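(* Let $(X,d)$ be a metric space, let $\mathfrak m$ be a Borel measure on $X$ and let $p\in[1,\infty)$. Let $\mathcal N^{1,p}_{\hat{TC}}(X)$, $N^{1,p}_{TC}(X)$, $M^{1,p}(X)$ and $G^{1,p}(X)$ be the $\hat{TC}$-Newtonian, $TC$-Newtonian, Hajłasz–Sobolev and Ambrosio–Gigli–Savaré-like spaces of $(X,d,\mathfrak m)$. Consider the natural maps $[f]\mapsto[f]$. Then: (1) The natural map $\mathcal N^{1,p}_{\hat{TC}}(X)\to N^{1,p}_{TC}(X)$ is a well-defined bounded injective linear map; the natural map $N^{1,p}_{TC}(X)\to M^{1,p}(X)$ is a well-defined bounded linear map (not necessarily injective) whose kernel consists of the equivalence classes of functions equal to $0$ $\mathfrak m$-almost everywhere; and the natural map $\mathcal N^{1,p}_{\hat{TC}}(X)\to M^{1,p}(X)$ is a bounded injective linear map. (2) If $\mathfrak m$ is Borel regular, then the natural maps $\mathcal N^{1,p}_{\hat{TC}}(X)\to N^{1,p}_{TC}(X)\to M^{1,p}(X)$ are both bounded injective linear maps. (3) If $\mathfrak m$ is $\sigma$-finite and Borel regular, then the natural maps $\mathcal N^{1,p}_{\hat{TC}}(X)\to N^{1,p}_{TC}(X)\to M^{1,p}(X)$ are linear isomorphisms with bounded inverses (so the three spaces coincide with equivalent norms), and the natural map $M^{1,p}(X)\to G^{1,p}(X)$ is a well-defined bounded injective linear map. (4) If $\mathfrak m$ is doubling and Borel regular, then in addition the natural map $M^{1,p}(X)\to G^{1,p}(X)$ is a linear isomorphism with bounded inverse,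 so that $\mathcal N^{1,p}_{\hat{TC}}(X)\cong N^{1,p}_{TC}(X)\cong M^{1,p}(X)\cong G^{1,p}(X)$.
   Context: Conventions. $|\infty-\infty|=|(-\infty)-(-\infty)|=\infty$. A Borel measure on $X$ is a measure whose $\sigma$-algebra of measurable sets contains the Borel sets; it is Borel regular if every (measurable) set is contained in a Borel set of the same measure; it is doubling if there is $C$ with $0<\mathfrak m(B(x,2r))\le C\,\mathfrak m(B(x,r))<\infty$ for all $x\in X$, $r>0$. Test curves. For $\gamma:[a,b]\to X$ let $V(\gamma)=\sup\sum_{i=1}^n d(\gamma(t_i),\gamma(t_{i-1}))$ over partitions $a=t_0<\dots<t_n=b$. $TC([a,b];X)$ is the set of $\gamma:[a,b]\to X$ with $V(\gamma)<\infty$ that are right-continuous on $[a,b)$, left-continuous at $b$, and for which $\gamma(t^-)=\lim_{s\to t^-}\gamma(s)$ exists in $X$ for every $t\in(a,b)$. Put $\gamma(a^-)=\gamma(a)$. The reversal is $\overleftarrow\gamma(t)=\gamma((a+b-t)^-)$; it is again a test curve. $V_\gamma(t)=V(\gamma|_{[a,t]})$ is nondecreasing and right-continuous; $\mu_\gamma$ is the Borel measure on $[a,b]$ with $\mu_\gamma((r,t])=V_\gamma(t)-V_\gamma(r)$ for $r<t$ and $\mu_\gamma(\{a\})=0$. For Borel $g:X\to[0,\infty]$, $\int_\gamma g=\int_{[a,b]}g\circ\gamma\,d\mu_\gamma$, and the symmetrized integral is $\int^S_\gamma g=\frac12\left(\int_\gamma g+\int_{\overleftarrow\gamma}g\right)$.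 Topology. $TC([0,1];X)$ carries the metric $d_{TC}(\gamma,\gamma')=\int_0^1\min(1,d(\gamma(t),\gamma'(t)))\,dt$; Borel sets and Borel measures on it are with respect to this metric. $TC_0$ denotes the set of $\gamma\in TC([0,1];X)$ with $V(\gamma)>0$ (a Borel set). The maps $\gamma\mapsto\int^S_\gamma g$, $\gamma\mapsto V(\gamma)$ and $e_t(\gamma)=\gamma(t)$ are Borel. $TC$-Newtonian space. For $\Gamma\subseteq TC_0$, $\mathrm{Mod}^p(\Gamma)=\inf\int_X\rho^p\,d\mathfrak m$ over Borel $\rho:X\to[0,\infty]$ with $\int^S_\gamma\rho\ge1$ for all $\gamma\in\Gamma$. A Borel $g:X\to[0,\infty]$ is a $p$-weak upper $S$-gradient of $f$ if $|f(\gamma(1))-f(\gamma(0))|\le\int^S_\gamma g$ for all $\gamma\in TC_0$ outside a family of $\mathrm{Mod}^p$ zero. $\tilde N^{1,p}_{TC}(X)$ is the set of ($\mathfrak m$-measurable) $f:X\to\mathbb R$ with $\int_X|f|^p\,d\mathfrak m<\infty$ having a $p$-weak upper $S$-gradient in $L^p(\mathfrak m)$, with seminorm $\|f\|_{L^p(\mathfrak m)}+\inf_g\|g\|_{L^p(\mathfrak m)}$, infimum over all $p$-weak upper $S$-gradients $g$ of $f$. $N^{1,p}_{TC}(X)$ is its quotient by functions of seminorm zero. $\hat{TC}$-Newtonian space. Let $\mathcal M_0$ be the set of Borel measures $\mu$ on $TC([0,1];X)$ with $\mu(TC([0,1];X)\setminus TC_0)=0$, and $\int^S_\mu g=\int_{TC([0,1];X)}\int^S_\gamma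 g\,d\mu(\gamma)$. For $\Gamma\subseteq\mathcal M_0$, $\widetilde{\mathrm{Mod}}^p(\Gamma)=\inf\int_X\rho^p\,d\mathfrak m$ over Borel $\rho:X\to[0,\infty]$ with $\int^S_\mu\rho\ge1$ for all $\mu\in\Gamma$. For Borel $f$, a Borel $g:X\to[0,\infty]$ is a generalized $p$-weak upper $S$-gradient of $f$ if $\int_{TC([0,1];X)}|f(\gamma(1))-f(\gamma(0))|\,d\mu(\gamma)\le\int^S_\mu g$ for all $\mu\in\mathcal M_0$ outside a family of $\widetilde{\mathrm{Mod}}^p$ zero. $\tilde{\mathcal N}^{1,p}_{\hat{TC}}(X)$ is the set of Borel $f:X\to\mathbb R$ with $\int|f|^p\,d\mathfrak m<\infty$ having such a $g\in L^p(\mathfrak m)$, with seminorm $\|f\|_{L^p}+\inf_g\|g\|_{L^p}$ over generalized $p$-weak upper $S$-gradients; $\mathcal N^{1,p}_{\hat{TC}}(X)$ is its quotient by functions of seminorm zero. Ambrosio–Gigli–Savaré-like space. A Borel probability measure $\mu$ on $TC([0,1];X)$ is $\mathfrak m$-admissible if there is $C\ge0$ with $(e_t)_\#\mu(B)\le C\,\mathfrak m(B)$ for all $t\in[0,1]$ and Borel $B\subseteq X$, and $\int V(\gamma)\,d\mu(\gamma)<\infty$. For Borel $f$, a Borel $g:X\to[0,\infty]$ is an $\mathfrak m$-upper $S$-gradient of $f$ if $\int|f(\gamma(1))-f(\gamma(0))|\,d\mu(\gamma)\le\int^S_\mu g$ for all $\mathfrak m$-admissible $\mu\in\mathcal M_0$.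 $\tilde G^{1,p}(X)$ is the set of Borel $f:X\to\mathbb R$ with $\int|f|^p\,d\mathfrak m<\infty$ having an $\mathfrak m$-upper $S$-gradient in $L^p(\mathfrak m)$, with seminorm $\|f\|_{L^p}+\inf_g\|g\|_{L^p}$ over $\mathfrak m$-upper $S$-gradients; $G^{1,p}(X)$ is its quotient by functions of seminorm zero. Hajłasz–Sobolev space. A measurable $g:X\to[0,\infty]$ is a Hajłasz gradient of a measurable, a.e. finite $f$ if there is an $\mathfrak m$-null set $E$ with $|f(x)-f(y)|\le(g(x)+g(y))d(x,y)$ for all $x,y\in X\setminus E$. $M^{1,p}(X)$ is the set of $f\in L^p(\mathfrak m)$ (classes modulo a.e. equality) with a Hajłasz gradient in $L^p(\mathfrak m)$, normed by $\|f\|_{L^p}+\inf_g\|g\|_{L^p}$ over Hajłasz gradients. Natural maps. $\mathcal N^{1,p}_{\hat{TC}}\to N^{1,p}_{TC}$ sends the class of $f$ to the class of $f$; the maps into $M^{1,p}$ send the class of $f$ to its a.e.-equality class; $M^{1,p}\to G^{1,p}$ sends $f$ to the class in $G^{1,p}$ of any Borel function $f'\in\tilde G^{1,p}(X)$ with $f'=f$ $\mathfrak m$-a.e. (existence of such $f'$ and independence of the choice being part of well-definedness). *)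

(* Defs.v *)
From HB Require Import structures.
From mathcomp Require Import all_boot all_order all_algebra.
From mathcomp Require Import lra.
From mathcomp Require Import all_classical all_reals all_analysis.
From mathcomp Require Import measurable_realfun.

Set Implicit Arguments.
Unset Strict Implicit.
Unset Printing Implicit Defensive.

Import Order.TTheory GRing.Theory Num.Theory.
Import numFieldNormedType.Exports.

Local Open Scope classical_set_scope.
Local Open Scope ring_scope.

(* The library's measurable types are pointed, hence so are our metric spaces. *)
#[short(type="pmetricType")]
HB.structure Definition PMetric (R : numDomainType) :=
  { M of Metric R M & Pointed M }.

(** Variation of curves *)

Section variation.
Context {R : realType} {X : metricType R}.
Implicit Types (a b c t x y : R) (s : seq R) (g : R -> X).

(* [s] lists the points t_1 < ... < t_n = b of a partition a = t_0 < ... < t_n *)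
Definition mvariation a b g s : R :=
  let F := g \o nth b (a :: s) in
  \sum_(0 <= i < size s) mdist (F i.+1) (F i).

Definition mtotal_variation a b g : \bar R :=
  ereal_sup [set (mvariation a b g s)%:E | s in itv_partition a b].

Lemma mvariation_nil a b g : mvariation a b g [::] = 0.
Proof. by rewrite /mvariation big_nil. Qed.

Lemma mvariation_cons a b g x s :
  mvariation a b g (x :: s) = mdist (g x) (g a) + mvariation x b g s.
Proof. by rewrite /mvariation /= big_nat_recl. Qed.

Lemma mvariation_cat a b c g s r : itv_partition a b s ->
  mvariation a c g (s ++ r) = mvariation a b g s + mvariation b c g r.
Proof.
elim: s a => [|x s ih] a.
  by move=> /itv_partition_nil ->; rewrite mvariation_nil add0r.
by move=> /itv_partition_cons/ih e; rewrite /= !mvariation_cons e addrA.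
Qed.

Lemma mvariation_ge0 a b g s : 0 <= mvariation a b g s.
Proof. by rewrite sumr_ge0// => i _; exact: mdist_ge0. Qed.

Lemma mvariation_le a b g s : itv_partition a b s ->
  ((mvariation a b g s)%:E <= mtotal_variation a b g)%E.
Proof. by move=> h; apply: ereal_sup_ubound; exists s. Qed.

Lemma mtotal_variation_ge0 a b g : a <= b -> (0 <= mtotal_variation a b g)%E.
Proof.
rewrite le_eqVlt => /predU1P[->|ab].
  have h : itv_partition b b [::] by [].
  by rewrite (le_trans _ (mvariation_le g h))// mvariation_nil.
by rewrite (le_trans _ (mvariation_le g (itv_partition1 ab)))// lee_fin mvariation_ge0.
Qed.

Lemma mtotal_variationxx a g : mtotal_variation a a g = 0%E.
Proof.
apply/eqP; rewrite eq_le mtotal_variation_ge0// andbT.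
by apply/ge_ereal_sup => _ [s /itv_partitionxx -> <-]; rewrite mvariation_nil.
Qed.

Lemma mtotal_variation_catr a b c g s : a <= b -> itv_partition b c s ->
  (mtotal_variation a b g + (mvariation b c g s)%:E <= mtotal_variation a c g)%E.
Proof.
move=> ab bs; rewrite -leeBrDr//; apply/ge_ereal_sup => _ [r ar <-].
by rewrite leeBrDr// -EFinD -mvariation_cat//; apply/mvariation_le/itv_partition_cat/bs.
Qed.

Lemma mtotal_variation_nd a b c g : a <= b -> b <= c ->
  (mtotal_variation a b g <= mtotal_variation a c g)%E.
Proof.
move=> ab; rewrite le_eqVlt => /predU1P[->//|bc].
rewrite (le_trans _ (mtotal_variation_catr g ab (itv_partition1 bc)))//.
by rewrite leeDl// lee_fin mvariation_ge0.
Qed.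

(* inserting a point in a partition does not decrease the variation *)
Lemma mvariation_refine a b c g s : a <= c -> c < b -> itv_partition a b s ->
  exists s1 s2, [/\ itv_partition a c s1, itv_partition c b s2 &
    mvariation a b g s <= mvariation a c g s1 + mvariation c b g s2].
Proof.
elim: s a => [|x s ih] a.
  by move=> ac cb /itv_partition_nil ab; move: cb; rewrite -ab ltNge ac.
rewrite le_eqVlt => /predU1P[<-|ac] cb.
  by move=> abs; exists [::], (x :: s); split; rewrite // mvariation_nil add0r.
move=> abs; have xbs := itv_partition_cons abs.
have ax : a < x by case: abs => /= /andP[].
have [cx|xc] := ltP c x.
  exists [:: c], (x :: s); split; first exact: itv_partition1.
    by case: xbs => h1 h2; split; rewrite //= cx.
  rewrite !mvariation_cons mvariation_nil addr0 addrA lerD2r.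
  by rewrite addrC; exact: metric_triangle.
have [s1 [s2 [h1 h2 h3]]] := ih _ xc cb xbs.
exists (x :: s1), s2; split => //.
  by case: h1 => ? ?; split; rewrite //= ax.
by rewrite !mvariation_cons -addrA lerD2l.
Qed.

Lemma mtotal_variation_cvg_right a b x g : a <= x -> x < b ->
  (mtotal_variation a b g < +oo)%E -> g @ x^'+ --> g x ->
  fine (mtotal_variation a t g) @[t --> x^'+] --> fine (mtotal_variation a x g).
Proof.
move=> ax xb vfin gx.
have Vfin t : a <= t -> t <= b -> mtotal_variation a t g \is a fin_num.
  move=> at_ tb; rewrite ge0_fin_numE ?mtotal_variation_ge0//.
  by rewrite (le_lt_trans _ vfin)// mtotal_variation_nd.
apply/cvgrPdist_le => e e0.
have bfin := Vfin b (ltW (le_lt_trans ax xb)) (lexx b).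
have [|_ [s sab <-]] := @ub_ereal_sup_adherent R _ (e / 2) _ bfin.
  by rewrite divr_gt0.
rewrite -/(mtotal_variation a b g) => vs.
have [s1 [[|y s2] [h1 h2 h3]]] := mvariation_refine g ax xb sab.
  by move/itv_partition_nil : h2 xb => ->; rewrite ltxx.
have xy : x < y by case: h2 => /= /andP[].
have ybs := itv_partition_cons h2.
have e20 : 0 < e / 2 by rewrite divr_gt0.
have gnear : \forall t \near x^'+, mdist (g x) (g t) <= e / 2.
  by apply: metricType_numDomainType.cvgr_dist_le gx _ e20.
near=> t.
have xt : x < t by near: t; exact: nbhs_right_gt.
have ty : t < y by near: t; exact: nbhs_right_lt.
have gxt : mdist (g x) (g t) <= e / 2 by near: t.
have tb : t <= b by rewrite (le_trans (ltW ty))// (itv_partition_le ybs).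
have at_ : a <= t by rewrite (le_trans ax)// ltW.
have tys : itv_partition t b (y :: s2).
  by case: ybs => ? ?; split; rewrite //= ty.
have tfin := Vfin _ at_ tb.
have xfin := Vfin _ ax (ltW xb).
have mono := mtotal_variation_nd g ax (ltW xt).
rewrite distrC ger0_norm; last by rewrite subr_ge0 fine_le.
rewrite lerBlDr -lee_fin EFinD !fineK//.
have up := mtotal_variation_catr g at_ tys.
have lo := mvariation_le g h1.
rewrite -(fineK xfin) -(fineK tfin) -(fineK bfin) in up lo vs *.
move: up lo vs; rewrite -!EFinD !lee_fin lte_fin => up lo vs.
have tri : mvariation x b g (y :: s2) <= e / 2 + mvariation t b g (y :: s2).
  rewrite !mvariation_cons.
  have := metric_triangle (g y) (g t) (g x); rewrite (metric_sym (g t)); lra.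
have := splitr e; lra.
Unshelve. all: by end_near. Qed.

Lemma mdist_le_variation a b x y g : a <= x -> x <= y -> y <= b ->
  (mtotal_variation a b g < +oo)%E ->
  mdist (g x) (g y) <= fine (mtotal_variation a y g) - fine (mtotal_variation a x g).
Proof.
move=> ax xy yb vfin.
have Vfin t : a <= t -> t <= b -> mtotal_variation a t g \is a fin_num.
  move=> at_ tb; rewrite ge0_fin_numE ?mtotal_variation_ge0//.
  by rewrite (le_lt_trans _ vfin)// mtotal_variation_nd.
move: xy; rewrite le_eqVlt => /predU1P[->|xy]; first by rewrite mdistxx subrr.
have := mtotal_variation_catr g ax (itv_partition1 xy).
rewrite -(@fineK _ (mtotal_variation a x g)) ?Vfin//; last first.
  by rewrite (le_trans (ltW xy)).
rewrite -(@fineK _ (mtotal_variation a y g)) ?Vfin//; last first.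
  by rewrite (le_trans ax)// ltW.
rewrite -EFinD lee_fin mvariation_cons mvariation_nil addr0 => h.
by rewrite lerBrDl metric_sym.
Qed.

End variation.

Lemma cvg_near_eq (T : Type) (U : topologicalType) (F : set_system T)
  (f : T -> U) (l : U) : Filter F ->
  (\forall x \near F, f x = l) -> f @ F --> l.
Proof.
move=> FF fl A /nbhs_singleton Al; apply: filterS fl => x fxl.
by rewrite /= fxl.
Qed.

(** Test curves *)

(* A curve on [0, 1] is represented by its extension to R that is constant on
   each side of [0, 1]. The convention gamma(0^-) = gamma(0) is thus a property
   of the left limit at 0. *)
Record test_curve (R : realType) (X : metricType R) := TestCurve {
  tc_fun :> R -> X ;
  tc_const_left : forall t : R, t < 0 -> tc_fun t = tc_fun 0 ;
  tc_const_right : forall t : R, 1 < t -> tc_fun t = tc_fun 1 ;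
  tc_variation_fin : (mtotal_variation 0 1 tc_fun < +oo)%E ;
  tc_cvg_right : forall t : R, 0 <= t -> t < 1 -> tc_fun @ t^'+ --> tc_fun t ;
  tc_cvg_left1 : tc_fun @ 1^'- --> tc_fun 1 ;
  tc_cvg_left : forall t : R, 0 < t -> t < 1 ->
    exists l : X, tc_fun @ t^'- --> l }.

Section test_curve_theory.
Context {R : realType} {X : metricType R}.
Implicit Types (g : test_curve X) (t x y : R).

Definition curve_length g : \bar R := mtotal_variation 0 1 g.

(* V_gamma, extended by 0 on the left and by V(gamma) on the right of [0, 1] *)
Definition curve_variation g t : R :=
  fine (mtotal_variation 0 (Num.min 1 (Num.max 0 t)) g).

Let clamp t : R := Num.min 1 (Num.max 0 t).

Let clamp_ge0 t : 0 <= clamp t.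
Proof. by rewrite /clamp le_min ler01 le_max lexx. Qed.

Let clamp_le1 t : clamp t <= 1.
Proof. by rewrite /clamp ge_min lexx. Qed.

Let clamp_id t : 0 <= t -> t <= 1 -> clamp t = t.
Proof. by move=> t0 t1; rewrite /clamp max_r// min_r. Qed.

Let clamp_lt0 t : t <= 0 -> clamp t = 0.
Proof. by move=> t0; rewrite /clamp max_l// min_r. Qed.

Let clamp_gt1 t : 1 <= t -> clamp t = 1.
Proof. by move=> t1; rewrite /clamp min_l// le_max t1 orbT. Qed.

Let clamp_nd x y : x <= y -> clamp x <= clamp y.
Proof.
move=> xy; rewrite /clamp le_min ge_min lexx/= ge_min; apply/orP; right.
by rewrite ge_max le_max lexx/= le_max xy orbT.
Qed.

Lemma tc_clamp g t : g (Num.min 1 (Num.max 0 t)) = g t.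
Proof.
rewrite -/(clamp t); have [t0|t0] := ltP t 0.
  by rewrite clamp_lt0 ?ltW// tc_const_left.
have [t1|t1] := ltP 1 t; first by rewrite clamp_gt1 ?ltW// tc_const_right.
by rewrite clamp_id.
Qed.

Let variation_fin g t : mtotal_variation 0 (clamp t) g \is a fin_num.
Proof.
rewrite ge0_fin_numE ?mtotal_variation_ge0//.
by rewrite (le_lt_trans _ (tc_variation_fin g))// mtotal_variation_nd.
Qed.

Lemma tc_right_continuous g t : g @ t^'+ --> g t.
Proof.
have [t0|t0] := ltP t 0.
  apply: cvg_near_eq.
  near=> x.
  have x0 : x < 0 by near: x; exact: nbhs_right_lt.
  by rewrite (tc_const_left g x0) (tc_const_left g t0).
have [t1|t1] := ltP t 1; first exact: tc_cvg_right.
apply: cvg_near_eq.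
near=> x.
have tx : t < x by near: x; exact: nbhs_right_gt.
rewrite (tc_const_right g (le_lt_trans t1 tx)).
by move: t1; rewrite le_eqVlt => /predU1P[<-//|/(tc_const_right g)].
Unshelve. all: by end_near. Qed.

Lemma tc_left_limit g t : exists l : X, g @ t^'- --> l.
Proof.
have [t0|t0] := leP t 0.
  exists (g 0); apply: cvg_near_eq; near=> x.
  by rewrite tc_const_left// (lt_le_trans _ t0)//; near: x; exact: nbhs_left_lt.
have [t1|] := ltP t 1; first exact: tc_cvg_left.
rewrite le_eqVlt => /predU1P[<-|t1]; first by exists (g 1); exact: tc_cvg_left1.
exists (g 1); apply: cvg_near_eq; near=> x.
by rewrite tc_const_right//; near: x; exact: nbhs_left_gt.
Unshelve. all: by end_near. Qed.

Lemma curve_variation_nd g : {homo curve_variation g : x y / x <= y}.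
Proof.
move=> x y xy; apply: fine_le; [exact: variation_fin..|].
by apply: mtotal_variation_nd; [exact: clamp_ge0|exact: clamp_nd].
Qed.

Lemma curve_variation_le1 g t : curve_variation g t <= curve_variation g 1.
Proof.
apply: fine_le; [exact: variation_fin..|].
apply: mtotal_variation_nd; first exact: clamp_ge0.
by rewrite -!/(clamp _) (clamp_gt1 (lexx 1)); exact: clamp_le1.
Qed.

Lemma curve_variation_right_continuous g t :
  curve_variation g @ t^'+ --> curve_variation g t.
Proof.
have [t0|t0] := ltP t 0.
  apply: cvg_near_eq; near=> x; rewrite /curve_variation -!/(clamp _).
  by rewrite !clamp_lt0 ?ltW//; near: x; exact: nbhs_right_lt.
have [t1|t1] := ltP t 1; last first.
  apply: cvg_near_eq; near=> x; rewrite /curve_variation -!/(clamp _).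
  by rewrite !clamp_gt1// ltW// (le_lt_trans t1)//; near: x; exact: nbhs_right_gt.
have := mtotal_variation_cvg_right t0 t1 (tc_variation_fin g) (tc_cvg_right t0 t1).
rewrite -[in X in _ --> X -> _](clamp_id t0 (ltW t1)); apply: cvg_trans.
apply: near_eq_cvg; near=> x.
rewrite /curve_variation -!/(clamp _) clamp_id//.
  by rewrite (le_trans t0)// ltW//; near: x; exact: nbhs_right_gt.
by rewrite ltW//; near: x; exact: nbhs_right_lt.
Unshelve. all: by end_near. Qed.

HB.instance Definition _ g := isCumulative.Build R _ R (curve_variation g)
  (@curve_variation_nd g) (@curve_variation_right_continuous g).

Lemma mdist_le_curve_variation g x y : x <= y ->
  mdist (g x) (g y) <= curve_variation g y - curve_variation g x.
Proof.
move=> xy; rewrite -(tc_clamp g x) -(tc_clamp g y).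
apply: (mdist_le_variation _ _ _ (tc_variation_fin g)).
- exact: clamp_ge0.
- exact: clamp_nd.
- exact: clamp_le1.
Qed.

End test_curve_theory.

(** Reversal *)

Section reversal.
Context {R : realType} {X : pmetricType R}.
Implicit Types (g : test_curve X) (t x y : R).

Definition left_lim g t : X := lim (g @ t^'-).

Lemma left_lim_cvg g t : g @ t^'- --> left_lim g t.
Proof. by have [l gl] := tc_left_limit g t; apply/cvg_ex; exists l. Qed.

Let ghausdorff : hausdorff_space X. Proof. exact: metric_hausdorff. Qed.

Lemma left_lim_eq g t l : g @ t^'- --> l -> left_lim g t = l.
Proof. by move=> gl; apply: cvg_lim. Qed.

Let near_left g t (e : R) : 0 < e ->
  \forall u \near t^'-, mdist (left_lim g t) (g u) <= e.
Proof.
move=> e0.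
by apply: metricType_numDomainType.cvgr_dist_le (@left_lim_cvg g t) _ e0.
Qed.

Let left_lim_near g t (l : X) (e d : R) :
  d < t -> (forall u, d < u -> u < t -> mdist l (g u) <= e) ->
  mdist l (left_lim g t) <= e.
Proof.
move=> dt H; apply/ler_addgt0Pr => r r0.
near t^'- => u.
have du : d < u by near: u; exact: nbhs_left_gt.
have ut : u < t by near: u; exact: nbhs_left_lt.
have gu : mdist (left_lim g t) (g u) <= r by near: u; exact: near_left.
rewrite (le_trans (metric_triangle _ (g u) _))// lerD ?H//.
by rewrite metric_sym.
Unshelve. all: by end_near. Qed.

Let rev g t : X := left_lim g (1 - t).

Let rev_right g t : rev g @ t^'+ --> rev g t.
Proof.
apply/metricType_numDomainType.cvgrPdist_le => e e0.
have [d /= d0 H] := near_left g (1 - t) e0.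
near=> s.
have ts : t < s by near: s; exact: nbhs_right_gt.
have sd : s < t + d by near: s; apply: nbhs_right_lt; rewrite ltrDl.
apply: (@left_lim_near _ _ _ _ (1 - t - d)); first by lra.
move=> u u1 u2; apply: H; last by lra.
by rewrite /= ltr_norml; apply/andP; split; lra.
Unshelve. all: by end_near. Qed.

Let rev_left g t : rev g @ t^'- --> g (1 - t).
Proof.
apply/metricType_numDomainType.cvgrPdist_le => e e0.
have : \forall u \near (1 - t)^'+, mdist (g (1 - t)) (g u) <= e.
  by apply: metricType_numDomainType.cvgr_dist_le (@tc_right_continuous _ _ _ _) _ e0.
move=> [d /= d0 H].
near=> s.
have ts : s < t by near: s; exact: nbhs_left_lt.
have sd : t - d < s by near: s; apply: nbhs_left_gt; rewrite ltrBlDr ltrDl.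
apply: (@left_lim_near _ _ _ _ (1 - t)); first by lra.
move=> u u1 u2; apply: H; last by [].
by rewrite /= ltr_norml; apply/andP; split; lra.
Unshelve. all: by end_near. Qed.

Let rev0 g : rev g 0 = g 1.
Proof. by apply: left_lim_eq; rewrite subr0; exact: tc_cvg_left1. Qed.

Let left_lim_le0 g t : t <= 0 -> left_lim g t = g 0.
Proof.
move=> t0; apply: left_lim_eq.
apply: cvg_near_eq; near=> x.
by rewrite tc_const_left// (lt_le_trans _ t0)//; near: x; exact: nbhs_left_lt.
Unshelve. all: by end_near. Qed.

Let rev1 g : rev g 1 = g 0.
Proof. by rewrite /rev left_lim_le0// subrr. Qed.

Let rev_const_left g t : t < 0 -> rev g t = rev g 0.
Proof.
move=> t0; rewrite rev0; apply: left_lim_eq.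
apply: cvg_near_eq; near=> x.
rewrite tc_const_right//; near: x; apply: nbhs_left_gt.
by rewrite ltrDl oppr_gt0.
Unshelve. all: by end_near. Qed.

Let rev_const_right g t : 1 < t -> rev g t = rev g 1.
Proof.
by move=> t1; rewrite rev1 /rev left_lim_le0// subr_le0 ltW.
Qed.

Let U g t := lim (curve_variation g @ t^'-).

Let U_cvg g t : curve_variation g @ t^'- --> U g t.
Proof.
apply: nondecreasing_at_left_is_cvgr; near=> r.
  by move=> x y _ _; exact: curve_variation_nd.
exists (curve_variation g 1) => _ [u _ <-].
exact: curve_variation_le1.
Unshelve. all: by end_near. Qed.

Let mdist_left_lim g x y : x < y ->
  mdist (left_lim g x) (left_lim g y) <= U g y - U g x.
Proof.
move=> xy; apply/ler_addgt0Pr => e e0.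
have e40 : 0 < e / 4 by rewrite divr_gt0.
near x^'- => u. near y^'- => v.
have ux : u < x by near: u; exact: nbhs_left_lt.
have xv : x < v by near: v; exact: nbhs_left_gt.
have gu : mdist (left_lim g x) (g u) <= e / 4 by near: u; exact: near_left.
have gv : mdist (left_lim g y) (g v) <= e / 4 by near: v; exact: near_left.
have Wu : `|U g x - curve_variation g u| <= e / 4.
  near: u; move/cvgrPdist_le : (@U_cvg g x); exact.
have Wv : `|U g y - curve_variation g v| <= e / 4.
  near: v; move/cvgrPdist_le : (@U_cvg g y); exact.
have guv := mdist_le_curve_variation g (ltW (lt_trans ux xv)).
have t1 := metric_triangle (left_lim g x) (g u) (left_lim g y).
have t2 := metric_triangle (g u) (g v) (left_lim g y).
rewrite (metric_sym (g v)) in t2.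
move: Wu Wv; rewrite !ler_norml => /andP[? ?] /andP[? ?].
lra.
Unshelve. all: by end_near. Qed.

Let rev_variation_fin g : (mtotal_variation 0 1 (rev g) < +oo)%E.
Proof.
suff H s a b : itv_partition a b s ->
    mvariation a b (rev g) s <= U g (1 - a) - U g (1 - b).
  apply: (@le_lt_trans _ _ (U g (1 - 0) - U g (1 - 1))%:E); last exact: ltry.
  by apply/ge_ereal_sup => _ [s /H h <-]; rewrite lee_fin.
elim: s a => [|x s ih] a.
  by move=> /itv_partition_nil ->; rewrite mvariation_nil subrr.
move=> h; have ax : a < x by case: h => /= /andP[].
rewrite mvariation_cons; have := ih _ (itv_partition_cons h).
have : mdist (rev g x) (rev g a) <= U g (1 - a) - U g (1 - x).
  by apply: mdist_left_lim; lra.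
lra.
Qed.

Let rev_left1 g : rev g @ 1^'- --> rev g 1.
Proof. by rewrite rev1; have := @rev_left g 1; rewrite subrr; exact. Qed.

Let rev_left_ex g t : exists l : X, rev g @ t^'- --> l.
Proof. by exists (g (1 - t)); exact: rev_left. Qed.

Definition reversal g : test_curve X :=
  @TestCurve R X (fun t => left_lim g (1 - t))
    (@rev_const_left g) (@rev_const_right g) (rev_variation_fin g)
    (fun t _ _ => @rev_right g t) (@rev_left1 g) (fun t _ _ => rev_left_ex g t).

End reversal.

Section constant_curve.
Context {R : realType} {X : pmetricType R}.

Let cst_variation : (mtotal_variation (0 : R) 1 (fun=> point : X) < +oo)%E.
Proof.
apply: (@le_lt_trans _ _ 0%E); last exact: ltry.
apply/ge_ereal_sup => _ [s _ <-]; rewrite lee_fin /mvariation big1// => i _.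
exact: mdistxx.
Qed.

Let cst_left (t : R) : exists l : X, (fun=> point : X) @ t^'- --> l.
Proof. by exists point; exact: cvg_cst. Qed.

Definition constant_curve : test_curve X :=
  @TestCurve R X (fun=> point) (fun _ _ => erefl) (fun _ _ => erefl)
    cst_variation (fun _ _ _ => cvg_cst _) (cvg_cst _)
    (fun t _ _ => cst_left t).

HB.instance Definition _ := gen_eqMixin (test_curve X).
HB.instance Definition _ := gen_choiceMixin (test_curve X).
HB.instance Definition _ := isPointed.Build (test_curve X) constant_curve.

End constant_curve.

(** Borel measures *)

(* [op] is the collection of open sets of [T]; the domain [bm_sets] of the
   measure is any sigma-algebra that contains the Borel sets, so that
   [<<s bm_sets>> = bm_sets]. *)
Record borel_measure (R : realType) (T : pointedType) (op : set (set T)) :=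
  BorelMeasure {
    bm_sets : set (set T) ;
    bm_sigma_algebra : sigma_algebra setT bm_sets ;
    bm_borel : op `<=` bm_sets ;
    bm_meas :> {measure set (g_sigma_algebraType bm_sets) -> \bar R} }.

Definition borel_fun {T : pointedType} (op : set (set T)) d
    (U : measurableType d) (f : T -> U) : Prop :=
  measurable_fun [set: g_sigma_algebraType op] (f : g_sigma_algebraType op -> U).

Section measures.
Context {R : realType} {X : pmetricType R}.
Implicit Types (m : borel_measure R (@open X)).

(* nonnegative Borel functions X -> [0, +oo] *)
Definition borel_nonneg : set (X -> \bar R) :=
  [set g : X -> \bar R | borel_fun (@open X) g /\ forall x, (0 <= g x)%E].

Definition borel_regular m : Prop :=
  forall A, bm_sets m A ->
    exists B, [/\ <<s @open X >> B, A `<=` B & m B = m A].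

Definition doubling m : Prop :=
  exists C : R, forall (x : X) (r : R), 0 < r ->
    [/\ (0 < m (ball x (2 * r)))%E,
        (m (ball x (2 * r)) <= C%:E * m (ball x r))%E &
        (C%:E * m (ball x r) < +oo)%E].

Definition in_Lp m (p : R) (f : X -> \bar R) : Prop :=
  (\int[m]_x (`|f x| `^ p) < +oo)%E.

(** Integrals along curves *)

Definition curve_integral (g : test_curve X) (h : X -> \bar R) : \bar R :=
  (\int[lebesgue_stieltjes_measure (curve_variation g)]_(t in `[0%R, 1%R])
     h (g t))%E.

Definition sym_curve_integral (g : test_curve X) (h : X -> \bar R) : \bar R :=
  (2^-1%:E * (curve_integral g h + curve_integral (reversal g) h))%E.

Definition dTC (g g' : test_curve X) : \bar R :=
  (\int[lebesgue_measure]_(t in `[0%R, 1%R])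
     (Num.min 1 (mdist (g t) (g' t)))%:E)%E.

Definition TC_open : set (set (test_curve X)) :=
  [set A | forall g, A g ->
    exists2 e : R, 0 < e & forall g', (dTC g g' < e%:E)%E -> A g'].

Definition TC0 : set (test_curve X) := [set g | (0 < curve_length g)%E].

Definition M0 : set (borel_measure R TC_open) :=
  [set mu | mu (~` TC0) = 0%E].

Definition sym_measure_integral (mu : borel_measure R TC_open)
    (h : X -> \bar R) : \bar R :=
  (\int[mu]_g sym_curve_integral g h)%E.

(** Moduli and upper gradients *)

Section sobolev.
Variables (m : borel_measure R (@open X)) (p : R).
Implicit Types (f : X -> R) (g : X -> \bar R).

(* The modulus of a family of objects along which functions can be integrated:
   the p-modulus for I = sym_curve_integral, and its generalization to
   families of measures for I = sym_measure_integral. *)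
Definition modulus (T : Type) (I : T -> (X -> \bar R) -> \bar R)
    (F : set T) : \bar R :=
  ereal_inf [set (\int[m]_x (rho x `^ p))%E | rho in
    [set rho | borel_nonneg rho /\ forall c, F c -> (1 <= I c rho)%E]].

Definition weak_upper_gradient f : set (X -> \bar R) :=
  [set g | borel_nonneg g /\
    exists2 E : set (test_curve X),
      E `<=` TC0 /\ modulus sym_curve_integral E = 0%E &
      forall c, (TC0 `\` E) c ->
        (`|f (c 1) - f (c 0)|%:E <= sym_curve_integral c g)%E].

Definition curve_oscillation f (mu : borel_measure R TC_open) : \bar R :=
  (\int[mu]_c `|f (c 1%R) - f (c 0%R)|%:E)%E.

Definition generalized_weak_upper_gradient f : set (X -> \bar R) :=
  [set g | borel_nonneg g /\
    exists2 E : set (borel_measure R TC_open),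
      E `<=` M0 /\ modulus sym_measure_integral E = 0%E &
      forall mu, (M0 `\` E) mu ->
        (curve_oscillation f mu <= sym_measure_integral mu g)%E].

Definition admissible (mu : borel_measure R TC_open) : Prop :=
  [/\ mu setT = 1%E,
      exists2 C : R, 0 <= C & forall (t : R) (B : set X), 0 <= t <= 1 ->
        <<s @open X >> B ->
        (mu [set c | B (c t)] <= C%:E * m B)%E &
      (\int[mu]_c curve_length c < +oo)%E].

Definition m_upper_gradient f : set (X -> \bar R) :=
  [set g | borel_nonneg g /\
    forall mu, M0 mu -> admissible mu ->
      (curve_oscillation f mu <= sym_measure_integral mu g)%E].

(* In [\bar R], `|+oo - +oo| = `|-oo - -oo| = +oo. *)
Definition hajlasz_gradient (f : X -> \bar R) : set (X -> \bar R) :=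
  [set g | [/\ measurable_fun [set: g_sigma_algebraType (bm_sets m)] g,
    forall x, (0 <= g x)%E &
    exists2 E, bm_sets m E /\ m E = 0%E &
      forall x y, ~ E x -> ~ E y ->
        (`|f x - f y| <= (g x + g y) * (mdist x y)%:E)%E]].

Definition sobolev_norm (f : X -> \bar R) (G : set (X -> \bar R)) : \bar R :=
  ('N[m]_p%:E[f] + ereal_inf [set 'N[m]_p%:E[g] | g in G])%E.

End sobolev.
End measures.

(** Quotients of function spaces *)

(* A set of functions with pointwise operations, an equivalence relation and a
   seminorm, from which a space of equivalence classes is formed. *)
Record fun_space (R : realType) := FunSpace {
  fs_sort : Type ;
  fs_mem : set fs_sort ;
  fs_eqv : fs_sort -> fs_sort -> Prop ;
  fs_zero : fs_sort ;
  fs_add : fs_sort -> fs_sort -> fs_sort ;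
  fs_scale : R -> fs_sort -> fs_sort ;
  fs_norm : fs_sort -> \bar R }.

Arguments fs_mem {R} S _ : rename.
Arguments fs_eqv {R} S _ _ : rename.
Arguments fs_zero {R} S : rename.
Arguments fs_norm {R} S _ : rename.

Section quotient.
Context {R : realType}.
Implicit Types S : fun_space R.

(* the equivalence class of a function, as a set of functions *)
Definition fs_class S (f : fs_sort S) : set (fs_sort S) :=
  [set f' | fs_mem S f' /\ fs_eqv S f f'].

Arguments fs_class : clear implicits.

Definition fs_quot S : set (set (fs_sort S)) :=
  [set fs_class S f | f in fs_mem S].

Definition class_zero S : set (fs_sort S) := fs_class S (fs_zero S).

Definition class_add S (a b : set (fs_sort S)) : set (fs_sort S) :=
  \bigcup_(f in a) \bigcup_(g in b) fs_class S (fs_add f g).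

Definition class_scale S (c : R) (a : set (fs_sort S)) : set (fs_sort S) :=
  \bigcup_(f in a) fs_class S (fs_scale c f).

Definition class_norm S (a : set (fs_sort S)) : \bar R :=
  ereal_inf [set fs_norm S f | f in a].

(* The functions form a vector space on which the relation is a congruence, so
   that the operations on classes are well defined. *)
Definition linear_quotient S : Prop :=
  [/\ fs_mem S (fs_zero S),
      forall f g : fs_sort S, fs_mem S f -> fs_mem S g -> fs_mem S (fs_add f g) &
      forall c (f : fs_sort S), fs_mem S f -> fs_mem S (fs_scale c f)] /\
  [/\ forall f : fs_sort S, fs_mem S f -> fs_eqv S f f,
      forall f g : fs_sort S, fs_mem S f -> fs_mem S g -> fs_eqv S f g -> fs_eqv S g f,
      forall f g h : fs_sort S, fs_mem S f -> fs_mem S g -> fs_mem S h ->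
        fs_eqv S f g -> fs_eqv S g h -> fs_eqv S f h,
      forall f f' g g' : fs_sort S,
        fs_mem S f -> fs_mem S f' -> fs_mem S g -> fs_mem S g' ->
        fs_eqv S f f' -> fs_eqv S g g' -> fs_eqv S (fs_add f g) (fs_add f' g') &
      forall c (f f' : fs_sort S), fs_mem S f -> fs_mem S f' ->
        fs_eqv S f f' -> fs_eqv S (fs_scale c f) (fs_scale c f')].

Arguments fs_quot : clear implicits.
Arguments class_zero : clear implicits.

Section maps.
Variables A B : fun_space R.
Implicit Types T : set (fs_sort A) -> set (fs_sort B).

(* [r f f'] reads: the class of f may be sent to the class of f' *)
Variable r : fs_sort A -> fs_sort B -> Prop.

Definition natural_map (a : set (fs_sort A)) : set (fs_sort B) :=
  \bigcup_(f in a) \bigcup_(f' in [set f' | fs_mem B f' /\ r f f']) fs_class B f'.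

Definition well_defined : Prop :=
  (forall f, fs_mem A f -> exists2 f', fs_mem B f' & r f f') /\
  (forall f g f' g',
    fs_mem A f -> fs_mem A g -> fs_mem B f' -> fs_mem B g' ->
    r f f' -> r g g' -> fs_eqv A f g -> fs_eqv B f' g').

Definition bounded_linear T : Prop :=
  [/\ linear_quotient A /\ linear_quotient B,
      set_fun (fs_quot A) (fs_quot B) T,
      forall a b, fs_quot A a -> fs_quot A b ->
        T (class_add a b) = class_add (T a) (T b),
      forall c a, fs_quot A a -> T (class_scale c a) = class_scale c (T a) &
      exists2 C : R, 0 <= C &
        forall a, fs_quot A a -> (class_norm (T a) <= C%:E * class_norm a)%E].

End maps.

(* linear isomorphism, bounded with bounded inverse *)
Definition bounded_isomorphism (A B : fun_space R)
    (T : set (fs_sort A) -> set (fs_sort B)) : Prop :=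
  bounded_linear T /\
  exists T' : set (fs_sort B) -> set (fs_sort A),
    [/\ bounded_linear T', {in fs_quot A, cancel T T'} &
        {in fs_quot B, cancel T' T}].

End quotient.

(** The four Sobolev spaces *)

Section spaces.
Context {R : realType} {X : pmetricType R}.
Variables (m : borel_measure R (@open X)) (p : R).

(* Real-valued functions f with finite L^p norm and a gradient in L^p, modulo
   functions of seminorm zero. [P] is the measurability required of f and
   [G f] is the set of gradients of f. *)
Definition gradient_space (P : (X -> R) -> Prop)
    (G : (X -> R) -> set (X -> \bar R)) : fun_space R :=
  let N f := sobolev_norm m p (EFin \o f) (G f) in
  @FunSpace R (X -> R)
    [set f | [/\ P f, in_Lp m p (EFin \o f) &
                 exists2 g, G f g & in_Lp m p g]]
    (fun f g => N (f \- g) = 0%E)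
    (cst 0) (fun f g => f \+ g) (fun c f => c \*o f) N.

Definition newtonian_TC : fun_space R :=
  gradient_space
    (fun f => measurable_fun [set: g_sigma_algebraType (bm_sets m)] f)
    (weak_upper_gradient m p).

Definition newtonian_hTC : fun_space R :=
  gradient_space (fun f => borel_fun (@open X) f)
    (generalized_weak_upper_gradient m p).

Definition ags_space : fun_space R :=
  gradient_space (fun f => borel_fun (@open X) f) (m_upper_gradient m).

(* Extended real-valued functions, modulo almost everywhere equality. *)
Definition hajlasz_space : fun_space R :=
  @FunSpace R (X -> \bar R)
    [set f | [/\ measurable_fun [set: g_sigma_algebraType (bm_sets m)] f,
                 {ae m, forall x, f x \is a fin_num}, in_Lp m p f &
                 exists2 g, hajlasz_gradient m f g & in_Lp m p g]]
    (fun f g => {ae m, forall x, f x = g x})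
    (cst 0%E) (fun f g => (f \+ g)%E) (fun c f => fun x => (c%:E * f x)%E)
    (fun f => sobolev_norm m p f (hajlasz_gradient m f)).

Definition hTC_TC_rel (f : fs_sort newtonian_hTC) (f' : fs_sort newtonian_TC) :=
  f' = f.

Definition TC_hajlasz_rel (f : fs_sort newtonian_TC) (f' : fs_sort hajlasz_space) :=
  f' = EFin \o f.

Definition hTC_hajlasz_rel (f : fs_sort newtonian_hTC)
    (f' : fs_sort hajlasz_space) :=
  f' = EFin \o f.

Definition hajlasz_ags_rel (f : fs_sort hajlasz_space) (f' : fs_sort ags_space) :=
  {ae m, forall x, (f' x)%:E = f x}.

Definition hTC_to_TC := natural_map hTC_TC_rel.
Definition TC_to_hajlasz := natural_map TC_hajlasz_rel.
Definition hTC_to_hajlasz := natural_map hTC_hajlasz_rel.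
Definition hajlasz_to_ags := natural_map hajlasz_ags_rel.

End spaces.

Arguments fs_class {R} S.
Arguments fs_quot {R} S.
Arguments class_zero {R} S.
Arguments hTC_TC_rel {R X} m p.
Arguments TC_hajlasz_rel {R X} m p.
Arguments hTC_hajlasz_rel {R X} m p.
Arguments hajlasz_ags_rel {R X} m p.
Arguments hTC_to_TC {R X} m p.
Arguments TC_to_hajlasz {R X} m p.
Arguments hTC_to_hajlasz {R X} m p.
Arguments hajlasz_to_ags {R X} m p.

(* Main.v *)
(* A family of curves (or of measures on curves) is negligible iff some Borel
   rho in L^p has infinite integral along all its members; adding rho to a weak
   gradient thus gives a gradient along every curve. The curve that jumps from x
   to y has symmetrized integral (g x + g y) d(x, y) / 2, so gradients along
   curves are Hajlasz gradients, and Dirac masses turn gradients along measures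
   into gradients along curves. If f = 0 off a Borel null set N, then integrating
   +oo on N forces f = 0 at the ends of almost every curve, which gives
   injectivity.

   Conversely, given a Hajlasz pair (f, g), one makes it Borel and valid at all
   pairs of points, with values +oo of g allowed, and lets f_j be the McShane
   extension of f from {g <= j}. A Lipschitz function with Hajlasz gradient G has
   upper gradient 10 G along every curve: cut the curve into n pieces of equal
   variation, choose in each a point where G is below average, and let n tend to
   infinity. Applied to f_i - f_j, this shows that f_j converges at the ends of
   every curve of finite g-integral, and the limit is a representative of f with
   upper gradient 20 g along every curve.

   Finally, if m is doubling and g is an m-upper gradient of f, then testing on
   the image under the jump map of m x m restricted to a set of pairs that
   violate the Hajlasz inequality shows that this set is null. Moving one of the
   points within the sublevel sets of g gives the inequality off a null set. *)

From HB Require Import structures.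
From mathcomp Require Import all_boot all_order all_algebra.
From mathcomp Require Import lra ring.
From mathcomp Require Import all_classical all_reals all_analysis.
From mathcomp Require Import measurable_realfun.
Require Import Defs.

Set Implicit Arguments.
Unset Strict Implicit.
Unset Printing Implicit Defensive.

Import Order.TTheory GRing.Theory Num.Theory.
Import numFieldNormedType.Exports.

Local Open Scope classical_set_scope.
Local Open Scope ring_scope.

(** The reversed curve runs through the left limits, so the integral of [g] along the reversal of
    [c] is the integral of [g (c (t^-))] against the variation measure of [c] itself. The
    symmetrized integral thus weighs each jump with the values of [g] at both of its ends, which is
    what a Hajlasz inequality between these ends requires. To subdivide a curve with jumps into
    pieces of equal variation, time is replaced by the variation parameter s in ]0, V(c)] through
    the quantile function: both integrals become Lebesgue integrals over this interval, and a jump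
    fills a subinterval on which the integrand is constant. Neither integral sees the end points of
    the curve: 0 carries no mass, and 1 is not an atom. Statements about the values at the ends are
    therefore reached as limits along tails of the curve, which is why curves started at a later
    time appear. *)

Import HBNNSimple.

(** * Lower integrals and L^p seminorms *)

Section lower_integral.
Context d (T : measurableType d) (R : realType).
Variable mu : {measure set T -> \bar R}.
Implicit Types f g : T -> \bar R.
Local Open Scope ereal_scope.

(* The integral of a nonnegative function is defined as a lower integral, so no
   measurability is needed here. This matters for integrals over curves, which
   need not be measurable functions of the curve. *)
Lemma ge0_lower_integral_le f g : (forall x, 0 <= f x) ->
  (forall x, f x <= g x) -> \int[mu]_x f x <= \int[mu]_x g x.
Proof.
move=> f0 fg; have g0 x : 0 <= g x by exact: le_trans (fg x).
rewrite !ge0_integralTE//; apply: ereal_sup_le => _ [h /= hf <-].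
by exists h => // x; exact: le_trans (fg x).
Qed.

Lemma ge0_lower_integralZ f (k : R) : (0 < k)%R -> (forall x, 0 <= f x) ->
  k%:E * \int[mu]_x f x <= \int[mu]_x (k%:E * f x).
Proof.
move=> k0 f0; rewrite !ge0_integralTE//; last first.
  by move=> x; rewrite mule_ge0// lee_fin ltW.
rewrite -lee_pdivlMl//; apply: ge_ereal_sup => _ [h /= hf <-].
rewrite lee_pdivlMl//.
rewrite -sintegralrM; apply: ereal_sup_ubound => /=.
exists (scale_nnsfun h (ltW k0)) => // x /=.
by rewrite EFinM lee_pmul2l.
Qed.

(** A simple minorant of [f] plus one of [g] is a simple minorant of the sum. Superadditivity is the
    direction needed when upper gradients, which sit on the larger side, are added. *)
Lemma ge0_lower_integralD f g : (forall x, 0 <= f x) -> (forall x, 0 <= g x) ->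
  \int[mu]_x f x + \int[mu]_x g x <= \int[mu]_x (f x + g x).
Proof.
move=> f0 g0; rewrite !ge0_integralTE//; last first.
  by move=> x; rewrite adde_ge0.
pose S f' := [set sintegral mu h |
  h in [set h : {nnsfun T >-> R} | forall x, (h x)%:E <= f' x]].
set c := (X in _ <= X).
have H a b : S f a -> S g b -> a + b <= c.
  move=> [h1 h1f <-] [h2 h2g <-]; rewrite -sintegralD; apply: ereal_sup_ubound.
  by exists (add_nnsfun h1 h2) => // x /=; rewrite EFinD leeD.
have S0 f' : (forall x, 0 <= f' x) -> S f' 0.
  by move=> f'0; exists nnsfun0; rewrite ?sintegral0.
have Sge0 f' a : S f' a -> 0 <= a by move=> [h _ <-]; exact: sintegral_ge0.
(* Once [c] is finite, so are all elements of [S f] and [S g], and the two suprema can be moved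
   across the inequality one after the other. *)
have [->|cfin] := eqVneq c +oo; first by rewrite leey.
have fin a : 0 <= a -> a <= c -> a \is a fin_num.
  by move=> a0 ac; rewrite ge0_fin_numE// (le_lt_trans ac)// ltey.
have supg : ereal_sup (S g) \is a fin_num.
  apply: fin; first by apply: ereal_sup_ubound; exact: S0.
  by apply: ge_ereal_sup => b Sb; rewrite -[b]add0e; apply: H => //; exact: S0.
rewrite -leeBrDr//; apply: ge_ereal_sup => a Sa; rewrite leeBrDr//.
have afin : a \is a fin_num.
  by apply: fin (Sge0 _ _ Sa) _; rewrite -[a]adde0; apply: H => //; exact: S0.
rewrite addeC -leeBrDr//; apply: ge_ereal_sup => b Sb.
by rewrite leeBrDr// addeC; exact: H.
Qed.

End lower_integral.

Lemma ge0_addye (R : realType) (x : \bar R) : (0 <= x -> +oo + x = +oo)%E.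
Proof. by case: x. Qed.

Lemma ge0_addey (R : realType) (x : \bar R) : (0 <= x -> x + +oo = +oo)%E.
Proof. by case: x. Qed.

Section Lp.
Context d (T : measurableType d) (R : realType).
Variables (mu : {measure set T -> \bar R}) (p : R).
Hypothesis p1 : (1 <= p)%R.
Implicit Types f g : T -> \bar R.
Local Open Scope ereal_scope.

Let p0 : (0 < p)%R. Proof. exact: lt_le_trans p1. Qed.
Let pn0 : p != 0%R. Proof. by rewrite gt_eqF. Qed.

Lemma measurable_poweR_abse f : measurable_fun setT f ->
  measurable_fun setT (fun x => `|f x| `^ p).
Proof.
move=> mf; apply: (measurableT_comp (measurable_poweR p)).
exact: measurableT_comp.
Qed.

Lemma Lnorm_lty f : ('N[mu]_p%:E[f] < +oo) <-> (\int[mu]_x (`|f x| `^ p) < +oo).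
Proof.
split=> h.
  by rewrite -poweR_Lnorm//; exact: poweR_lty.
by rewrite unlock; exact: poweR_lty.
Qed.

Lemma Lnorm_ae_eq f g : measurable_fun setT f -> measurable_fun setT g ->
  {ae mu, forall x, f x = g x} -> 'N[mu]_p%:E[f] = 'N[mu]_p%:E[g].
Proof.
move=> mf mg fg; rewrite unlock; congr (_ `^ _).
apply: ge0_ae_eq_integral => //; try exact: measurable_poweR_abse.
- by move=> *; exact: poweR_ge0.
- by move=> *; exact: poweR_ge0.
by apply: filterS fg => x /= -> .
Qed.

Lemma Lnorm0_ae f : {ae mu, forall x, f x = 0} -> measurable_fun setT f ->
  'N[mu]_p%:E[f] = 0.
Proof.
by move=> f0 mf; rewrite (@Lnorm_ae_eq _ (cst 0))// Lnorm0.
Qed.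

Lemma LnormZE f (k : R) : measurable_fun setT f ->
  'N[mu]_p%:E[(fun x => k%:E * f x)] = `|k|%:E * 'N[mu]_p%:E[f].
Proof.
move=> mf; rewrite unlock.
under eq_integral do rewrite abseM poweRM//.
rewrite ge0_integralZl//; last 3 first.
- exact: measurable_poweR_abse.
- by move=> *; exact: poweR_ge0.
- exact: poweR_ge0.
rewrite poweRM ?poweR_ge0// -?poweRrM ?mulfV// ?poweRe1//.
by apply: integral_ge0 => x _; exact: poweR_ge0.
Qed.

Lemma Lnorm_lty_ae f : measurable_fun setT f -> 'N[mu]_p%:E[f] < +oo ->
  {ae mu, forall x, f x \is a fin_num}.
Proof.
move=> mf /Lnorm_lty h.
have : mu.-integrable setT (fun x => `|f x| `^ p).
  apply/integrableP; split; first exact: measurable_poweR_abse.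
  by under eq_integral => x _ do rewrite gee0_abs ?poweR_ge0//.
move/(integrable_ae measurableT); apply: filterS => x /= /(_ I).
rewrite ge0_fin_numE ?poweR_ge0// => /(lty_poweRy pn0).
by rewrite fin_num_abs.
Qed.

(** If both norms are finite, then [f] and [g] are finite almost everywhere and can be replaced by
    real-valued functions, to which Minkowski's inequality applies. *)
Lemma Lnorm_minkowski f g : measurable_fun setT f -> measurable_fun setT g ->
  'N[mu]_p%:E[f \+ g] <= 'N[mu]_p%:E[f] + 'N[mu]_p%:E[g].
Proof.
move=> mf mg.
have [->|fy] := eqVneq ('N[mu]_p%:E[f]) +oo.
  by rewrite ge0_addye ?leey// Lnorm_ge0.
have [->|gy] := eqVneq ('N[mu]_p%:E[g]) +oo.
  by rewrite ge0_addey ?leey// Lnorm_ge0.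
have ff : {ae mu, forall x, f x \is a fin_num}.
  by apply: Lnorm_lty_ae => //; rewrite ltey.
have gf : {ae mu, forall x, g x \is a fin_num}.
  by apply: Lnorm_lty_ae => //; rewrite ltey.
have mfine (h : T -> \bar R) : measurable_fun setT h -> measurable_fun setT (fine \o h).
  by move=> mh; exact: (measurableT_comp (fine_measurable measurableT) mh).
have mE (h : T -> R) : measurable_fun setT h -> measurable_fun setT (EFin \o h).
  by move/measurable_EFinP.
rewrite (@Lnorm_ae_eq f (EFin \o (fine \o f)))//; last 2 first.
- exact/mE/mfine.
- by apply: filterS ff => x fx; rewrite /= fineK.
rewrite (@Lnorm_ae_eq g (EFin \o (fine \o g)))//; last 2 first.
- exact/mE/mfine.
- by apply: filterS gf => x fx; rewrite /= fineK.
rewrite (@Lnorm_ae_eq (f \+ g) (EFin \o ((fine \o f) \+ (fine \o g))%R))//; last 3 first.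
- exact: emeasurable_funD.
- by apply/mE; apply: measurable_funD; exact: mfine.
- by apply: filterS2 ff gf => x fx gx; rewrite /= EFinD !fineK.
by apply: eminkowski => //; exact: mfine.
Qed.

End Lp.

Section borel.
Context {R : realType} {X : pmetricType R}.
Variable m : borel_measure R (@open X).

Lemma bm_setsE : <<s bm_sets m >> = bm_sets m.
Proof. exact: (sigma_algebra_id (bm_sigma_algebra m)). Qed.

Lemma borel_bm (A : set X) : <<s @open X >> A -> bm_sets m A.
Proof. by rewrite -bm_setsE; apply: sub_sigma_algebra2; exact: bm_borel. Qed.

Lemma borel_measurable d (U : measurableType d) (f : X -> U) :
  borel_fun (@open X) f ->
  measurable_fun [set: g_sigma_algebraType (bm_sets m)] f.
Proof.
move=> mf _ Y mY; have := mf measurableT Y mY; rewrite !setTI.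
by move=> /borel_bm h; rewrite [X in X _]bm_setsE.
Qed.

Lemma borel_nonnegZ (k : R) (g : X -> \bar R) : 0 <= k ->
  borel_nonneg g -> borel_nonneg (fun x => k%:E * g x)%E.
Proof.
move=> k0 [mg g0]; split; last by move=> x; rewrite mule_ge0.
by rewrite /borel_fun; apply: measurable_funeM.
Qed.

Lemma borel_nonnegD (f g : X -> \bar R) :
  borel_nonneg f -> borel_nonneg g -> borel_nonneg (f \+ g)%E.
Proof.
move=> [mf f0] [mg g0]; split; last by move=> x; rewrite adde_ge0.
by rewrite /borel_fun; apply: emeasurable_funD.
Qed.

Lemma borel_nonneg0 : borel_nonneg (cst 0 : X -> \bar R)%E.
Proof. by split => //; exact: measurable_cst. Qed.

End borel.

(** * Families of zero modulus *)

Section modulus0.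
Context {R : realType} {X : pmetricType R}.
Variables (m : borel_measure R (@open X)) (p : R).
Hypothesis p1 : 1 <= p.
Variables (T : Type) (I : T -> (X -> \bar R) -> \bar R).
Hypothesis I_le : forall c f g, borel_nonneg f -> borel_nonneg g ->
  (forall x, f x <= g x)%E -> (I c f <= I c g)%E.
Hypothesis I_Z : forall c (k : R) f, 0 < k -> borel_nonneg f ->
  (k%:E * I c f <= I c (fun x => k%:E * f x))%E.
Local Open Scope ereal_scope.

Let p0 : (0 < p)%R. Proof. exact: lt_le_trans p1. Qed.
Let pn0 : p != 0%R. Proof. by rewrite gt_eqF. Qed.

Lemma in_LpE (f : X -> \bar R) : (forall x, 0 <= f x) ->
  in_Lp m p f = is_true (\int[m]_x (f x `^ p) < +oo).
Proof.
by move=> f0; rewrite /in_Lp; under eq_integral => x _ do rewrite gee0_abs//.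
Qed.

(** Choose admissible [rho n] so small that the multiples [(n + 1) rho n] have summable p-th powers.
    The witness is the p-th root of the sum of these powers rather than the sum itself: its p-th
    power integrates term by term, and it still dominates each multiple. *)
Lemma modulus0_witness (F : set T) : modulus m p I F = 0 ->
  exists rho, [/\ borel_nonneg rho, in_Lp m p rho &
    forall c, F c -> I c rho = +oo].
Proof.
move=> F0.
have ex n : exists rho, [/\ borel_nonneg rho, forall c, F c -> 1 <= I c rho &
    \int[m]_x ((n.+1%:R%:E * rho x) `^ p) <= ((2 ^ n.+1)%:R^-1)%:E].
  (* The division by [(n + 1)^p] pays for the later scaling of [rho] by [n + 1]. *)
  have e0 : (0 < (2 ^ n.+1)%:R^-1 / (n.+1%:R `^ p) :> R)%R.
    by rewrite divr_gt0 ?invr_gt0 ?ltr0n ?expn_gt0// powR_gt0.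
  have fin : modulus m p I F \is a fin_num by rewrite F0.
  have [_ [rho [brho hrho] <-]] := lb_ereal_inf_adherent e0 fin.
  rewrite -/(modulus m p I F) F0 add0e => lt.
  exists rho; split => //.
  have rho0 := brho.2.
  under eq_integral => x _ do rewrite poweRM//.
  rewrite ge0_integralZl//; last 3 first.
  - apply: (measurableT_comp (measurable_poweR p)).
    exact: borel_measurable brho.1.
  - by move=> *; exact: poweR_ge0.
  - exact: poweR_ge0.
  rewrite poweR_EFin -lee_pdivlMl ?powR_gt0//.
  by rewrite (le_trans (ltW lt))// -EFinM lee_fin mulrC.
have [rho hrho] := choice ex.
pose g n x := (n.+1%:R%:E * rho n x) `^ p.
have g0 n x : 0 <= g n x by exact: poweR_ge0.
have rho0 n x : 0 <= rho n x by have [[_ +] _ _] := hrho n; exact.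
have mg n : measurable_fun [set: g_sigma_algebraType (@open X)] (g n).
  apply: (measurableT_comp (measurable_poweR p)).
  apply: measurable_funeM.
  by have [[+ _] _ _] := hrho n.
pose S x := \sum_(0 <= n <oo) g n x.
have S0 x : 0 <= S x by apply: nneseries_ge0.
have mS : borel_nonneg (fun x => S x `^ p^-1).
  split; last by move=> x; exact: poweR_ge0.
  apply: (measurableT_comp (measurable_poweR _)).
  by apply: ge0_emeasurable_sum => //.
exists (fun x => S x `^ p^-1); split => //.
- rewrite in_LpE; last by move=> x; exact: poweR_ge0.
  under eq_integral => x _ do rewrite -poweRrM mulVf// poweRe1//.
  rewrite integral_nneseries//; last first.
    by move=> n; exact: (@borel_measurable _ _ m _ _ (g n) (mg n)).
  apply: (@le_lt_trans _ _ 1); last exact: ltry.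
  have := @epsilon_trick0 R 1%R xpredT ler01.
  apply: le_trans; apply: lee_nneseries => [n _ _|n _].
    exact: integral_ge0.
  by rewrite div1r; have [_ _ +] := hrho n; exact.
- move=> c Fc; apply/eqyP => r r0.
  have [n rn] : exists n, (r <= n.+1%:R)%R.
    by exists (Num.truncn r); rewrite ltW// truncnS_gt.
  have [bn In _] := hrho n.
  apply: (@le_trans _ _ (I c (fun x => n.+1%:R%:E * rho n x))).
    apply: le_trans (I_Z _ _ _) => //.
    rewrite (@le_trans _ _ (n.+1%:R%:E * 1))//; first by rewrite mule1 lee_fin.
    by rewrite lee_pmul2l ?In// lte_fin.
  apply: I_le => //; first exact: borel_nonnegZ.
  move=> x.
  have -> : n.+1%:R%:E * rho n x = (g n x) `^ p^-1.
    by rewrite /g -poweRrM mulfV// poweRe1// mule_ge0.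
  apply: gt0_ler_poweR.
  + by rewrite invr_ge0 ltW.
  + by rewrite in_itv/= leey andbT.
  + by rewrite in_itv/= leey andbT.
  rewrite /S (nneseriesD1 _ (n:=n))// leeDl//.
by apply: nneseries_ge0.
Qed.

Lemma modulus0_le (F : set T) rho : borel_nonneg rho -> in_Lp m p rho ->
  (forall c, F c -> I c rho = +oo) -> modulus m p I F = 0.
Proof.
move=> brho Lrho Frho; apply/eqP; rewrite eq_le; apply/andP; split; last first.
  by apply: le_ereal_inf_tmp => _ [r _ <-]; apply: integral_ge0 => x _; exact: poweR_ge0.
move: Lrho; rewrite in_LpE; last exact: brho.2.
set J := \int[m]_x _ => J1.
have J0 : 0 <= J by apply: integral_ge0 => x _; exact: poweR_ge0.
have Jfin : J \is a fin_num by rewrite ge0_fin_numE.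
apply/lee_addgt0Pr => e e0; rewrite add0e.
(* Every positive multiple of [rho] is admissible. This one has energy [e J / (J + 1)], and the
   [+ 1] covers [J = 0]. *)
pose k : R := ((e / (fine J + 1)) `^ p^-1)%R.
have J1p : (0 < fine J + 1)%R by rewrite ltr_wpDl// fine_ge0.
have k0 : (0 < k)%R by rewrite powR_gt0// divr_gt0.
apply: (@le_trans _ _ (\int[m]_x ((k%:E * rho x) `^ p))).
  apply: ereal_inf_lbound; exists (fun x => k%:E * rho x) => //; split.
    by apply: borel_nonnegZ => //; exact: ltW.
  move=> c /Frho Ic; apply: le_trans (I_Z _ k0 brho).
  by rewrite Ic gt0_muley ?lte_fin// leey.
under eq_integral => x _ do rewrite poweRM ?brho.2 ?lee_fin ?(ltW k0)//.
rewrite ge0_integralZl//; last 3 first.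
- apply: (measurableT_comp (measurable_poweR p)).
  exact: borel_measurable brho.1.
- by move=> *; exact: poweR_ge0.
- exact: poweR_ge0.
rewrite poweR_EFin /k -powRrM mulVf// powRr1; last by rewrite divr_ge0 ?ltW.
rewrite -/J -(fineK Jfin) -EFinM lee_fin mulrAC ler_pdivrMr//.
by rewrite ler_pM2l// lerDl.
Qed.

End modulus0.

(** * Lipschitz functions and measurability *)

Section metric.
Context {R : realType} {X : pmetricType R}.
Implicit Types (x y : X) (A E : set X).

Lemma metric_openP A :
  open A <-> (forall x, A x -> exists2 e : R, 0 < e & forall y, mdist x y < e -> A y).
Proof.
split=> [|H].
  rewrite openE => oA x /oA /nbhs_ballP [e e0 eA]; exists e => // y xy.
  by apply: eA; rewrite ballEmdist.
rewrite openE => x /H [e e0 He]; apply/nbhs_ballP; exists e => // y.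
by rewrite ballEmdist; exact: He.
Qed.

Lemma metric_dist_triangle x y z : `|mdist x z - mdist y z| <= mdist x y.
Proof.
have := metric_triangle x y z; have := metric_triangle y x z.
rewrite (metric_sym y x) ler_norml => h1 h2; apply/andP; split; lra.
Qed.

Lemma lipschitz_borel (K : R) (f : X -> R) : 0 <= K ->
  (forall x y, `|f x - f y| <= K * mdist x y) -> borel_fun (@open X) f.
Proof.
move=> K0 fK; apply: (measurability (@RGenOInfty.G R)) => [|/= _ [_] [r] -> <-].
  exact: RGenOInfty.measurableE.
rewrite setTI; apply: sub_sigma_algebra; apply/metric_openP => x /=.
rewrite in_itv/= andbT => rf; exists ((f x - r) / (K + 1)).
  by rewrite divr_gt0 ?subr_gt0// ltr_wpDl.
move=> y; have K1 : 0 < K + 1 by rewrite ltr_wpDl.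
rewrite ltr_pdivlMr// in_itv/= andbT => xy.
have := fK x y; have := mdist_ge0 x y; rewrite ler_norml => d0 /andP[_ h].
nra.
Qed.

Definition mcshane E (K : R) (f : X -> R) x : R :=
  inf [set f y + K * mdist x y | y in E].

Section mcshane_theory.
Variables (E : set X) (K : R) (f : X -> R).
Hypothesis K0 : 0 <= K.
Hypothesis fK : forall x y, E x -> E y -> `|f x - f y| <= K * mdist x y.

Lemma mcshane_lb x y z : E y -> E z ->
  f y - K * mdist x y <= f z + K * mdist x z.
Proof.
move=> Ey Ez; have := fK Ey Ez; rewrite ler_norml => /andP[_ h].
have := metric_triangle y x z; rewrite (metric_sym y x) => /(ler_wpM2l K0).
rewrite mulrDr; lra.
Qed.

Lemma mcshane_le x y : E y -> mcshane E K f x <= f y + K * mdist x y.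
Proof.
move=> Ey; apply: ge_inf; last by exists y.
by exists (f y - K * mdist x y) => _ [z Ez <-]; exact: mcshane_lb.
Qed.

Lemma mcshane_ge x r y : E y -> (forall z, E z -> r <= f z + K * mdist x z) ->
  r <= mcshane E K f x.
Proof.
move=> Ey H; apply: lb_le_inf; first by exists (f y + K * mdist x y), y.
by move=> _ [z Ez <-]; exact: H.
Qed.

Lemma mcshaneE x : E x -> mcshane E K f x = f x.
Proof.
move=> Ex; apply/eqP; rewrite eq_le; apply/andP; split.
  by rewrite (le_trans (mcshane_le _ Ex))// mdistxx mulr0 addr0.
apply: (mcshane_ge Ex) => z Ez; have := mcshane_lb x Ex Ez.
by rewrite mdistxx mulr0 subr0.
Qed.

Lemma mcshane_lipschitz x y :
  `|mcshane E K f x - mcshane E K f y| <= K * mdist x y.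
Proof.
(* For empty [E] both infima are taken over the empty set, so they are equal. *)
have [[e Ee]|/nonemptyPn E0] := pselect (E !=set0); last first.
  rewrite /mcshane E0 !image_set0 subrr normr0 mulr_ge0//; exact: mdist_ge0.
suff H u v : mcshane E K f u <= mcshane E K f v + K * mdist u v.
  rewrite ler_norml; have := H x y; have := H y x.
  by rewrite (metric_sym y x) => h1 h2; apply/andP; split; lra.
rewrite -lerBlDr; apply: (mcshane_ge Ee) => z Ez; rewrite lerBlDr.
rewrite (le_trans (mcshane_le u Ez))// -addrA lerD2l -mulrDr.
rewrite ler_wpM2l// addrC; exact: metric_triangle.
Qed.

End mcshane_theory.

(** An open set [U] is the set where [min(1, d(x, X \ U))] is positive. Truncating the test
    functions at 1 makes their integrals along curves Lipschitz for the metric [dTC]. *)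
Lemma measurable_to_metric d (T : measurableType d) (u : T -> X) :
  (forall phi : X -> R,
    (forall x y, `|phi x - phi y| <= Num.min 1 (mdist x y)) ->
    measurable_fun setT (phi \o u)) ->
  measurable_fun setT (u : T -> g_sigma_algebraType (@open X)).
Proof.
move=> H; apply: (@measurability _ _ T (g_sigma_algebraType (@open X)) setT u (@open X)) => // _ [U oU <-]; rewrite setTI.
have [[a nUa]|/nonemptyPn UT] := pselect ((~` U) !=set0); last first.
  have -> : U = setT by rewrite -[U]setCK UT setC0.
  by rewrite preimage_setT.
(* The distance to the complement of [U]. *)
pose h := mcshane (~` U) 1 (cst 0).
have h1 x y : `|h x - h y| <= mdist x y.
  by rewrite -[leRHS]mul1r; apply: mcshane_lipschitz => // x' y' _ _; rewrite subrr normr0 mul1r; exact: mdist_ge0.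
have hlip : forall x y : X, (~` U) x -> (~` U) y -> `|cst (0 : R) x - cst (0 : R) y| <= 1 * mdist x y.
  by move=> x' y' _ _; rewrite subrr normr0 mul1r; exact: mdist_ge0.
have h0 x : 0 <= h x.
  apply: (mcshane_ge nUa) => z _; rewrite add0r mul1r; exact: mdist_ge0.
have hU x : (0 < Num.min 1 (h x)) = (x \in U).
  rewrite lt_min ltr01/=; apply/idP/idP => [hx|/set_mem Ux].
    apply/mem_set; apply: contrapT => nUx; move: hx.
    by rewrite /h (mcshaneE ler01 hlip)// ltxx.
  have [e e0 eU] := (metric_openP U).1 oU _ Ux.
  apply: (lt_le_trans e0); apply: (mcshane_ge nUa) => z nUz.
  rewrite add0r mul1r leNgt; apply/negP => /eU; exact: nUz.
have -> : u @^-1` U = ((fun x => Num.min 1 (h x)) \o u) @^-1` `]0, +oo[.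
  apply/seteqP; split => t /=; rewrite in_itv/= andbT hU.
    by move=> ?; exact/mem_set.
  by move=> /set_mem.
rewrite -[X in measurable X]setTI; apply: H => // x y.
have := h1 x y; have := h0 x; have := h0 y.
rewrite le_min; set a1 := h x; set a2 := h y.
rewrite !ler_norml => A B /andP[C D].
case: (leP 1 a1) => E1; case: (leP 1 a2) => E2; apply/andP; split; try apply/andP; try split; try lra.
Qed.

End metric.

(** Both [phi + W] and [W] are nondecreasing. *)
Lemma bv_measurable (R : realType) (phi W : R -> R) :
  {homo W : x y / x <= y} ->
  (forall x y, x <= y -> `|phi y - phi x| <= W y - W x) ->
  measurable_fun setT phi.
Proof.
move=> Wnd H.
have -> : phi = (phi \+ W) \- W by apply/funext => x /=; rewrite addrK.
apply: measurable_funB; last exact: nondecreasing_measurable.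
apply: nondecreasing_measurable => // x y xy /=.
have := H _ _ xy; rewrite ler_norml => /andP[? _]; lra.
Qed.

Section test_curve_measurable.
Context {R : realType} {X : pmetricType R}.
Implicit Types (c : test_curve X) (t : R).

Lemma measurable_test_curve c :
  measurable_fun setT (c : R -> g_sigma_algebraType (@open X)).
Proof.
apply: measurable_to_metric => phi phi1.
apply: (@bv_measurable _ _ (curve_variation c)).
  exact: curve_variation_nd.
move=> x y xy; apply: le_trans (mdist_le_curve_variation c xy).
by rewrite distrC (le_trans (phi1 _ _))// ge_min lexx orbT.
Qed.

Lemma left_lim_reversal c t : left_lim c t = reversal c (1 - t).
Proof. by rewrite /= opprB addrC subrK. Qed.

Lemma measurable_left_lim c :
  measurable_fun setT (left_lim c : R -> g_sigma_algebraType (@open X)).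
Proof.
have -> : left_lim c = reversal c \o (fun t => 1 - t).
  by apply/funext => t; rewrite left_lim_reversal.
apply: measurableT_comp; first exact: measurable_test_curve.
exact: measurable_funB.
Qed.

Lemma measurable_mdist_test_curve c c' :
  measurable_fun setT (fun t => mdist (c t) (c' t)).
Proof.
apply: (@bv_measurable _ _ (curve_variation c \+ curve_variation c')).
  by move=> x y xy /=; apply: lerD; exact: curve_variation_nd.
move=> x y xy /=.
have h1 := mdist_le_curve_variation c xy.
have h2 := mdist_le_curve_variation c' xy.
have t1 := metric_dist_triangle (c x) (c y) (c' x).
have t2 := metric_dist_triangle (c' x) (c' y) (c y).
rewrite (metric_sym (c' x) (c y)) (metric_sym (c' y) (c y)) in t2.
move: t1 t2; rewrite !ler_norml => /andP[? ?] /andP[? ?]; apply/andP; split; lra.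
Qed.

Lemma measurable_borel_curve c (h : X -> \bar R) :
  borel_nonneg h -> measurable_fun setT (h \o c).
Proof.
move=> [mh _].
exact: (measurableT_comp (f:=h : g_sigma_algebraType (@open X) -> _) mh (measurable_test_curve c)).
Qed.

Lemma measurable_borel_left_lim c (h : X -> \bar R) :
  borel_nonneg h -> measurable_fun setT (h \o left_lim c).
Proof.
move=> [mh _].
exact: (measurableT_comp (f:=h : g_sigma_algebraType (@open X) -> _) mh (measurable_left_lim c)).
Qed.

End test_curve_measurable.

(** * Variation and reversal *)

Section variation_left.
Context {R : realType} {X : pmetricType R}.
Implicit Types (c : test_curve X) (a b s t x y : R).

Lemma curve_variation_le0 c t : t <= 0 -> curve_variation c t = 0.
Proof.
by move=> t0; rewrite /curve_variation max_l// min_r// mtotal_variationxx.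
Qed.

Lemma curve_variation_ge1 c t : 1 <= t -> curve_variation c t = curve_variation c 1.
Proof.
move=> t1; rewrite /curve_variation.
have -> : Num.max 0 t = t by rewrite max_r// (le_trans ler01).
have -> : Num.max 0 1 = 1 :> R by rewrite max_r.
by rewrite minxx min_l.
Qed.

Lemma EFin_curve_variation c t : 0 <= t -> t <= 1 ->
  (curve_variation c t)%:E = mtotal_variation 0 t c.
Proof.
move=> t0 t1; rewrite /curve_variation max_r// min_r// fineK//.
rewrite ge0_fin_numE ?mtotal_variation_ge0//.
by rewrite (le_lt_trans _ (tc_variation_fin c))// mtotal_variation_nd.
Qed.

Lemma curve_lengthE c : curve_length c = (curve_variation c 1)%:E.
Proof. by rewrite EFin_curve_variation. Qed.

Lemma curve_variation_ge0 c t : 0 <= curve_variation c t.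
Proof.
have [t0|t0] := leP t 0; first by rewrite curve_variation_le0.
by rewrite -(curve_variation_le0 c (lexx 0)) curve_variation_nd// ltW.
Qed.

(** The left limit of the variation at [t], since the variation is nondecreasing; as a supremum it
    needs no convergence argument. *)
Definition variation_left c t : R := sup [set curve_variation c x | x in [set x | x < t]].

Let has_ub c t : has_ubound [set curve_variation c x | x in [set x | x < t]].
Proof. by exists (curve_variation c t) => _ [x xt <-]; rewrite curve_variation_nd// ltW. Qed.

Let ne c t : [set curve_variation c x | x in [set x | x < t]] !=set0.
Proof. by exists (curve_variation c (t - 1)), (t - 1) => //=; rewrite ltrBlDr ltrDl. Qed.

Lemma le_variation_left c x t : x < t -> curve_variation c x <= variation_left c t.
Proof. by move=> xt; apply: ub_le_sup => //; exists x. Qed.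

Lemma variation_left_le c t r :
  (forall x, x < t -> curve_variation c x <= r) -> variation_left c t <= r.
Proof. by move=> H; apply: ge_sup => // _ [x xt <-]; exact: H. Qed.

Lemma variation_left_le_self c t : variation_left c t <= curve_variation c t.
Proof. by apply: variation_left_le => x xt; rewrite curve_variation_nd// ltW. Qed.

Lemma variation_left_nd c : {homo variation_left c : x y / x <= y}.
Proof.
by move=> x y xy; apply: variation_left_le => z zx; apply: le_variation_left; exact: lt_le_trans xy.
Qed.

Lemma variation_left_le0 c t : t <= 0 -> variation_left c t = 0.
Proof.
move=> t0; apply/eqP; rewrite eq_le; apply/andP; split.
  apply: variation_left_le => x xt.
  by rewrite curve_variation_le0// ltW// (lt_le_trans xt).
rewrite -(@curve_variation_le0 c (t - 1)); last by lra.
by apply: le_variation_left; lra.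
Qed.

Lemma variation_left_adherent c t (e : R) : 0 < e ->
  exists2 x, x < t & variation_left c t - e < curve_variation c x.
Proof.
move=> e0; have [|_ [x xt <-] h] := @sup_adherent _ [set curve_variation c x | x in [set x | x < t]] _ e0.
  by split.
by exists x.
Qed.

Let left_near c t (e : R) : 0 < e ->
  \forall u \near t^'-, mdist (left_lim c t) (c u) <= e.
Proof.
move=> e0.
by apply: metricType_numDomainType.cvgr_dist_le (left_lim_cvg (g:=c) (t:=t)) _ e0.
Qed.

Lemma mdist_left_lim_le c s t : s < t ->
  mdist (c s) (left_lim c t) <= variation_left c t - curve_variation c s.
Proof.
move=> st; apply/ler_addgt0Pr => e e0.
near t^'- => u.
have su : s < u by near: u; exact: nbhs_left_gt.
have ut : u < t by near: u; exact: nbhs_left_lt.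
have gu : mdist (left_lim c t) (c u) <= e by near: u; exact: left_near.
have h1 := mdist_le_curve_variation c (ltW su).
have h2 := le_variation_left c ut.
have := metric_triangle (c s) (c u) (left_lim c t); rewrite (metric_sym (c u)); lra.
Unshelve. all: by end_near. Qed.

Lemma mdist_jump_le c t :
  mdist (left_lim c t) (c t) <= curve_variation c t - variation_left c t.
Proof.
apply/ler_addgt0Pr => e e0.
have e20 : 0 < e / 2 by rewrite divr_gt0.
have [x xt xe] := variation_left_adherent c t e20.
near t^'- => u.
have xu : x < u by near: u; exact: nbhs_left_gt.
have ut : u < t by near: u; exact: nbhs_left_lt.
have gu : mdist (left_lim c t) (c u) <= e / 2 by near: u; exact: left_near.
have h1 := mdist_le_curve_variation c (ltW ut).
have h2 : curve_variation c x <= curve_variation c u.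
  by apply: curve_variation_nd; exact: ltW.
have := metric_triangle (left_lim c t) (c u) (c t); lra.
Unshelve. all: by end_near. Qed.

Lemma mdist_left_lim2_le c s t : s < t ->
  mdist (left_lim c s) (left_lim c t) <= variation_left c t - variation_left c s.
Proof.
move=> st; have := metric_triangle (left_lim c s) (c s) (left_lim c t).
have := mdist_left_lim_le c st; have := mdist_jump_le c s; lra.
Qed.

Let mvariation_reversal c p a b : itv_partition a b p ->
  mvariation a b (reversal c) p <=
  variation_left c (1 - a) - variation_left c (1 - b).
Proof.
elim: p a => [|x p ih] a.
  by move=> /itv_partition_nil ->; rewrite mvariation_nil subrr.
move=> h; have ax : a < x by case: h => /= /andP[].
rewrite mvariation_cons; have := ih _ (itv_partition_cons h).
have : mdist (reversal c x) (reversal c a) <= variation_left c (1 - a) - variation_left c (1 - x).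
  by apply: mdist_left_lim2_le; lra.
lra.
Qed.

Lemma mtotal_variation_D (f : R -> X) a b t : a <= t -> t <= b ->
  (mtotal_variation a b f < +oo)%E ->
  mtotal_variation a b f = (mtotal_variation a t f + mtotal_variation t b f)%E.
Proof.
move=> at_ tb fin.
have fin1 : mtotal_variation a t f \is a fin_num.
  rewrite ge0_fin_numE ?mtotal_variation_ge0//.
  by rewrite (le_lt_trans _ fin)// mtotal_variation_nd.
apply/eqP; rewrite eq_le; apply/andP; split; last first.
  rewrite addeC -leeBrDr//; apply/ge_ereal_sup => _ [p tp <-].
  by rewrite leeBrDr// addeC mtotal_variation_catr.
move: tb; rewrite [t <= b]le_eqVlt => /predU1P[->|tb].
  by rewrite mtotal_variationxx adde0.
apply/ge_ereal_sup => _ [p ap <-].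
have [p1 [p2 [h1 h2 h3]]] := mvariation_refine f at_ tb ap.
apply: (@le_trans _ _ (mvariation a t f p1 + mvariation t b f p2)%:E).
  by rewrite lee_fin.
by rewrite EFinD leeD// mvariation_le.
Qed.

Lemma curve_variationB c a b : 0 <= a -> a <= b -> b <= 1 ->
  (curve_variation c b - curve_variation c a)%:E = mtotal_variation a b c.
Proof.
move=> a0 ab b1.
have b0 := le_trans a0 ab.
rewrite EFinB !EFin_curve_variation ?(le_trans ab)//.
rewrite (@mtotal_variation_D _ _ _ _ a0 ab); last first.
  by rewrite -EFin_curve_variation// ltry.
by rewrite addeAC subee ?add0e// -EFin_curve_variation ?(le_trans ab).
Qed.

Lemma reversal_variation_le c a b : 0 <= a -> a <= b -> b <= 1 ->
  curve_variation (reversal c) b - curve_variation (reversal c) a <=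
  variation_left c (1 - a) - variation_left c (1 - b).
Proof.
move=> a0 ab b1; rewrite -lee_fin curve_variationB//.
by apply/ge_ereal_sup => _ [p hp <-]; rewrite lee_fin mvariation_reversal.
Qed.

Lemma test_curve_eq c c' : (forall t, c t = c' t) -> c = c'.
Proof.
case: c c' => [f h1 h2 h3 h4 h5 h6] [f' h1' h2' h3' h4' h5' h6'] /= /funext ff'.
by subst f'; f_equal; exact: Prop_irrelevance.
Qed.

(** The left limits of the reversed curve are right limits of [c], hence values of [c]. *)
Lemma reversalK c : reversal (reversal c) = c.
Proof.
apply: test_curve_eq => t; apply: left_lim_eq.
apply/metricType_numDomainType.cvgrPdist_le => e e0.
have : \forall u \near t^'+, mdist (c t) (c u) <= e.
  by apply: metricType_numDomainType.cvgr_dist_le (@tc_right_continuous _ _ c t) _ e0.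
move=> [d /= d0 H].
near=> s.
have ts : s < 1 - t by near: s; exact: nbhs_left_lt.
have sd : 1 - t - d < s by near: s; apply: nbhs_left_gt; rewrite ltrBlDr ltrDl.
apply/ler_addgt0Pr => r r0 /=.
near (1 - s)^'- => u.
have u1 : t < u by near: u; apply: nbhs_left_gt; lra.
have u2 : u < 1 - s by near: u; exact: nbhs_left_lt.
have gu : mdist (left_lim c (1 - s)) (c u) <= r by near: u; exact: left_near.
have := metric_triangle (c t) (c u) (left_lim c (1 - s)).
rewrite (metric_sym (c u)) => /le_trans; apply; apply: lerD => //.
by apply: H => //=; rewrite ltr_norml; apply/andP; split; lra.
Unshelve. all: by end_near. Qed.

(** The upper bound [dn] comes from summing distances between left limits of [c]. The same bound for
    the reversed curve, whose reversal is [c], gives the lower bound [up], but with [V(x)] where a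
    left limit is wanted; right-continuity of the reversed variation at [t] closes the gap. *)
Lemma reversal_variation c t :
  curve_variation (reversal c) t = curve_variation c 1 - variation_left c (1 - t).
Proof.
have up x : 0 <= x -> x <= 1 ->
    curve_variation c 1 - curve_variation c x <= curve_variation (reversal c) (1 - x).
  move=> x0 x1; have := @reversal_variation_le (reversal c) x 1 x0 x1 (lexx _).
  rewrite reversalK subrr (variation_left_le0 _ (lexx 0)) subr0.
  by move=> /le_trans; apply; exact: variation_left_le_self.
have dn x : 0 <= x -> x <= 1 ->
    curve_variation (reversal c) x <= variation_left c 1 - variation_left c (1 - x).
  move=> x0 x1; have := @reversal_variation_le c 0 x (lexx 0) x0 x1.
  by rewrite subr0 (curve_variation_le0 _ (lexx 0)) subr0.
have U1 : variation_left c 1 = curve_variation c 1.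
  apply/eqP; rewrite eq_le variation_left_le_self/=.
  have := up 0 (lexx 0) ler01; have := dn 1 ler01 (lexx 1).
  by rewrite subrr subr0 (variation_left_le0 _ (lexx 0)) (curve_variation_le0 _ (lexx 0)); lra.
have [t0|t0] := ltP t 0.
  rewrite curve_variation_le0 ?ltW//; apply/esym/eqP; rewrite subr_eq0 eq_le.
  rewrite le_variation_left/=; last by lra.
  by apply: variation_left_le => x _; exact: curve_variation_le1.
have [t1|t1] := leP 1 t.
  rewrite curve_variation_ge1// variation_left_le0 ?subr_le0//.
  apply/eqP; rewrite eq_le; have := up 0 (lexx 0) ler01.
  have := dn 1 ler01 (lexx 1).
  rewrite subrr !subr0 (variation_left_le0 _ (lexx 0)) (curve_variation_le0 _ (lexx 0)) U1.
  by rewrite !subr0 => -> ->.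
apply/eqP; rewrite eq_le; apply/andP; split.
  by rewrite -U1; apply: dn => //; exact: ltW.
apply/ler_addgt0Pr => e e0.
have : \forall u \near t^'+, `|curve_variation (reversal c) t - curve_variation (reversal c) u| <= e.
  by move/cvgrPdist_le : (curve_variation_right_continuous (g:=reversal c) (t:=t)) => /(_ _ e0).
move=> H; near t^'+ => u.
have tu : t < u by near: u; exact: nbhs_right_gt.
have u1 : u < 1 by near: u; exact: nbhs_right_lt.
have : `|curve_variation (reversal c) t - curve_variation (reversal c) u| <= e by near: u.
have := up (1 - u); rewrite opprB addrCA subrr addr0 => upu.
have := upu ltac:(lra) ltac:(lra).
have : curve_variation c (1 - u) <= variation_left c (1 - t).
  by apply: le_variation_left; lra.
rewrite ler_norml => h1 h2 /andP[h3 h4]; lra.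
Unshelve. all: by end_near. Qed.

Lemma reversal_length c : curve_variation (reversal c) 1 = curve_variation c 1.
Proof. by rewrite reversal_variation subrr variation_left_le0// subr0. Qed.

End variation_left.

(** * Integration along a curve by its quantile function *)

Section quantile.
Context {R : realType} {X : pmetricType R}.
Implicit Types (c : test_curve X) (s t : R).

(** The generalized inverse of the variation. Admitting [t = 1] unconditionally keeps the set
    nonempty, so that the function is monotone with values in [0, 1] on the whole line. *)
Definition quantile c s : R :=
  inf [set t | 0 <= t <= 1 /\ (t = 1 \/ s <= curve_variation c t)].

Let A c s := [set t | 0 <= t <= 1 /\ (t = 1 \/ s <= curve_variation c t)].

Let Alb c s : has_lbound (A c s).
Proof. by exists 0 => x [/andP[]]. Qed.

Let A1 c s : A c s 1.
Proof. by split; [rewrite ler01 lexx|left]. Qed.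

Lemma quantile_ge0 c s : 0 <= quantile c s.
Proof. by apply: lb_le_inf => [|x [/andP[]//]]; exists 1; exact: A1. Qed.

Lemma quantile_le1 c s : quantile c s <= 1.
Proof. by apply: ge_inf; [exact: Alb|exact: A1]. Qed.

Lemma quantile_nd c : {homo quantile c : x y / x <= y}.
Proof.
move=> x y xy; apply: lb_le_inf; first by exists 1; exact: A1.
move=> t [t01 t1]; apply: ge_inf; first exact: Alb.
  split => //.
by case: t1 => [|yt]; [left|right; exact: le_trans yt].
Qed.

Lemma measurable_quantile c : measurable_fun setT (quantile c).
Proof. by apply: nondecreasing_measurable => //; exact: quantile_nd. Qed.

(** Right-continuity of the variation makes the infimum a minimum. For [s <= 0] the equivalence
    breaks down at negative [t], where the variation is 0 but the quantile is larger than [t]. *)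
Lemma quantile_le c s t : 0 < s <= curve_variation c 1 ->
  (quantile c s <= t) = (s <= curve_variation c t).
Proof.
move=> /andP[s0 s1]; apply/idP/idP => [qt|st]; last first.
  have [t0|t0] := leP t 0.
    by have := lt_le_trans s0 st; rewrite (curve_variation_le0 _ t0) ltxx.
  have [t1|t1] := leP 1 t; first by rewrite (le_trans (quantile_le1 _ _)).
  apply: ge_inf; first exact: Alb.
  by split; [rewrite !ltW|right].
have [t1|t1] := leP 1 t; first by rewrite curve_variation_ge1.
apply/ler_addgt0Pr => e e0.
have : \forall u \near t^'+, `|curve_variation c t - curve_variation c u| <= e.
  by move/cvgrPdist_le : (curve_variation_right_continuous (g:=c) (t:=t)) => /(_ _ e0).
move=> H; near t^'+ => u.
have tu : t < u by near: u; exact: nbhs_right_gt.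
have u1 : u < 1 by near: u; exact: nbhs_right_lt.
have : `|curve_variation c t - curve_variation c u| <= e by near: u.
have [x [x01 xs] xu] : exists2 x, A c s x & x < u.
  apply: inf_lt; first by exists 1; exact: A1.
  exact: le_lt_trans tu.
have sx : s <= curve_variation c x.
  by case: xs => [x1|//]; move: xu; rewrite x1 ltNge ltW.
have : curve_variation c x <= curve_variation c u.
  by apply: curve_variation_nd; exact: ltW.
rewrite ler_norml => h1 /andP[h2 h3]; lra.
Unshelve. all: by end_near. Qed.

End quantile.

Lemma mrestr_integral d (T : measurableType d) (R : realType)
    (mu : {measure set T -> \bar R}) (D : set T) (mD : measurable D)
    (f : T -> \bar R) : (forall x, (0 <= f x)%E) -> measurable_fun setT f ->
  (\int[mrestr mu mD]_x f x = \int[mu]_(x in D) f x)%E.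
Proof.
move=> f0 mf.
have -> : (\int[mu]_(x in D) f x = \int[mrestr mu mD]_(x in D) f x)%E.
  apply: eq_measure_integral => B mB BD; rewrite /= /mrestr.
  by congr (mu _); apply/esym/setIidl.
rewrite -{1}(setUv D) ge0_integral_setU//; last 3 first.
- exact: measurableC.
- by rewrite setUv.
- by apply/disj_setPS => x [].
rewrite [X in (_ + X)%E](_ : _ = 0%E) ?adde0//.
apply: null_set_integral; first exact: measurableC.
  exact: measurable_funTS.
by rewrite /= /mrestr setICl measure0.
Qed.

(** For a reversed curve the parameters that are sent into a time interval are known only up to the
    end points. *)
Lemma lebesgue_measure_sandwich (R : realType) (E : set R) (a b : R) :
  a <= b -> measurable E -> `]a, b[ `<=` E -> E `<=` `[a, b] ->
  lebesgue_measure E = (b - a)%:E.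
Proof.
move=> ab mE aE Eb; apply/eqP; rewrite eq_le; apply/andP; split.
  apply: (@le_trans _ _ (lebesgue_measure `[a, b]%classic)).
    by apply: le_measure; rewrite ?inE.
  rewrite lebesgue_measure_itv/= lte_fin; case: ltP => _; rewrite ?EFinB//.
  by rewrite sube_ge0// lee_fin.
apply: (@le_trans _ _ (lebesgue_measure `]a, b[%classic)); last first.
  by apply: le_measure; rewrite ?inE.
rewrite lebesgue_measure_itv/= lte_fin; case: ltP => [_|ba]; rewrite ?EFinB//.
by rewrite sube_le0// lee_fin.
Qed.

Section change_of_variables.
Context {R : realType} {X : pmetricType R}.
Local Open Scope ereal_scope.

(** A Lebesgue-Stieltjes measure is determined by its values on half-open intervals, so the
    variation measure is the image under [S] of Lebesgue measure on [D]. *)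
Lemma curve_integral_pushforward (c : test_curve X) (D : set R)
    (mD : measurable D) (S : R -> R) (h : X -> \bar R) :
  measurable_fun setT S -> (forall s, 0 <= S s <= 1)%R ->
  (forall x y, (x < y)%R ->
    lebesgue_measure (D `&` S @^-1` `]x, y]) =
    (curve_variation c y - curve_variation c x)%:E) ->
  borel_nonneg h ->
  curve_integral c h = \int[lebesgue_measure]_(s in D) h (c (S s)).
Proof.
move=> mS S01 HS bh; have [mh h0] := bh; have mhc := measurable_borel_curve c bh.
pose leb : {measure set (measurableTypeR R) -> \bar R} := mrestr (@lebesgue_measure R) mD.
have mS' : @measurable_fun _ _ (measurableTypeR R) (measurableTypeR R) setT S by exact: mS.
unshelve epose (nu := (pushforward leb (S : measurableTypeR R -> measurableTypeR R)
  : {measure set (measurableTypeR R) -> \bar R})); first exact: mS'.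
rewrite /curve_integral (@eq_measure_integral _ _ _ _ nu); last first.
  move=> B mB _; apply: lebesgue_stieltjes_measure_unique => // I.
  case/ocitvP => [->|[[x y] /= xy ->]]; first by rewrite !measure0.
  rewrite /nu /= /pushforward /= /mrestr /= setIC HS//.
  rewrite [LHS]measurable_mu_extE/=; last exact: is_ocitv.
  by rewrite wlength_itv/= lte_fin xy EFinB.
rewrite (@ge0_integral_pushforward _ _ (measurableTypeR R) (measurableTypeR R) _ _ mS' leb)//; last exact: measurable_funTS.
have -> : S @^-1` `[0%R, 1%R] = setT.
  by apply/seteqP; split => // s _ /=; rewrite in_itv/=.
apply: mrestr_integral; first by move=> s; exact: h0.
exact: (measurableT_comp mhc mS).
Qed.

(* The offset a serves the curves started at a later time, where it is the
   variation of the omitted part. *)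
Lemma curve_integral_inverse (c : test_curve X) (a : R) (T : R -> R)
    (h : X -> \bar R) :
  let D := `]a, (a + curve_variation c 1)%R]%classic in
  measurable_fun setT T -> (forall s, 0 <= T s <= 1)%R ->
  (forall s t, D s -> (T s <= t)%R = (s <= a + curve_variation c t)%R) ->
  borel_nonneg h ->
  curve_integral c h = \int[lebesgue_measure]_(s in D) h (c (T s)) /\
  curve_integral (reversal c) h =
    \int[lebesgue_measure]_(s in D) h (left_lim c (T s)).
Proof.
move=> D mT T01 HT bh.
have mD : measurable D by exact: measurable_itv.
have inD s : D s = (a < s <= a + curve_variation c 1)%R :> Prop.
  by rewrite /D /= in_itv.
split.
  apply: curve_integral_pushforward => // x y xy.
  have -> : D `&` T @^-1` `]x, y] = `](a + curve_variation c x)%R, (a + curve_variation c y)%R]%classic.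
    apply/seteqP; split => s /=; rewrite !in_itv/=.
      move=> [Ds]; rewrite ltNge HT// HT// -ltNge; exact.
    move=> /andP[xs sy].
    have Ds : D s.
      rewrite inD (le_lt_trans _ xs) ?lerDl ?curve_variation_ge0//=.
      by rewrite (le_trans sy)// lerD2l curve_variation_le1.
    by split => //; rewrite ltNge HT// HT// -ltNge xs.
  have xyV : (curve_variation c x <= curve_variation c y)%R.
    by apply: curve_variation_nd; exact: ltW.
  rewrite lebesgue_measure_itv/= lte_fin ltrD2l; case: ltP => ltV.
    by rewrite -EFinB; congr EFin; lra.
  by have -> : curve_variation c y = curve_variation c x by [lra]; rewrite subrr.
have -> : \int[lebesgue_measure]_(s in D) h (left_lim c (T s)) =
    \int[lebesgue_measure]_(s in D) h (reversal c (1 - T s)%R).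
  by apply: eq_integral => s _; rewrite left_lim_reversal.
apply: (@curve_integral_pushforward _ _ _ (fun s => 1 - T s)%R) => //.
- exact: measurable_funB.
- by move=> s; have /andP[? ?] := T01 s; apply/andP; split; lra.
move=> x y xy; rewrite !reversal_variation.
have -> : (curve_variation c 1 - variation_left c (1 - y) -
    (curve_variation c 1 - variation_left c (1 - x)) =
    (a + variation_left c (1 - x)) - (a + variation_left c (1 - y)))%R by lra.
(* [1 - T s] lies in []x, y]] iff [T s] lies in [[1 - y, 1 - x[]. This confines [s] between [a] plus
   the left limits of the variation at [1 - y] and [1 - x]; whether these two ends belong to the set
   is left open. *)
apply: lebesgue_measure_sandwich.
- by rewrite lerD2l variation_left_nd// lerD2l lerN2 ltW.
- apply: measurableI => //; rewrite -[X in measurable X]setTI.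
  by apply: measurable_funB.
- move=> s /=; rewrite !in_itv/= => /andP[ys sx].
  have Uy0 : (0 <= variation_left c (1 - y))%R.
    have [y1|y1] := leP (1 - y)%R 0%R; first by rewrite variation_left_le0.
    by rewrite -(variation_left_le0 c (lexx 0%R)) variation_left_nd// ltW.
  have Ds : D s.
    rewrite inD (le_lt_trans _ ys) ?lerDl//= (le_trans (ltW sx))// lerD2l.
    by rewrite (le_trans (variation_left_le_self _ _))// curve_variation_le1.
  split => //; apply/andP; split.
    rewrite ltrBrDr addrC -ltrBrDr.
    have e0 : (0 < (a + variation_left c (1 - x)) - s)%R by rewrite subr_gt0.
    have [z zx zV] := variation_left_adherent c (1 - x)%R e0.
    by apply: le_lt_trans zx; rewrite HT//; lra.
  rewrite lerBlDr addrC -lerBlDr leNgt; apply/negP => Ty.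
  have := le_variation_left c Ty.
  have := HT s (T s) Ds; rewrite lexx => /esym h1 h2.
  move: ys; lra.
- move=> s /= [Ds]; rewrite !in_itv/= => /andP[xT Ty].
  have := HT s (T s) Ds; rewrite lexx => /esym h1.
  apply/andP; split; last first.
    apply: (le_trans h1); rewrite lerD2l le_variation_left//; lra.
  rewrite -subr_ge0 opprD addrA subr_ge0.
  apply: variation_left_le => z zy.
  rewrite leNgt; apply/negP => szV.
  have : (T s <= z)%R by rewrite HT//; lra.
  lra.
Qed.

End change_of_variables.

Section quantile_integral.
Context {R : realType} {X : pmetricType R}.
Local Open Scope ereal_scope.

Lemma curve_integral_quantile (c : test_curve X) (h : X -> \bar R) :
  borel_nonneg h ->
  let D := `]0%R, curve_variation c 1]%classic in
  curve_integral c h = \int[lebesgue_measure]_(s in D) h (c (quantile c s)) /\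
  curve_integral (reversal c) h =
    \int[lebesgue_measure]_(s in D) h (left_lim c (quantile c s)).
Proof.
move=> bh; have := @curve_integral_inverse _ _ c 0%R (quantile c) h.
rewrite /= add0r; apply => //.
- exact: measurable_quantile.
- by move=> s; rewrite quantile_ge0 quantile_le1.
- by move=> s t; rewrite in_itv/= => s0; rewrite add0r quantile_le.
Qed.

Lemma measurable_quantile_curve (c : test_curve X) (h : X -> \bar R) :
  borel_nonneg h -> measurable_fun setT (fun s => h (c (quantile c s))).
Proof.
by move=> bh; exact: (measurableT_comp (measurable_borel_curve c bh) (measurable_quantile c)).
Qed.

Lemma measurable_quantile_left_lim (c : test_curve X) (h : X -> \bar R) :
  borel_nonneg h -> measurable_fun setT (fun s => h (left_lim c (quantile c s))).
Proof.
by move=> bh; exact: (measurableT_comp (measurable_borel_left_lim c bh) (measurable_quantile c)).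
Qed.

End quantile_integral.

(** * Tails of a curve *)

Section start_curve.
Context {R : realType} {X : pmetricType R}.
Implicit Types (c : test_curve X) (s t : R).

Let start c s t : X := c (Num.max t s).

Lemma tc_le0 c t : t <= 0 -> c t = c 0.
Proof. by rewrite le_eqVlt => /predU1P[->//|]; exact: tc_const_left. Qed.

Lemma tc_ge1 c t : 1 <= t -> c t = c 1.
Proof. by rewrite le_eqVlt => /predU1P[<-//|]; exact: tc_const_right. Qed.

Let start_left c s t : t < 0 -> start c s t = start c s 0.
Proof.
move=> t0; rewrite /start; have [s0|s0] := leP 0 s.
  by rewrite max_r// ltW// (lt_le_trans t0).
by rewrite tc_le0// ge_max !ltW.
Qed.

Let start_right c s t : 1 < t -> start c s t = start c s 1.
Proof.
move=> t1; rewrite /start tc_ge1; last by rewrite le_max ltW.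
by rewrite [RHS]tc_ge1// le_max lexx.
Qed.

Let mvariation_start c s a b p : itv_partition a b p ->
  mvariation a b (start c s) p <=
  curve_variation c (Num.max b s) - curve_variation c (Num.max a s).
Proof.
elim: p a => [|x p ih] a.
  by move=> /itv_partition_nil ->; rewrite mvariation_nil subrr.
move=> h; have ax : a < x by case: h => /= /andP[].
rewrite mvariation_cons; have := ih _ (itv_partition_cons h).
have : mdist (start c s x) (start c s a) <= curve_variation c (Num.max x s) - curve_variation c (Num.max a s).
  rewrite metric_sym; apply: mdist_le_curve_variation.
  by rewrite ge_max !le_max (ltW ax) lexx orbT.
lra.
Qed.

Let start_variation_fin c s : (mtotal_variation 0 1 (start c s) < +oo)%E.
Proof.
apply: (@le_lt_trans _ _ (curve_variation c (Num.max 1 s) - curve_variation c (Num.max 0 s))%:E); last exact: ltry.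
by apply/ge_ereal_sup => _ [p /mvariation_start h <-]; rewrite lee_fin.
Qed.

Let start_cvg_right c s t : start c s @ t^'+ --> start c s t.
Proof.
rewrite /start; have [st|ts] := leP s t.
  apply: cvg_trans (tc_right_continuous (g:=c) (t:=t)).
  apply: near_eq_cvg; near=> u.
  by rewrite max_l// (le_trans st)// ltW//; near: u; exact: nbhs_right_gt.
apply: cvg_near_eq; near=> u.
by rewrite max_r// ltW//; near: u; exact: nbhs_right_lt.
Unshelve. all: by end_near. Qed.

Let start_cvg_left c s t : s < t -> start c s @ t^'- --> left_lim c t.
Proof.
move=> st; apply: cvg_trans (left_lim_cvg (g:=c) (t:=t)).
apply: near_eq_cvg; near=> u.
by rewrite /start max_l// ltW//; near: u; exact: nbhs_left_gt.
Unshelve. all: by end_near. Qed.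

Let start_cvg_left_cst c s t : t <= s -> start c s @ t^'- --> c s.
Proof.
move=> ts; apply: cvg_near_eq; near=> u.
by rewrite /start max_r// (le_trans _ ts)// ltW//; near: u; exact: nbhs_left_lt.
Unshelve. all: by end_near. Qed.

Let start_cvg_left1 c s : start c s @ 1^'- --> start c s 1.
Proof.
have [s1|s1] := ltP s 1; last first.
  by rewrite {2}/start max_r//; exact: start_cvg_left_cst.
rewrite {2}/start max_l ?ltW//.
rewrite -(left_lim_eq (@tc_cvg_left1 R X c)); exact: start_cvg_left.
Qed.

Let start_left_lim c s t : exists l : X, start c s @ t^'- --> l.
Proof.
have [ts|st] := leP t s; first by exists (c s); exact: start_cvg_left_cst.
by exists (left_lim c t); exact: start_cvg_left.
Qed.

(** The curve waits at [c s] until time [s] and then follows [c]; waiting costs no variation. It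
    allows an upper gradient inequality to be applied from an intermediate point to the end. *)
Definition start_curve c s : test_curve X :=
  @TestCurve R X (fun t => c (Num.max t s)) (@start_left c s) (@start_right c s)
    (start_variation_fin c s) (fun t _ _ => @start_cvg_right c s t)
    (@start_cvg_left1 c s) (fun t _ _ => @start_left_lim c s t).

Lemma left_lim_start c s t : s < t -> left_lim (start_curve c s) t = left_lim c t.
Proof. by move=> st; apply: left_lim_eq; exact: start_cvg_left. Qed.

Lemma start_variation c s t : 0 <= s <= 1 ->
  curve_variation (start_curve c s) t =
  curve_variation c (Num.max t s) - curve_variation c s.
Proof.
move=> /andP[s0 s1].
have main u : 0 <= u <= 1 -> curve_variation (start_curve c s) u =
    curve_variation c (Num.max u s) - curve_variation c s.
  move=> /andP[u0 u1]; apply/eqP; rewrite eq_le; apply/andP; split.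
    rewrite -lee_fin EFin_curve_variation//.
    apply/ge_ereal_sup => _ [p /(mvariation_start c s) h <-]; rewrite lee_fin.
    by rewrite (max_r s0) in h.
  have [us|su] := leP u s; first by rewrite subrr curve_variation_ge0.
  (* After time [s] the two curves coincide, and so do their variations on [[s, u]]. *)
  have eqp p a : s <= a -> itv_partition a u p ->
      mvariation a u (start_curve c s) p = mvariation a u c p.
    elim: p a => [|x p ih] a sa; first by rewrite !mvariation_nil.
    move=> h; have ax : a < x by case: h => /= /andP[].
    rewrite !mvariation_cons (ih _ _ (itv_partition_cons h)); last by rewrite (le_trans sa)// ltW.
    by rewrite /= (max_l sa) max_l// (le_trans sa)// ltW.
  have : (curve_variation c u - curve_variation c s)%:E =
      (curve_variation (start_curve c s) u - curve_variation (start_curve c s) s)%:E.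
    rewrite !curve_variationB// ?(ltW su)//.
    rewrite /mtotal_variation; congr ereal_sup.
    by apply/seteqP; split => _ [p hp <-]; exists p => //; rewrite eqp.
  by move=> [->]; rewrite gerBl curve_variation_ge0.
have [t0|t0] := leP t 0.
  by rewrite curve_variation_le0// max_r ?subrr// (le_trans t0).
have [t1|t1] := leP 1 t; last by rewrite main// !ltW.
rewrite curve_variation_ge1// main ?ler01 ?lexx// max_l//.
by rewrite (@curve_variation_ge1 _ _ c (Num.max t s)) // le_max t1.
Qed.

(** The quantile function of [c] serves the tail too, with the variation up to [s] as offset. Its
    values on [D] exceed [s], where the tail agrees with [c], left limits included. *)
Lemma start_curve_integral c s h : 0 <= s <= 1 -> borel_nonneg h ->
  let D := `]curve_variation c s, curve_variation c 1]%classic in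
  curve_integral (start_curve c s) h =
    (\int[lebesgue_measure]_(r in D) h (c (quantile c r)))%E /\
  curve_integral (reversal (start_curve c s)) h =
    (\int[lebesgue_measure]_(r in D) h (left_lim c (quantile c r)))%E.
Proof.
move=> s01 bh D.
have /andP[s0 s1] := s01.
have V1 : curve_variation c s + curve_variation (start_curve c s) 1 = curve_variation c 1.
  by rewrite start_variation// (max_l s1) addrC subrK.
have r01 r : D r -> 0 < r <= curve_variation c 1.
  rewrite /D /= in_itv/= => /andP[sr ->]; rewrite andbT.
  by rewrite (le_lt_trans _ sr)// curve_variation_ge0.
have sq r : D r -> s < quantile c r.
  move=> Dr; rewrite ltNge quantile_le ?r01// -ltNge.
  by move: Dr; rewrite /D/= in_itv/= => /andP[].
have := @curve_integral_inverse _ _ (start_curve c s) (curve_variation c s) (quantile c) h.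
rewrite /= V1 => H; have [] := H (measurable_quantile c).
- by move=> r; rewrite quantile_ge0 quantile_le1.
- move=> r t Dr; rewrite quantile_le ?r01// start_variation// addrC subrK.
  have [//|ts] := leP s t.
  move: Dr; rewrite /D/= in_itv/= => /andP[sr _].
  apply/idP/idP => [rt|rs]; last by have := lt_le_trans sr rs; rewrite ltxx.
  by rewrite (le_trans rt)// curve_variation_nd// ltW.
- exact: bh.
move=> -> ->; split; apply: eq_integral => r /set_mem /sq sqr.
  by rewrite max_l// ltW.
by rewrite left_lim_start.
Qed.

End start_curve.

(** * Symmetrized integrals as functions of the integrand *)

Section sym_integral.
Context {R : realType} {X : pmetricType R}.
Implicit Types (c : test_curve X) (f g h : X -> \bar R).
Local Open Scope ereal_scope.

Lemma curve_integral_ge0 c h : (forall x, 0 <= h x) -> 0 <= curve_integral c h.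
Proof. by move=> h0; apply: integral_ge0. Qed.

Lemma sym_curve_integral_ge0 c h : (forall x, 0 <= h x) -> 0 <= sym_curve_integral c h.
Proof.
by move=> h0; rewrite mule_ge0// adde_ge0// curve_integral_ge0.
Qed.

Lemma curve_integral_le c f g : borel_nonneg f -> borel_nonneg g ->
  (forall x, f x <= g x) -> curve_integral c f <= curve_integral c g.
Proof.
move=> bf bg fg; apply: ge0_le_integral => //.
- by move=> t _; exact: bf.2.
- exact: (measurable_funTS (measurable_borel_curve c bf)).
- exact: (measurable_funTS (measurable_borel_curve c bg)).
Qed.

Lemma sym_curve_integral_le c f g : borel_nonneg f -> borel_nonneg g ->
  (forall x, f x <= g x) -> sym_curve_integral c f <= sym_curve_integral c g.
Proof.
move=> bf bg fg; rewrite lee_pmul2l ?lte_fin//.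
by apply: leeD; exact: curve_integral_le.
Qed.

Lemma curve_integralZ c (k : R) h : (0 <= k)%R -> borel_nonneg h ->
  curve_integral c (fun x => k%:E * h x) = k%:E * curve_integral c h.
Proof.
move=> k0 bh; rewrite /curve_integral ge0_integralZl_EFin//.
- by move=> t _; exact: bh.2.
- exact: (measurable_funTS (measurable_borel_curve c bh)).
Qed.

Lemma sym_curve_integralZ c (k : R) h : (0 <= k)%R -> borel_nonneg h ->
  sym_curve_integral c (fun x => k%:E * h x) = k%:E * sym_curve_integral c h.
Proof.
move=> k0 bh; rewrite /sym_curve_integral !curve_integralZ//.
rewrite -ge0_muleDr ?curve_integral_ge0//; try exact: bh.2.
by rewrite muleCA.
Qed.

Lemma curve_integralD c f g : borel_nonneg f -> borel_nonneg g ->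
  curve_integral c (f \+ g) = curve_integral c f + curve_integral c g.
Proof.
move=> bf bg; rewrite /curve_integral ge0_integralD//.
- by move=> t _; exact: bf.2.
- exact: (measurable_funTS (measurable_borel_curve c bf)).
- by move=> t _; exact: bg.2.
- exact: (measurable_funTS (measurable_borel_curve c bg)).
Qed.

Lemma sym_curve_integralD c f g : borel_nonneg f -> borel_nonneg g ->
  sym_curve_integral c (f \+ g) = sym_curve_integral c f + sym_curve_integral c g.
Proof.
move=> bf bg; rewrite /sym_curve_integral !curve_integralD//.
have f0 := bf.2; have g0 := bg.2.
rewrite addeACA ge0_muleDr//; by rewrite adde_ge0 ?curve_integral_ge0.
Qed.

(* Explicit proof terms: unifying c with its reversal unfolds both curves. *)
Lemma sym_curve_integral_reversal c h :
  sym_curve_integral (reversal c) h = sym_curve_integral c h.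
Proof.
pose I c' := curve_integral c' h.
exact (etrans
  (f_equal (fun c' => 2^-1%:E * (I (reversal c) + I c')) (reversalK c))
  (f_equal (fun r => 2^-1%:E * r) (addeC (I (reversal c)) (I c)))).
Qed.

Implicit Types mu : borel_measure R (@TC_open R X).

Lemma sym_measure_integral_le mu f g : borel_nonneg f -> borel_nonneg g ->
  (forall x, f x <= g x) -> sym_measure_integral mu f <= sym_measure_integral mu g.
Proof.
move=> bf bg fg; apply: ge0_lower_integral_le => c.
  exact/sym_curve_integral_ge0/bf.2.
exact: sym_curve_integral_le.
Qed.

Lemma sym_measure_integralZ mu (k : R) h : (0 < k)%R -> borel_nonneg h ->
  k%:E * sym_measure_integral mu h <= sym_measure_integral mu (fun x => k%:E * h x).
Proof.
move=> k0 bh; apply: le_trans (ge0_lower_integralZ _ k0 _) _.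
  by move=> c; exact/sym_curve_integral_ge0/bh.2.
apply: ge0_lower_integral_le => c.
  by rewrite mule_ge0 ?lee_fin ?(ltW k0)//; exact/sym_curve_integral_ge0/bh.2.
by rewrite sym_curve_integralZ// ltW.
Qed.

Lemma sym_measure_integralD mu f g : borel_nonneg f -> borel_nonneg g ->
  sym_measure_integral mu f + sym_measure_integral mu g <=
  sym_measure_integral mu (f \+ g).
Proof.
move=> bf bg; apply: le_trans (ge0_lower_integralD _ _ _) _.
- by move=> c; exact/sym_curve_integral_ge0/bf.2.
- by move=> c; exact/sym_curve_integral_ge0/bg.2.
apply: ge0_lower_integral_le => c.
  by rewrite adde_ge0//; [exact/sym_curve_integral_ge0/bf.2|exact/sym_curve_integral_ge0/bg.2].
by rewrite sym_curve_integralD.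
Qed.

End sym_integral.

Lemma mtotal_variation_le_diff (R : realType) (X : pmetricType R) (f : R -> X) (W : R -> R) a b :
  (forall x y, x <= y -> mdist (f x) (f y) <= W y - W x) ->
  (mtotal_variation a b f <= (W b - W a)%:E)%E.
Proof.
move=> H; apply/ge_ereal_sup => _ [p hp <-]; rewrite lee_fin.
elim: p a hp => [|x p ih] a.
  by move=> /itv_partition_nil ->; rewrite mvariation_nil subrr.
move=> h; have ax : a < x by case: h => /= /andP[].
rewrite mvariation_cons; have := ih _ (itv_partition_cons h).
have := H _ _ (ltW ax); rewrite metric_sym; lra.
Qed.

(** * Jump curves and Dirac masses *)

Section jump_curve.
Context {R : realType} {X : pmetricType R}.
Implicit Types (x y : X) (t : R).

Let jump x y t : X := if t < 2^-1 then x else y.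
Let W x y t : R := if t < 2^-1 then 0 else mdist x y.

Let half01 : (0 : R) < 2^-1 /\ (2^-1 : R) < 1.
Proof. by split; lra. Qed.

Let jump_left x y t : t < 0 -> jump x y t = jump x y 0.
Proof. by move=> t0; rewrite /jump half01.1 (lt_trans t0)// half01.1. Qed.

Let jump_right x y t : 1 < t -> jump x y t = jump x y 1.
Proof. by move=> t1; rewrite /jump !ifF//; apply/negbTE; rewrite -leNgt; lra. Qed.

Let mdist_jump x y s t : s <= t -> mdist (jump x y s) (jump x y t) <= W x y t - W x y s.
Proof.
move=> st; rewrite /jump /W; case: (ltP s) => h1; case: (ltP t) => h2; rewrite ?mdistxx ?subr0 ?subrr//.
lra.
Qed.

Let jump_variation_fin x y : (mtotal_variation 0 1 (jump x y) < +oo)%E.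
Proof.
apply: le_lt_trans (mtotal_variation_le_diff _ _ (@mdist_jump x y)) _; exact: ltry.
Qed.

Let jump_cvg_right x y t : jump x y @ t^'+ --> jump x y t.
Proof.
rewrite {2}/jump; case: ltP => t2; apply: cvg_near_eq.
  by apply: filterS (nbhs_right_lt t2) => u u2; rewrite /jump u2.
apply: filterS (nbhs_right_gt t) => u tu.
by rewrite /jump ltNge (le_trans t2 (ltW tu)).
Qed.

Let jump_cvg_left x y t : jump x y @ t^'- --> (if t <= 2^-1 then x else y).
Proof.
case: leP => t2; apply: cvg_near_eq.
  by apply: filterS (nbhs_left_lt t) => u ut; rewrite /jump (lt_le_trans ut t2).
by apply: filterS (nbhs_left_gt t2) => u u2; rewrite /jump ltNge (ltW u2).
Qed.

Let jump_cvg_left1 x y : jump x y @ 1^'- --> jump x y 1.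
Proof.
have := @jump_cvg_left x y 1.
by rewrite leNgt half01.2/= /jump ltNge (ltW half01.2).
Qed.

Let jump_left_lim x y t : exists l : X, jump x y @ t^'- --> l.
Proof. by exists (if t <= 2^-1 then x else y). Qed.

Definition jump_curve x y : test_curve X :=
  @TestCurve R X (fun t => if t < 2^-1 then x else y) (@jump_left x y) (@jump_right x y)
    (jump_variation_fin x y) (fun t _ _ => @jump_cvg_right x y t)
    (@jump_cvg_left1 x y) (fun t _ _ => @jump_left_lim x y t).

Lemma jump_curve0 x y : jump_curve x y 0 = x.
Proof. by rewrite /= half01.1. Qed.

Lemma jump_curve1 x y : jump_curve x y 1 = y.
Proof. by rewrite /= ifF//; apply/negbTE; rewrite -leNgt; lra. Qed.

Lemma jump_curve_reversal x y : reversal (jump_curve x y) = jump_curve y x.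
Proof.
apply: test_curve_eq => t; apply: left_lim_eq.
have := @jump_cvg_left x y (1 - t); rewrite /=.
case: (leP (1 - t)) => h; case: ltP => h2 //; lra.
Qed.

Lemma jump_curve_variation x y t :
  curve_variation (jump_curve x y) t = if t < 2^-1 then 0 else mdist x y.
Proof.
have [h0 h1] := half01.
have main u : 0 <= u -> u <= 1 -> curve_variation (jump_curve x y) u = W x y u.
  move=> u0 u1; apply/eqP; rewrite -eqe EFin_curve_variation// eq_le; apply/andP; split.
    have := mtotal_variation_le_diff 0 u (@mdist_jump x y).
    by rewrite {2}/W h0 subr0.
  rewrite /W; case: (ltP u) => hu; first exact: mtotal_variation_ge0.
  have u00 : 0 < u by lra.
  apply: le_trans (mvariation_le _ (itv_partition1 u00)).
  rewrite mvariation_cons mvariation_nil addr0 lee_fin /= h0 ifF; last by apply/negbTE; rewrite -leNgt.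
  by rewrite metric_sym.
have [t0|t0] := leP t 0.
  by rewrite curve_variation_le0// ifT//; lra.
have [t1|t1] := leP 1 t.
  rewrite curve_variation_ge1// main// /W !ifF//; apply/negbTE; rewrite -leNgt; lra.
by rewrite main// ltW.
Qed.

Lemma jump_curve_length x y : curve_length (jump_curve x y) = (mdist x y)%:E.
Proof.
rewrite curve_lengthE jump_curve_variation ifF//; apply/negbTE; rewrite -leNgt; lra.
Qed.

Lemma jump_curve_TC0 x y : TC0 (jump_curve x y) <-> x <> y.
Proof.
rewrite /TC0 /= jump_curve_length lte_fin mdist_gt0.
by split => [/eqP|/eqP].
Qed.

(** The variation measure is a point mass of weight [mdist x y] at 1/2, the image of Lebesgue
    measure on []0, mdist x y]] under a constant map. *)
Lemma curve_integral_jump x y h : borel_nonneg h ->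
  curve_integral (jump_curve x y) h = (h y * (mdist x y)%:E)%E.
Proof.
move=> bh; have [h0 h1] := half01.
rewrite (@curve_integral_pushforward _ _ _ `]0, mdist x y] _ (cst 2^-1))//; last 2 first.
- by move=> s /=; apply/andP; split; lra.
- move=> a b ab; rewrite !jump_curve_variation.
  have [aH|aH] := ltP a 2^-1; last first.
    rewrite ifF; last by apply/negbTE; rewrite -leNgt; lra.
    rewrite subrr (_ : _ `&` _ = set0) ?measure0//.
    by apply/seteqP; split => s //= [_]; rewrite in_itv/= => /andP[]; lra.
  have [bH|bH] := ltP b 2^-1.
    rewrite subrr (_ : _ `&` _ = set0) ?measure0//.
    by apply/seteqP; split => s //= [_]; rewrite in_itv/= => /andP[]; lra.
  rewrite subr0 (_ : _ `&` _ = `]0, mdist x y]%classic); last first.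
    apply/seteqP; split => s /=; first by case.
    by move=> ->; split => //; rewrite in_itv/= aH.
  rewrite lebesgue_measure_itv/= lte_fin; case: ltP => [_|d0]; rewrite ?sube0//.
  by have := mdist_ge0 x y => d1; have -> : mdist x y = 0 by lra.
rewrite /cst /= ltxx integral_cst//.
congr (_ * _)%E; rewrite [LHS]lebesgue_measure_itv/= lte_fin; case: ltP => [_|d0]; rewrite ?sube0//.
by have := mdist_ge0 x y => d1; have -> : mdist x y = 0 by lra.
Qed.

Lemma sym_curve_integral_jump x y h : borel_nonneg h ->
  sym_curve_integral (jump_curve x y) h =
  (2^-1%:E * ((h x + h y) * (mdist x y)%:E))%E.
Proof.
move=> bh; rewrite /sym_curve_integral jump_curve_reversal !curve_integral_jump//.
by rewrite (metric_sym y x) ge0_muleDl ?bh.2// addeC.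
Qed.

End jump_curve.

Section dirac.
Context {R : realType} {X : pmetricType R}.
Local Open Scope ereal_scope.

Let setsT : set (set (test_curve X)) := setT.

Let setsT_sigma : sigma_algebra setT setsT. Proof. by []. Qed.

(** On the sigma-algebra of all sets every functional of curves is measurable, so that integration
    against this measure is evaluation at [c]. *)
Definition dirac_curve (c : test_curve X) : borel_measure R (@TC_open R X) :=
  BorelMeasure setsT_sigma (@subsetT _ _) (dirac (c : g_sigma_algebraType setsT)).

Let setsT_measurable (A : set (g_sigma_algebraType setsT)) : measurable A.
Proof. by apply: sub_sigma_algebra. Qed.

Lemma dirac_curve_integral c (I : test_curve X -> \bar R) :
  \int[dirac_curve c]_x I x = I c.
Proof.
by rewrite integral_dirac// diracT mul1e.
Qed.

Lemma dirac_curve_M0 c : M0 (dirac_curve c) <-> TC0 c.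
Proof.
rewrite /M0 /= diracE; case: (boolP (c \in ~` TC0)) => [/set_mem|/negP] h.
  by split => [[]/eqP|/h//]; rewrite oner_eq0.
by split => // _; apply: contrapT => /mem_set.
Qed.

End dirac.

(** * Evaluation at the end points *)

Section evaluation.
Context {R : realType} {X : pmetricType R}.
Local Open Scope ereal_scope.

Section bounded_test.
Variable psi : X -> R.
Hypothesis psi0 : forall x, (0 <= psi x)%R.
Hypothesis psi2 : forall x, (psi x <= 2)%R.
Hypothesis psiL : forall x y, (`|psi x - psi y| <= Num.min 1 (mdist x y))%R.
Variable I : set R.
Hypothesis mI : measurable I.
Hypothesis I01 : I `<=` `[0%R, 1%R].

Let J (c : test_curve X) := \int[lebesgue_measure]_(s in I) (psi (c s))%:E.

Let mpsi (c : test_curve X) : measurable_fun setT (fun s => (psi (c s))%:E).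
Proof.
apply/measurable_EFinP; apply: (@bv_measurable _ _ (curve_variation c)).
  exact: curve_variation_nd.
move=> x y xy; apply: le_trans (mdist_le_curve_variation c xy).
by rewrite distrC (le_trans (psiL _ _))// ge_min lexx orbT.
Qed.

Hint Extern 0 (measurable_fun _ _) => solve [exact: mpsi] : core.

Let J0 c : 0 <= J c.
Proof. by apply: integral_ge0 => s _; rewrite lee_fin. Qed.

Let Jfin c : J c \is a fin_num.
Proof.
rewrite ge0_fin_numE//; apply: (@le_lt_trans _ _ (\int[lebesgue_measure]_(s in `[0%R, 1%R]) cst (2%R)%:E s)).
  apply: (@le_trans _ _ (\int[lebesgue_measure]_(s in `[0%R, 1%R]) (psi (c s))%:E)).
    apply: ge0_subset_integral => //; first by apply: measurable_funTS.
    by move=> s _; rewrite lee_fin.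
  apply: ge0_le_integral => //; try by [apply: measurable_funTS|move=> s _; rewrite lee_fin].
rewrite integral_cst// [X in (_ * X)%E]lebesgue_measure_itv/= lte_fin ltr01 sube0 mule1.
exact: ltry.
Qed.

Let J_lip c c' : J c <= J c' + dTC c c'.
Proof.
have mmin : measurable_fun setT (fun s => (Num.min 1 (mdist (c s) (c' s)))%:E : \bar R).
  apply/measurable_EFinP; apply: measurable_minr => //.
  exact: measurable_mdist_test_curve.
have min0 s : 0 <= (Num.min 1 (mdist (c s) (c' s)))%:E :> \bar R.
  by rewrite lee_fin le_min ler01 mdist_ge0.
apply: (@le_trans _ _ (J c' + \int[lebesgue_measure]_(s in I) (Num.min 1 (mdist (c s) (c' s)))%:E)).
  rewrite -ge0_integralD//; last 3 first.
  - by move=> s _; rewrite lee_fin.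
  - by apply: measurable_funTS.
  - by apply: measurable_funTS.
  apply: ge0_le_integral => //.
  - by move=> s _; rewrite lee_fin.
  - by apply: measurable_funTS.
  - by apply: emeasurable_funD; by apply: measurable_funTS.
  move=> s _; rewrite -EFinD lee_fin.
  have := psiL (c s) (c' s); rewrite ler_norml => /andP[_]; lra.
apply: leeD => //; apply: ge0_subset_integral => //.
by apply: measurable_funTS.
Qed.

(** The map [J] is 1-Lipschitz for [dTC], so the sets where it exceeds a constant are open. *)
Lemma measurable_curve_average :
  measurable_fun [set: g_sigma_algebraType (@TC_open R X)] J.
Proof.
apply: (measurability (@ErealGenOInfty.G R)) => [|/= _ [_] [r] -> <-].
  exact: ErealGenOInfty.measurableE.
rewrite setTI; apply: sub_sigma_algebra => c /=; rewrite in_itv/= andbT => rJ.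
have := rJ; rewrite -(fineK (Jfin c)) lte_fin => rJ'.
exists (fine (J c) - r)%R; first by rewrite subr_gt0.
move=> c' cc'; rewrite in_itv/= andbT.
have := J_lip c c'.
rewrite -(fineK (Jfin c)) -(fineK (Jfin c')).
have d0 : 0 <= dTC c c'.
  by apply: integral_ge0 => s _; rewrite lee_fin le_min ler01 mdist_ge0.
have dfin : dTC c c' \is a fin_num by rewrite ge0_fin_numE// (lt_trans cc')// ltry.
move: cc'; rewrite -(fineK dfin) -EFinD lte_fin lee_fin lte_fin; lra.
Qed.

Lemma curve_average_approx (c : test_curve X) (x : X) (e l : R) :
  (0 < l)%R -> lebesgue_measure I = l%:E ->
  (forall s, I s -> (mdist x (c s) <= e)%R) ->
  `|(l^-1)%:E * J c - (psi x)%:E| <= e%:E.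
Proof.
move=> l0 Il He.
have up : J c <= ((psi x + e) * l)%:E.
  rewrite EFinM -Il -integral_cst//; apply: ge0_le_integral => //.
  - by move=> s _; rewrite lee_fin.
  - by apply: measurable_funTS.
  move=> s Is; rewrite lee_fin; have := psiL x (c s); have := He _ Is.
  rewrite le_min !ler_norml => h /andP[_ /andP[h1 h2]]; lra.
have dn : ((psi x - e) * l)%:E <= J c.
  have [h0|h0] := leP 0%R (psi x - e)%R; last first.
    by apply: le_trans (J0 c); rewrite lee_fin nmulr_rle0// ltW.
  rewrite EFinM -Il -integral_cst//; apply: ge0_le_integral => //.
  - by apply: measurable_funTS.
  move=> s Is; rewrite lee_fin; have := psiL x (c s); have := He _ Is.
  rewrite le_min !ler_norml => h /andP[_ /andP[h1 h2]]; lra.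
move: up dn; rewrite -(fineK (Jfin c)) !lee_fin => up dn.
rewrite ler_norml; apply/andP; split.
  by rewrite lerBrDr addrC -ler_pdivrMl ?invr_gt0// invrK mulrC.
by rewrite lerBlDr ler_pdivrMl// mulrC addrC.
Qed.

End bounded_test.

(** Evaluation at a point is not continuous for an integral metric. It is however the limit of
    averages over intervals that shrink to [t] from a side on which the curve is continuous. *)
Lemma measurable_evaluation (t : R) (I : nat -> set R) :
  (forall n, measurable (I n)) -> (forall n, I n `<=` `[0%R, 1%R]) ->
  (forall n, lebesgue_measure (I n) = (n.+1%:R^-1)%:E) ->
  (forall (c : test_curve X) (e : R), (0 < e)%R ->
     \forall n \near \oo, forall s, I n s -> (mdist (c t) (c s) <= e)%R) ->
  measurable_fun [set: g_sigma_algebraType (@TC_open R X)]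
    ((fun c : test_curve X => c t) : _ -> g_sigma_algebraType (@open X)).
Proof.
move=> mI I01 Il Icvg; apply: measurable_to_metric => phi phi1.
(* [phi] oscillates by at most 1, so this shift has values in [0, 2]; nonnegative integrands are
   easier to integrate. *)
pose psi x : R := (phi x - phi point + 1)%R.
have psib x : (0 <= psi x <= 2)%R.
  have := phi1 x point; rewrite le_min /psi !ler_norml => /andP[/andP[h1 h2] _].
  by apply/andP; split; lra.
have psiL x y : (`|psi x - psi y| <= Num.min 1 (mdist x y))%R.
  rewrite (_ : psi x - psi y = phi x - phi y)%R; first exact: phi1.
  by rewrite /psi; lra.
suff : measurable_fun [set: g_sigma_algebraType (@TC_open R X)]
    (fun c : test_curve X => (psi (c t))%:E).
  move/measurable_EFinP => mpsi.
  have -> : phi \o (fun c : test_curve X => c t) =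
      ((fun c => psi (c t)) \- cst (1 - phi point))%R.
    by apply/funext => c /=; rewrite /psi; lra.
  exact: measurable_funB.
pose F n (c : test_curve X) :=
  ((n.+1%:R^-1)^-1)%:E * \int[lebesgue_measure]_(s in I n) (psi (c s))%:E.
apply: (@emeasurable_fun_cvg _ (g_sigma_algebraType (@TC_open R X)) _ setT F) => [n|c _].
  apply: measurable_funeM; apply: measurable_curve_average => //.
  - by move=> x; have /andP[] := psib x.
  - by move=> x; have /andP[] := psib x.
have Fb (e : R) : (0 < e)%R -> \forall n \near \oo, `|F n c - (psi (c t))%:E| <= e%:E.
  move=> e0; have := Icvg c _ e0; apply: filterS => n Hn.
  apply: curve_average_approx => //.
  - by move=> x; have /andP[] := psib x.
  - by move=> x; have /andP[] := psib x.
apply/fine_cvgP; split.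
  apply: filterS (Fb _ ltr01) => n; case: (F n c) => [r| |] //=.
apply/cvgrPdist_le => e e0; apply: filterS (Fb _ e0) => n /=.
by case: (F n c) => [r| |] //=; rewrite lee_fin distrC.
Qed.

Let itv_measure (a b : R) n : b = (a + n.+1%:R^-1)%R ->
  lebesgue_measure `[a, b]%classic = (n.+1%:R^-1)%:E.
Proof.
move=> ->; rewrite [LHS]lebesgue_measure_itv/= lte_fin ltrDl invr_gt0 ltr0n.
by rewrite -EFinB addrAC subrr add0r.
Qed.

Lemma measurable_evaluation0 :
  measurable_fun [set: g_sigma_algebraType (@TC_open R X)]
    ((fun c : test_curve X => c 0%R) : _ -> g_sigma_algebraType (@open X)).
Proof.
apply: (@measurable_evaluation 0%R (fun n => `[0%R, (n.+1%:R^-1)%R]%classic)).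
- by move=> n.
- move=> n s /=; rewrite !in_itv/= => /andP[-> sn] /=.
  by rewrite (le_trans sn)// invf_le1// ler1n.
- by move=> n; apply: itv_measure; rewrite add0r.
move=> c e e0.
have : \forall u \near 0%R^'+, (mdist (c 0%R) (c u) <= e)%R.
  by apply: metricType_numDomainType.cvgr_dist_le (@tc_right_continuous _ _ c 0%R) _ e0.
move=> [d /= d0 H].
apply: filterS (near_infty_natSinv_lt (PosNum d0)) => n /= nd s.
rewrite in_itv/= => /andP[s0 sn].
move: s0; rewrite le_eqVlt => /predU1P[<-|s0]; first by rewrite mdistxx ltW.
apply: H => //=; rewrite sub0r normrN gtr0_norm//.
exact: le_lt_trans nd.
Qed.

Lemma measurable_evaluation1 :
  measurable_fun [set: g_sigma_algebraType (@TC_open R X)]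
    ((fun c : test_curve X => c 1%R) : _ -> g_sigma_algebraType (@open X)).
Proof.
apply: (@measurable_evaluation 1%R (fun n => `[(1 - n.+1%:R^-1)%R, 1%R]%classic)).
- by move=> n.
- move=> n s /=; rewrite !in_itv/= => /andP[sn ->]; rewrite andbT.
  by rewrite (le_trans _ sn)// subr_ge0 invf_le1// ler1n.
- by move=> n; apply: itv_measure; rewrite subrK.
move=> c e e0.
have : \forall u \near 1%R^'-, (mdist (c 1%R) (c u) <= e)%R.
  by apply: metricType_numDomainType.cvgr_dist_le (@tc_cvg_left1 _ _ c) _ e0.
move=> [d /= d0 H].
apply: filterS (near_infty_natSinv_lt (PosNum d0)) => n /= nd s.
rewrite in_itv/= => /andP[sn s1].
move: s1; rewrite le_eqVlt => /predU1P[->|s1]; first by rewrite mdistxx ltW.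
apply: H => //=; rewrite gtr0_norm ?subr_gt0//.
by apply: le_lt_trans nd; rewrite lerBlDr addrC -lerBlDr.
Qed.

End evaluation.

Lemma ge0_integral_tail (R : realType) (G : R -> \bar R) (L e : R) :
  0 < L -> 0 < e -> measurable_fun setT G -> (forall x, (0 <= G x)%E) ->
  (\int[lebesgue_measure]_(x in `]0%R, L]) G x < +oo)%E ->
  exists2 s, 0 < s < L & (\int[lebesgue_measure]_(x in `]s, L]) G x <= e%:E)%E.
Proof.
move=> L0 e0 mG G0 GL.
(* With [n.+1] in place of [n.+2] the point [u 0] would be 0, which is excluded. *)
pose u n : R := L - L / n.+2%:R.
have u0 n : 0 < u n < L.
  rewrite /u gtrBl divr_gt0// andbT subr_gt0 ltr_pdivrMr// ltr_pMr//.
  by rewrite ltr1n.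
pose F n := `]0, u n]%classic.
have ndF : nondecreasing_seq F.
  move=> m n mn; apply/subsetPset => x; rewrite /F /= !in_itv/= => /andP[-> xm] /=.
  rewrite (le_trans xm)// lerD2l lerN2 ler_pM2l// lef_pV2 ?posrE//.
  by rewrite ler_nat.
have UF : \bigcup_n F n = `]0, L[%classic.
  apply/seteqP; split => [x [n _]|x]; rewrite /F /= !in_itv/=.
    by have /andP[_ uL] := u0 n; move=> /andP[-> xn]; rewrite (le_lt_trans xn).
  move=> /andP[x0 xL].
  have d0 : 0 < (L - x) / L by rewrite divr_gt0// subr_gt0.
  have [n _ Hn] := near_infty_natSinv_lt (PosNum d0).
  exists n => //; rewrite /F /= in_itv/= x0 /= /u lerBrDr addrC -lerBrDr.
  have := Hn n.+1 (leqnSn n) => /= /ltW; by rewrite ler_pdivlMr// mulrC.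
have mF n : measurable (F n) by exact: measurable_itv.
have := @ge0_nondecreasing_set_cvg_integral _ (measurableTypeR R) _ F G (@lebesgue_measure R) ndF mF
  (fun n => measurable_funTS mG) (fun n x _ => G0 x).
rewrite UF integral_itv_bndo_bndc//; last exact: measurable_funTS.
set I := (X in _ --> X).
have I0 : (0 <= I)%E by apply: integral_ge0.
have Ifin : I \is a fin_num by rewrite ge0_fin_numE.
rewrite -(fineK Ifin) => /fine_cvgP[_ /cvgrPdist_le/(_ _ e0)] [n _ /(_ n (leqnn n)) /= Hn].
exists (u n) => //.
have/andP[un0 unL] := u0 n.
have eI : I = (\int[lebesgue_measure]_(x in F n) G x +
    \int[lebesgue_measure]_(x in `]u n, L]) G x)%E.
  rewrite /I -(@ge0_integral_setU _ (measurableTypeR R) _ lebesgue_measure _ _ (mF n))//.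
  - congr (integral _ _ _); apply/seteqP; split => x; rewrite /F /= !in_itv/=.
      by move=> /andP[-> ->]; case: leP; [left|right].
    case => /andP[x1 x2]; apply/andP; split => //.
    + by rewrite (le_trans x2)// ltW.
    + exact: lt_trans x1.
  - exact: measurable_funTS.
  - apply/disj_setPS => x []; rewrite /F /= !in_itv/= => /andP[_ xu] /andP[ux _].
    by have := lt_le_trans ux xu; rewrite ltxx.
pose I1 := (\int[lebesgue_measure]_(x in F n) G x)%E.
pose I2 := (\int[lebesgue_measure]_(x in `]u n, L]) G x)%E.
have {}Hn : `|fine I - fine I1| <= e by exact: Hn.
have {}eI : I = (I1 + I2)%E by exact: eI.
change (I2 <= e%:E)%E.
have I10 : (0 <= I1)%E by apply: integral_ge0.
have I20 : (0 <= I2)%E by apply: integral_ge0.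
have I1fin : I1 \is a fin_num.
  by rewrite ge0_fin_numE// (le_lt_trans _ GL)// -/I eI leeDl.
have I2fin : I2 \is a fin_num.
  by rewrite ge0_fin_numE// (le_lt_trans _ GL)// -/I eI leeDr.
move: Hn; rewrite eI fineD// addrAC subrr add0r ger0_norm ?fine_ge0//.
by rewrite -[X in _ -> (X <= _)%E](fineK I2fin) lee_fin.
Qed.

(** * Functions that vanish off a Borel set *)

Section vanishing.
Context {R : realType} {X : pmetricType R}.
Implicit Types (c : test_curve X) (f : X -> R) (g h : X -> \bar R) (N : set X).
Local Open Scope ereal_scope.

Definition infty_on N (x : X) : \bar R := +oo * (\1_N x)%:E.

Lemma infty_on_in N x : N x -> infty_on N x = +oo.
Proof. by move=> Nx; rewrite /infty_on indicE mem_set// mule1. Qed.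

Lemma infty_on_out N x : ~ N x -> infty_on N x = 0.
Proof. by move=> Nx; rewrite /infty_on indicE memNset// mule0. Qed.

Lemma infty_on_ge0 N x : 0 <= infty_on N x.
Proof.
by have [/infty_on_in->|/infty_on_out->] := pselect (N x).
Qed.

Lemma borel_nonneg_infty_on N : <<s @open X >> N -> borel_nonneg (infty_on N).
Proof.
move=> bN; split; last exact: infty_on_ge0.
rewrite /borel_fun; apply: measurable_funeM; apply/measurable_EFinP.
exact: (@measurable_indic _ (g_sigma_algebraType (@open X))).
Qed.

Lemma TC0E c : TC0 c = (0 < curve_variation c 1)%R :> Prop.
Proof. by rewrite /TC0 /= curve_lengthE lte_fin. Qed.

Lemma notTC0_eq c : ~ TC0 c -> c 1%R = c 0%R.
Proof.
rewrite TC0E => /negP; rewrite -leNgt => V0.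
have := mdist_le_curve_variation c (@ler01 R).
rewrite (curve_variation_le0 c (lexx 0%R)) subr0 => /le_trans/(_ V0) d0.
by apply/esym/mdist_positivity/eqP; rewrite eq_le d0 mdist_ge0.
Qed.

Lemma sym_curve_integral_lty c h : (forall x, 0 <= h x) ->
  sym_curve_integral c h < +oo ->
  curve_integral c h < +oo /\ curve_integral (reversal c) h < +oo.
Proof.
move=> h0; have c0 := curve_integral_ge0 c h0.
have r0 := curve_integral_ge0 (reversal c) h0.
rewrite /sym_curve_integral; move: c0 r0.
set A := curve_integral c h; set B := curve_integral (reversal c) h.
case: A => [a| |] //; case: B => [b| |] // a0 b0.
- by move=> _; split; exact: ltry.
- by rewrite addey// gt0_muley ?lte_fin.
- by rewrite addye// gt0_muley ?lte_fin.
- by rewrite addye// gt0_muley ?lte_fin.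
Qed.

(** A finite integral of [infty_on N] forces the curve to leave [N] at parameters arbitrarily close
    to the end. From such a point, where [f] is 0, the gradient inequality along the tail bounds
    [f (c 1)] by a tail of the convergent integral of [g]. *)
Lemma vanishing_end f g N c : <<s @open X >> N ->
  (forall x, ~ N x -> f x = 0%R) -> borel_nonneg g ->
  (forall c, `|f (c 1%R) - f (c 0%R)|%:E <= sym_curve_integral c g) ->
  TC0 c -> sym_curve_integral c (g \+ infty_on N) < +oo -> f (c 1%R) = 0%R.
Proof.
move=> bN fN bg fg; rewrite TC0E => L0.
have bi := borel_nonneg_infty_on bN.
rewrite sym_curve_integralD// => fin.
have gfin : sym_curve_integral c g < +oo.
  by apply: le_lt_trans fin; rewrite leeDl// sym_curve_integral_ge0//; exact: bi.2.
have ifin : sym_curve_integral c (infty_on N) < +oo.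
  by apply: le_lt_trans fin; rewrite leeDr// sym_curve_integral_ge0//; exact: bg.2.
have [g1 g2] := sym_curve_integral_lty bg.2 gfin.
have [i1 _] := sym_curve_integral_lty bi.2 ifin.
move: g1 g2 i1.
have [-> ->] := curve_integral_quantile c bg.
have [-> _] := curve_integral_quantile c bi.
set D := `]0%R, _]%classic => g1 g2 i1.
have mD : measurable D by exact: measurable_itv.
have mG1 := measurable_quantile_curve c; have mG2 := measurable_quantile_left_lim c.
pose G s := g (c (quantile c s)) + g (left_lim c (quantile c s)).
have mG : measurable_fun setT G by apply: emeasurable_funD; [exact: mG1|exact: mG2].
have G0 s : 0 <= G s by apply: adde_ge0; exact: bg.2.
have GD : \int[lebesgue_measure]_(s in D) G s < +oo.
  rewrite ge0_integralD//; last 4 first.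
  - by move=> s _; exact: bg.2.
  - exact: (measurable_funTS (mG1 _ bg)).
  - by move=> s _; exact: bg.2.
  - exact: (measurable_funTS (mG2 _ bg)).
  by rewrite lte_add_pinfty.
apply/eqP; rewrite -normr_le0; apply/ler_addgt0Pr => e e0; rewrite add0r.
have [s /andP[s0 sL] Gs] := ge0_integral_tail L0 e0 mG G0 GD.
(* Otherwise [infty_on N] is infinite on the whole parameter interval []s, V(1)]], which has
   positive length. *)
have [sg [sg1 sgN]] : exists sg, (s < sg <= curve_variation c 1)%R /\ ~ N (c (quantile c sg)).
  apply: contrapT => H.
  have HN sg : (s < sg <= curve_variation c 1)%R -> N (c (quantile c sg)).
    by move=> sg1; apply: contrapT => sgN; apply: H; exists sg.
  move: i1; rewrite ltNge => /negP; apply.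
  apply: (@le_trans _ _ (\int[lebesgue_measure]_(x in `]s, curve_variation c 1]) cst +oo x)).
    rewrite integral_cst// [X in _ * X]lebesgue_measure_itv/= lte_fin sL -EFinB.
    by rewrite gt0_mulye// lte_fin subr_gt0.
  apply: (@le_trans _ _ (\int[lebesgue_measure]_(x in `]s, curve_variation c 1]) infty_on N (c (quantile c x)))).
    apply: ge0_le_integral => //.
    - by move=> x _; exact: le0y.
    - exact: (measurable_funTS (mG1 _ bi)).
    - by move=> x /=; rewrite in_itv/= => /HN/infty_on_in ->.
  apply: ge0_subset_integral => //.
  - exact: (measurable_funTS (mG1 _ bi)).
  - by move=> x _; exact: infty_on_ge0.
  - by move=> x /=; rewrite /D /= !in_itv/= => /andP[sx ->]; rewrite (lt_trans s0).
have sgD : (0 < sg <= curve_variation c 1)%R.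
  by have /andP[ssg ->] := sg1; rewrite (lt_trans s0).
pose r := quantile c sg.
have r01 : (0 <= r <= 1)%R by rewrite quantile_ge0 quantile_le1.
have sgr : (sg <= curve_variation c r)%R by rewrite -quantile_le.
have := fg (start_curve c r); rewrite /=.
have /andP[r0 r1] := r01.
rewrite (max_l r1) (max_r r0) (fN _ sgN) subr0 -lee_fin => /le_trans; apply.
rewrite /sym_curve_integral.
have [-> ->] := start_curve_integral c r01 bg.
rewrite -ge0_integralD//; last 4 first.
- by move=> x _; exact: bg.2.
- exact: (measurable_funTS (mG1 _ bg)).
- by move=> x _; exact: bg.2.
- exact: (measurable_funTS (mG2 _ bg)).
apply: le_trans Gs.
have J0 (A : set R) : 0 <= \int[lebesgue_measure]_(x in A) G x by apply: integral_ge0.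
apply: (@le_trans _ _ (1 * \int[lebesgue_measure]_(x in `]curve_variation c r, curve_variation c 1]) G x)).
  by apply: lee_wpmul2r; [exact: J0|rewrite lee_fin; lra].
rewrite mul1e; apply: ge0_subset_integral => //; first exact: measurable_funTS.
move=> x /=; rewrite !in_itv/= => /andP[rx ->]; rewrite andbT.
have /andP[ssg _] := sg1.
by rewrite (lt_le_trans ssg)// (le_trans sgr)// ltW.
Qed.

Lemma reversal1 c : reversal c 1%R = c 0%R.
Proof.
rewrite /= subrr; apply: left_lim_eq; apply: cvg_near_eq.
by apply: filterS (nbhs_left_lt 0%R) => u u0; exact: tc_const_left.
Qed.

Lemma reversal_TC0 c : TC0 c -> TC0 (reversal c).
Proof. by rewrite !TC0E reversal_length. Qed.

(** The start of a curve is the end of its reversal, along which the symmetrized integral is the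
    same. *)
Lemma vanishing f g N c : <<s @open X >> N ->
  (forall x, ~ N x -> f x = 0%R) -> borel_nonneg g ->
  (forall c, `|f (c 1%R) - f (c 0%R)|%:E <= sym_curve_integral c g) ->
  TC0 c -> sym_curve_integral c (g \+ infty_on N) < +oo ->
  f (c 1%R) = 0%R /\ f (c 0%R) = 0%R.
Proof.
move=> bN fN bg fg c0 fin; split; first exact: (@vanishing_end f g N).
have rfin := eq_ind_r (fun x => x < +oo) fin (sym_curve_integral_reversal c (g \+ infty_on N)).
exact (eq_ind _ (fun x => f x = 0%R)
  (vanishing_end bN fN bg fg (reversal_TC0 c0) rfin) _ (reversal1 c)).
Qed.

End vanishing.

(** * Weak upper gradients *)

Section gradients.
Context {R : realType} {X : pmetricType R}.
Variables (m : borel_measure R (@open X)) (p : R).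
Hypothesis p1 : (1 <= p)%R.
Implicit Types (c : test_curve X) (f : X -> R) (g h rho : X -> \bar R) (N : set X).
Implicit Types mu : borel_measure R (@TC_open R X).
Local Open Scope ereal_scope.

Let p0 : (0 < p)%R. Proof. exact: lt_le_trans p1. Qed.
Let pn0 : p != 0%R. Proof. by rewrite gt_eqF. Qed.

Lemma in_Lp_lty h : in_Lp m p h <-> 'N[m]_p%:E[h] < +oo.
Proof. by rewrite Lnorm_lty. Qed.

Lemma in_LpD g h : borel_nonneg g -> borel_nonneg h ->
  in_Lp m p g -> in_Lp m p h -> in_Lp m p (g \+ h).
Proof.
move=> bg bh /in_Lp_lty Lg /in_Lp_lty Lh; apply/in_Lp_lty.
apply: (le_lt_trans (Lnorm_minkowski m p1 _ _)).
- exact: borel_measurable bg.1.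
- exact: borel_measurable bh.1.
- by rewrite lte_add_pinfty.
Qed.

Lemma in_LpZ (k : R) h : borel_nonneg h ->
  in_Lp m p h -> in_Lp m p (fun x => k%:E * h x).
Proof.
move=> bh /in_Lp_lty Lh; apply/in_Lp_lty.
rewrite LnormZE//; last exact: borel_measurable bh.1.
by rewrite lte_mul_pinfty.
Qed.

Lemma ae_of_null N (P : X -> Prop) : bm_sets m N -> m N = 0 ->
  (forall x, ~ N x -> P x) -> {ae m, forall x, P x}.
Proof.
move=> mN N0 NP; exists N; split => //.
  by rewrite /measurable/= bm_setsE.
by move=> x /= nP; apply: contrapT => /NP.
Qed.

Lemma null_of_ae (P : X -> Prop) : {ae m, forall x, P x} ->
  exists N, [/\ bm_sets m N, m N = 0 & forall x, ~ N x -> P x].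
Proof.
move=> [N [mN N0 NP]]; exists N; split => //.
  by move: mN; rewrite /measurable/= bm_setsE.
by move=> x nNx; apply: contrapT => nP; apply: nNx; exact: NP.
Qed.

Lemma in_Lp0 : in_Lp m p (cst 0).
Proof. by apply/in_Lp_lty; rewrite Lnorm0// ltry. Qed.

Lemma in_Lp_infty_on N : <<s @open X >> N -> m N = 0 -> in_Lp m p (infty_on N).
Proof.
move=> bN N0; apply/in_Lp_lty; rewrite Lnorm0_ae//.
- exact: (ae_of_null (borel_bm m bN) N0 (@infty_on_out _ _ N)).
- exact: borel_measurable (borel_nonneg_infty_on bN).1.
Qed.

Let le_sym_curve_integralZ c (k : R) h : (0 < k)%R -> borel_nonneg h ->
  k%:E * sym_curve_integral c h <= sym_curve_integral c (fun x => k%:E * h x).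
Proof. by move=> k0 bh; rewrite sym_curve_integralZ// ltW. Qed.

(** The negligible family is traded for a single [rho] in L^p, so that exceptional families combine
    by adding functions. Curves of length 0 may be included because their ends coincide. *)
Lemma weak_upper_gradientP f g : weak_upper_gradient m p f g <->
  borel_nonneg g /\ exists rho, [/\ borel_nonneg rho, in_Lp m p rho &
    forall c, sym_curve_integral c rho < +oo ->
      `|f (c 1%R) - f (c 0%R)|%:E <= sym_curve_integral c g].
Proof.
split=> [[bg [E [E0 modE] H]]|[bg [rho [brho Lrho H]]]]; split => //.
  have [rho [brho Lrho Erho]] := modulus0_witness p1 (@sym_curve_integral_le R X)
    le_sym_curve_integralZ modE.
  exists rho; split => // c crho.
  have [c0|/notTC0_eq->] := pselect (TC0 c); last first.
    by rewrite subrr normr0 sym_curve_integral_ge0//; exact: bg.2.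
  by apply: H; split => // /Erho; move: crho => /[swap] ->; rewrite ltxx.
exists [set c | TC0 c /\ sym_curve_integral c rho = +oo].
  split; first by move=> c [].
  by apply: (modulus0_le p1 le_sym_curve_integralZ brho Lrho) => c [].
move=> c [c0 nc]; apply: H; rewrite ltey; apply/negP => /eqP crho.
by apply: nc.
Qed.

Lemma generalized_weak_upper_gradientP f g : generalized_weak_upper_gradient m p f g <->
  borel_nonneg g /\ exists rho, [/\ borel_nonneg rho, in_Lp m p rho &
    forall mu, M0 mu -> sym_measure_integral mu rho < +oo ->
      curve_oscillation f mu <= sym_measure_integral mu g].
Proof.
split=> [[bg [E [E0 modE] H]]|[bg [rho [brho Lrho H]]]]; split => //.
  have [rho [brho Lrho Erho]] := modulus0_witness p1 (@sym_measure_integral_le R X)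
    (@sym_measure_integralZ R X) modE.
  exists rho; split => // mu mu0 murho.
  by apply: H; split => // /Erho; move: murho => /[swap] ->; rewrite ltxx.
exists [set mu | M0 mu /\ sym_measure_integral mu rho = +oo].
  split; first by move=> c [].
  by apply: (modulus0_le p1 (@sym_measure_integralZ R X) brho Lrho) => c [].
move=> mu [mu0 nmu]; apply: H => //; rewrite ltey; apply/negP => /eqP murho.
by apply: nmu.
Qed.

Lemma generalized_weak_upper_gradientW f g : generalized_weak_upper_gradient m p f g ->
  weak_upper_gradient m p f g.
Proof.
move=> /generalized_weak_upper_gradientP[bg [rho [brho Lrho H]]]; apply/weak_upper_gradientP; split => //.
exists rho; split => // c crho.
have [c0|/notTC0_eq->] := pselect (TC0 c); last first.
  by rewrite subrr normr0 sym_curve_integral_ge0//; exact: bg.2.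
have := H (dirac_curve c).
rewrite /curve_oscillation /sym_measure_integral !dirac_curve_integral; apply => //.
exact/dirac_curve_M0.
Qed.

(* h = g + rho, where rho has infinite integral along the exceptional curves. *)
Lemma weak_upper_gradient_everywhere f g : weak_upper_gradient m p f g -> in_Lp m p g ->
  exists h, [/\ borel_nonneg h, in_Lp m p h &
    forall c, `|f (c 1%R) - f (c 0%R)|%:E <= sym_curve_integral c h].
Proof.
move=> /weak_upper_gradientP[bg [rho [brho Lrho H]]] Lg.
exists (g \+ rho); split; [exact: borel_nonnegD|exact: in_LpD|move=> c].
rewrite sym_curve_integralD//.
have g0 := sym_curve_integral_ge0 c bg.2.
have rho0 := sym_curve_integral_ge0 c brho.2.
have [rhoy|] := eqVneq (sym_curve_integral c rho) +oo.
  by rewrite rhoy ge0_addey ?leey.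
by rewrite -ltey => /H h; rewrite (le_trans h)// leeDl.
Qed.

Lemma weak_upper_gradient_null f g N : weak_upper_gradient m p f g -> in_Lp m p g ->
  <<s @open X >> N -> m N = 0 -> (forall x, ~ N x -> f x = 0%R) ->
  weak_upper_gradient m p f (cst 0).
Proof.
move=> wg Lg bN N0 fN; have [h [bh Lh H]] := weak_upper_gradient_everywhere wg Lg.
apply/weak_upper_gradientP; split; first exact: borel_nonneg0.
exists (h \+ infty_on N); split.
- by apply: borel_nonnegD => //; exact: borel_nonneg_infty_on.
- by apply: in_LpD => //; [exact: borel_nonneg_infty_on|exact: in_Lp_infty_on].
move=> c fin; have [c0|/notTC0_eq->] := pselect (TC0 c); last first.
  by rewrite subrr normr0 sym_curve_integral_ge0.
have [-> ->] := vanishing bN fN bh H c0 fin.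
by rewrite subrr normr0 sym_curve_integral_ge0.
Qed.

Section oscillation.
Variable mu : borel_measure R (@TC_open R X).

Lemma TC_borel_bm (A : set (test_curve X)) :
  <<s @TC_open R X >> A -> <<s bm_sets mu >> A.
Proof. by apply: sub_sigma_algebra2; exact: bm_borel. Qed.

Lemma TC_borel_measurable d (U : measurableType d) (F : test_curve X -> U) :
  measurable_fun [set: g_sigma_algebraType (@TC_open R X)] F ->
  measurable_fun [set: g_sigma_algebraType (bm_sets mu)] F.
Proof.
move=> mF _ Y mY; have := mF measurableT Y mY; rewrite !setTI.
exact: TC_borel_bm.
Qed.

Lemma measurable_end_difference f : borel_fun (@open X) f ->
  measurable_fun [set: g_sigma_algebraType (@TC_open R X)]
    (fun c : test_curve X => f (c 1%R) - f (c 0%R))%R.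
Proof.
move=> bf; apply: measurable_funB.
- exact: (measurableT_comp (f:=f : g_sigma_algebraType (@open X) -> _) bf (@measurable_evaluation1 R X)).
- exact: (measurableT_comp (f:=f : g_sigma_algebraType (@open X) -> _) bf (@measurable_evaluation0 R X)).
Qed.

Lemma measurable_oscillation f : borel_fun (@open X) f ->
  measurable_fun [set: g_sigma_algebraType (bm_sets mu)]
    (fun c : test_curve X => `|f (c 1%R) - f (c 0%R)|%:E).
Proof.
move=> bf; apply: TC_borel_measurable; apply/measurable_EFinP.
by apply: measurableT_comp => //; exact: measurable_end_difference.
Qed.

Lemma measurable_oscillating f : borel_fun (@open X) f ->
  <<s bm_sets mu >> [set c : test_curve X | f (c 1%R) <> f (c 0%R)].
Proof.
move=> bf; have -> : [set c : test_curve X | f (c 1%R) <> f (c 0%R)] =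
    ((fun c : test_curve X => f (c 1%R) - f (c 0%R))%R @^-1` [set~ 0%R]).
  apply/seteqP; split => c /= h /eqP; rewrite ?subr_eq0 => /eqP//.
  by move=> e; apply: h; rewrite e subrr.
apply: TC_borel_bm; rewrite -[X in <<s _ >> X]setTI.
by apply: (measurable_end_difference bf) => //; exact: measurableC.
Qed.

Lemma curve_oscillation_null f : borel_fun (@open X) f ->
  mu [set c : test_curve X | f (c 1%R) <> f (c 0%R)] = 0 -> curve_oscillation f mu = 0.
Proof.
move=> bf D0; rewrite /curve_oscillation.
rewrite (@ge0_ae_eq_integral _ _ _ mu setT _ (cst 0)) ?integral0//.
- exact: measurable_oscillation.
exists [set c : test_curve X | f (c 1%R) <> f (c 0%R)]; split => //.
- exact: measurable_oscillating.
- move=> c /= h ff; apply: h => _; by rewrite ff subrr normr0.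
Qed.

End oscillation.

(** Along each curve of [D] the integral of [h + infty_on N] is infinite, by [vanishing]. A measure
    that charges [D] therefore gives this function an infinite integral and is exceptional. The set
    [D] is measurable since [f] is Borel, so the constant [+oo] on [D] is a legitimate minorant. *)
Lemma generalized_weak_upper_gradient_null f g N : generalized_weak_upper_gradient m p f g -> in_Lp m p g ->
  borel_fun (@open X) f ->
  <<s @open X >> N -> m N = 0 -> (forall x, ~ N x -> f x = 0%R) ->
  generalized_weak_upper_gradient m p f (cst 0).
Proof.
move=> wg Lg bf bN N0 fN; have [h [bh Lh H]] := weak_upper_gradient_everywhere (generalized_weak_upper_gradientW wg) Lg.
have bi := borel_nonneg_infty_on bN.
have bhi := borel_nonnegD bh bi.
apply/generalized_weak_upper_gradientP; split; first exact: borel_nonneg0.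
exists (h \+ infty_on N); split => //.
  by apply: in_LpD => //; exact: in_Lp_infty_on.
move=> mu mu0 fin.
rewrite curve_oscillation_null//; first by apply: integral_ge0 => c _; exact: sym_curve_integral_ge0.
set D := [set c : test_curve X | _].
have mD : <<s bm_sets mu >> D by exact: measurable_oscillating.
apply/eqP; apply/negPn/negP => D0; move: fin; rewrite ltNge => /negP; apply.
have := @integral_cst _ _ _ mu D mD +oo.
rewrite gt0_mulye ?lt0e ?D0 ?measure_ge0// => <-.
rewrite integral_mkcond; apply: ge0_lower_integral_le.
  by move=> c; rewrite /patch; case: ifP => _ //; exact: le0y.
move=> c; rewrite /patch; case: ifPn => [/set_mem Dc|_]; last first.
  by apply: sym_curve_integral_ge0; exact: bhi.2.
rewrite leye_eq; apply/eqP; apply: contrapT => /eqP; rewrite -ltey => cfin.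
have [c0|/notTC0_eq e] := pselect (TC0 c); last by apply: Dc; rewrite e.
by have [e1 e0] := vanishing bN fN bh H c0 cfin; apply: Dc; rewrite e1 e0.
Qed.

(** The laws of the end points under an admissible measure are dominated by multiples of [m], so
    almost every curve has both ends off [N]. *)
Lemma m_upper_gradient_null f N : borel_fun (@open X) f ->
  <<s @open X >> N -> m N = 0 -> (forall x, ~ N x -> f x = 0%R) ->
  m_upper_gradient m f (cst 0).
Proof.
move=> bf bN N0 fN; split; first exact: borel_nonneg0.
move=> mu mu0 [_ [C C0 HC] _].
rewrite curve_oscillation_null//; first by apply: integral_ge0 => c _; exact: sym_curve_integral_ge0.
have NE t : (0 <= t <= 1)%R -> mu [set c : test_curve X | N (c t)] = 0.
  move=> t01; apply/eqP; rewrite eq_le measure_ge0 andbT.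
  by have := HC t N t01 bN; rewrite N0 mule0.
have mE1 : <<s bm_sets mu >> [set c : test_curve X | N (c 1%R)].
  apply: TC_borel_bm; rewrite -[X in <<s _ >> X]setTI.
  exact: (@measurable_evaluation1 R X measurableT N).
have mE0 : <<s bm_sets mu >> [set c : test_curve X | N (c 0%R)].
  apply: TC_borel_bm; rewrite -[X in <<s _ >> X]setTI.
  exact: (@measurable_evaluation0 R X measurableT N).
apply/eqP; rewrite eq_le measure_ge0 andbT.
apply: (@le_trans _ _ (mu ([set c : test_curve X | N (c 1%R)] `|` [set c : test_curve X | N (c 0%R)]))).
  apply: le_measure; rewrite ?inE.
  - exact: measurable_oscillating.
  - exact: measurableU.
  - move=> c /= ff; have [N1|N1] := pselect (N (c 1%R)); [by left|right].
    by apply: contrapT => N0'; apply: ff; rewrite !fN.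
have := @measureU0 _ _ _ mu _ _ mE1 mE0.
by rewrite NE ?ler01 ?lexx// => ->//; rewrite NE ?ler01 ?lexx.
Qed.

(** The jump between two points at which [rho] is finite has a finite [rho]-integral, so it is not
    exceptional. The set where [rho] is infinite is null because [rho] is in L^p. The factor 1/2 of
    the symmetrized integral is given away. *)
Lemma weak_upper_gradient_hajlasz f g : weak_upper_gradient m p f g ->
  hajlasz_gradient m (EFin \o f) g.
Proof.
move=> /weak_upper_gradientP[bg [rho [brho Lrho H]]]; split.
- exact: borel_measurable bg.1.
- exact: bg.2.
have [N [mN N0 NP]] : exists N, [/\ bm_sets m N, m N = 0 & forall x, ~ N x -> rho x \is a fin_num].
  apply: null_of_ae; apply: (Lnorm_lty_ae p1); first exact: borel_measurable brho.1.
  exact/in_Lp_lty.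
exists N => // x y /NP rx /NP ry /=.
have d0 := mdist_ge0 x y.
have gxy0 : 0 <= g x + g y by apply: adde_ge0; exact: bg.2.
have := H (jump_curve x y); rewrite !sym_curve_integral_jump// jump_curve0 jump_curve1.
rewrite distrC => h.
apply: (le_trans (h _)).
  rewrite -(fineK rx) -(fineK ry) -EFinD -!EFinM; exact: ltry.
rewrite -[leRHS]mul1e; apply: lee_wpmul2r; last by rewrite lee_fin; lra.
by rewrite mule_ge0.
Qed.

End gradients.

(** * Lipschitz functions with a Hajlasz gradient, along a curve *)

(* In the application phi s = F (c (T s)) with T the quantile function of c, the
   function hs is the sum of the values of G on the two sides of T s, and PV
   telescopes the contribution of the jumps of c. *)
Section chain.
Context {R : realType}.
Variables (L K f0 f1 : R) (phi PV hs Psi : R -> R) (good : R -> Prop).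
Hypothesis K0 : 0 <= K.
Hypothesis hs0 : forall s, 0 <= hs s.
Hypothesis Psi0 : Psi 0 = 0.
Hypothesis Psi_nd : forall a b : R, 0 <= a -> a <= b -> b <= L -> Psi a <= Psi b.
Hypothesis PV_le : forall s, PV s <= Psi L.
Hypothesis step_bound : forall s s', 0 < s -> s < s' -> s' <= L ->
  good s -> good s' ->
  `|phi s' - phi s| <= (hs s + hs s') * (s' - s) + (PV s' - PV s).
Hypothesis base_bound : forall s, 0 < s <= L -> good s ->
  `|phi s - f0| <= K * s + PV s.
Hypothesis end_bound : forall s, 0 < s <= L -> `|f1 - phi s| <= K * (L - s).
Hypothesis choose : forall a b d : R, 0 <= a -> a < b -> b <= L -> 0 < d ->
  exists s, [/\ a < s <= b, good s &
    hs s * (b - a) <= Psi b - Psi a + d * (b - a)].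

(** The interval []0, L]] is cut into [n + 1] pieces of length [h]. Chosen points of adjacent pieces
    are at most [2 h] apart, so a step costs at most twice the increments of [Psi] over both pieces.
    As a piece takes part in at most two steps, the steps cost at most [4 Psi(L)]; the telescoped
    [PV] adds one more [Psi(L)]. The rest is of order [h]: the two end pieces, and the slack [d = h]
    in the choice of the points. *)
Let bound_n (n : nat) : 0 < L ->
  `|f1 - f0| <= 5 * Psi L + (2 * K + 4 * L) * (L / n.+1%:R).
Proof.
move=> L0; pose h := L / n.+1%:R.
have h0 : 0 < h by rewrite divr_gt0.
have hn : n.+1%:R * h = L by rewrite /h mulrC divfK// pnatr_eq0.
have iL i : (i <= n)%N -> i.+1%:R * h <= L.
  by move=> iN; rewrite -hn ler_pM2r// ler_nat.
have i0 i : 0 <= i%:R * h :> R by rewrite mulr_ge0// ltW.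
have ex i : exists s, (i <= n)%N -> [/\ i%:R * h < s <= i.+1%:R * h, good s &
    hs s * h <= Psi (i.+1%:R * h) - Psi (i%:R * h) + h * h].
  have [iN|iN] := leqP i n; last by exists 0.
  have ii : i%:R * h < i.+1%:R * h by rewrite ltr_pM2r// ltr_nat.
  have [s Hs] := choose (i0 i) ii (iL _ iN) h0.
  exists s => _; move: Hs; rewrite -mulrBl.
  by rewrite -[i.+1]addn1 natrD addrAC subrr add0r mul1r.
have [sg Hsg] := choice ex.
have sgL i : (i <= n)%N -> 0 < sg i <= L.
  move=> iN; have [/andP[h1 h2] _ _] := Hsg i iN.
  by rewrite (le_lt_trans (i0 i) h1) (le_trans h2)// iL.
(* The two shifted values of [Psi] count the pieces as left and as right partners of a step. *)
have key i : (i <= n)%N -> `|phi (sg i) - f0| <=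
    K * h + PV (sg i) + 2 * Psi (i.+1%:R * h) + 2 * Psi (i%:R * h) + 4 * (i%:R * h) * h.
  elim: i => [iN|i ih iN].
    have [/andP[_ s1] sy _] := Hsg 0%N iN.
    apply: (le_trans (base_bound (sgL _ iN) sy)).
    rewrite !mul0r Psi0 !mulr0 !addr0 mul0r addr0.
    have : K * sg 0%N <= K * h by rewrite ler_wpM2l// -[leRHS]mul1r.
    have : 0 <= Psi (1 * h).
      rewrite -Psi0; apply: Psi_nd => //; first by rewrite mul1r ltW.
      exact: (iL 0%N iN).
    lra.
  have iN' := ltnW iN.
  have [/andP[a1 a2] sy a3] := Hsg i iN'.
  have [/andP[b1 b2] sy' b3] := Hsg i.+1 iN.
  have [sgi0 _] := andP (sgL _ iN'); have [_ sgiL] := andP (sgL _ iN).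
  have lt : sg i < sg i.+1 by exact: le_lt_trans b1.
  have := step_bound sgi0 lt sgiL sy sy'.
  have d2 : sg i.+1 - sg i <= 2 * h.
    move: b2; rewrite -[i.+2]addn2 natrD mulrDl; lra.
  have e0 : 0 <= hs (sg i) by exact: hs0.
  have e0' : 0 <= hs (sg i.+1) by exact: hs0.
  have : (hs (sg i) + hs (sg i.+1)) * (sg i.+1 - sg i) <=
      (hs (sg i) + hs (sg i.+1)) * (2 * h).
    by rewrite ler_wpM2l// addr_ge0.
  have := ih iN'.
  have := ler_distD (phi (sg i)) (phi (sg i.+1)) (f0).
  have -> : 4 * (i.+1%:R * h) * h = 4 * (i%:R * h) * h + 4 * (h * h).
    by rewrite -[i.+1]addn1 natrD; ring.
  have -> : (hs (sg i) + hs (sg i.+1)) * (2 * h) =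
     2 * (hs (sg i) * h) + 2 * (hs (sg i.+1) * h) by ring.
  lra.
have := key n (leqnn n); have := end_bound (sgL n (leqnn n)).
have := ler_distD (phi (sg n)) (f1) (f0).
have [/andP[a1 a2] _ _] := Hsg n (leqnn n).
have : K * (L - sg n) <= K * h.
  rewrite ler_wpM2l// -hn lerBlDr -lerBlDl -[leLHS]/(n.+1%:R * h - h).
  by rewrite -[n.+1]addn1 natrD mulrDl mul1r addrK ltW.
have : PV (sg n) <= Psi L by exact: PV_le.
rewrite hn.
have nL : n%:R * h <= L by rewrite -hn ler_pM2r// ler_nat.
have : Psi (n%:R * h) <= Psi L by apply: Psi_nd.
have : 4 * (n%:R * h) * h <= 4 * L * h by rewrite ler_pM2r// ler_pM2l.
rewrite -/h mulrDl -mulrA; lra.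
Qed.

Lemma chain_bound : 0 < L -> `|f1 - f0| <= 5 * Psi L.
Proof.
move=> L0; apply/ler_addgt0Pr => e e0.
pose M := (2 * K + 4 * L) * L.
have M0 : 0 < M by rewrite mulr_gt0// ltr_wpDl ?mulr_ge0// mulr_gt0.
have [n _ Hn] := near_infty_natSinv_lt (PosNum (divr_gt0 e0 M0)).
apply: (le_trans (bound_n n L0)); rewrite lerD2l mulrA -/M.
by rewrite -ler_pdivlMl// mulrC ltW//; exact: (Hn n (leqnn n)).
Qed.

End chain.

Section hajlasz_curve.
Context {R : realType} {X : pmetricType R}.
Variables (F : X -> R) (G : X -> \bar R) (K : R) (c : test_curve X).
Hypothesis K0 : 0 <= K.
Hypothesis FK : forall x y, `|F x - F y| <= K * mdist x y.
Hypothesis bG : borel_nonneg G.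
Hypothesis FG : forall x y, (`|F x - F y|%:E <= (G x + G y) * (mdist x y)%:E)%E.
Hypothesis finG : (sym_curve_integral c G < +oo)%E.

Let V := curve_variation c.
Let U := variation_left c.
Let T := quantile c.
Let L := V 1.
Let H s : \bar R := (G (c (T s)) + G (left_lim c (T s)))%E.
Let I a b : \bar R := (\int[lebesgue_measure]_(s in `]a, b]) H s)%E.
Let Psi b : R := fine (I 0 b).

Let H0 s : (0 <= H s)%E. Proof. by apply: adde_ge0; exact: bG.2. Qed.

Let mH1 : measurable_fun setT (fun s => G (c (T s))).
Proof. exact: measurable_quantile_curve. Qed.

Let mH2 : measurable_fun setT (fun s => G (left_lim c (T s))).
Proof. exact: measurable_quantile_left_lim. Qed.

Let mH : measurable_fun setT H.
Proof. exact: emeasurable_funD. Qed.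

Let I0 a b : (0 <= I a b)%E. Proof. exact: integral_ge0. Qed.

Let IE : I 0 L = (2%:E * sym_curve_integral c G)%E.
Proof.
rewrite /sym_curve_integral muleA -EFinM divff// mul1e.
have [-> ->] := curve_integral_quantile c bG.
rewrite /I ge0_integralD//.
- by move=> s _; exact: bG.2.
- exact: measurable_funTS mH1.
- by move=> s _; exact: bG.2.
- exact: measurable_funTS mH2.
Qed.

Let Isub (a b a' b' : R) : a' <= a -> b <= b' -> (I a b <= I a' b')%E.
Proof.
move=> aa bb; apply: ge0_subset_integral => //; first exact: measurable_funTS.
move=> s /=; rewrite !in_itv/= => /andP[as_ sb].
by rewrite (le_lt_trans aa)// (le_trans sb).
Qed.

Let Ifin (a b : R) : 0 <= a -> b <= L -> I a b \is a fin_num.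
Proof.
move=> a0 bL; rewrite ge0_fin_numE//; apply: (le_lt_trans (Isub a0 bL)).
by rewrite IE lte_mul_pinfty.
Qed.

Let IB (a b : R) : 0 <= a -> a <= b -> b <= L -> I a b = (Psi b - Psi a)%:E.
Proof.
move=> a0 ab bL; have aL := le_trans ab bL.
have e : I 0 b = (I 0%R a + I a b)%E.
  rewrite /I -ge0_integral_setU//.
  - congr (integral _ _ _); apply/seteqP; split => x /=; rewrite !in_itv/=.
      by move=> /andP[-> ->]; case: leP; [left|right].
    case => /andP[x1 x2]; apply/andP; split => //.
    + exact: le_trans ab.
    + exact: le_lt_trans x1.
  - exact: measurable_funTS.
  - apply/disj_setPS => x []; rewrite /= !in_itv/= => /andP[_ xu] /andP[ux _].
    by have := lt_le_trans ux xu; rewrite ltxx.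
rewrite /Psi e fineD ?Ifin// addrAC subrr add0r fineK// Ifin//.
Qed.

Let Psi0 : Psi 0 = 0.
Proof.
have L0 : 0 <= L by exact: curve_variation_ge0.
by rewrite /Psi /I set_itvoc0 integral_set0.
Qed.

Let Psi_nd (a b : R) : 0 <= a -> a <= b -> b <= L -> Psi a <= Psi b.
Proof. by move=> a0 ab bL; rewrite -subr_ge0 -lee_fin -IB. Qed.

Let T_galois s t : 0 < s <= L -> (T s <= t) = (s <= V t).
Proof. exact: quantile_le. Qed.

Let s_le_VT s : 0 < s <= L -> s <= V (T s).
Proof. by move=> sL; rewrite -T_galois. Qed.

Let UT_le_s s : 0 < s <= L -> U (T s) <= s.
Proof.
move=> sL; apply: variation_left_le => t; rewrite ltNge T_galois// -ltNge => /ltW; exact.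
Qed.

Let VL t : V t <= L. Proof. exact: curve_variation_le1. Qed.
Let V0 t : 0 <= V t. Proof. exact: curve_variation_ge0. Qed.
Let UV t : U t <= V t. Proof. exact: variation_left_le_self. Qed.
Let U0 t : 0 <= U t.
Proof.
by apply: (le_trans (V0 (t - 1))); apply: le_variation_left; lra.
Qed.

(** A jump at time [T s] occupies all parameters from [U (T s)] to [V (T s)]. *)
Let T_jump s s' : 0 < s <= L -> U (T s) < s' <= V (T s) -> T s' = T s.
Proof.
move=> sL /andP[Us' s'V].
have s'L : 0 < s' <= L by rewrite (le_lt_trans (U0 _) Us') (le_trans s'V).
apply/eqP; rewrite eq_le T_galois// s'V/= leNgt; apply/negP => TT.
have := le_variation_left c TT.
by rewrite leNgt (lt_le_trans Us')//; exact: s_le_VT.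
Qed.

Let Hfin s : (H s < +oo)%E ->
  G (c (T s)) = (fine (G (c (T s))))%:E /\
  G (left_lim c (T s)) = (fine (G (left_lim c (T s))))%:E /\
  fine (H s) = fine (G (c (T s))) + fine (G (left_lim c (T s))).
Proof.
rewrite /H; have := bG.2 (c (T s)); have := bG.2 (left_lim c (T s)).
case: (G (c (T s))) => [a| |] //; case: (G (left_lim c (T s))) => [b| |] //.
Qed.

Let FGfin x y a b : G x = a%:E -> G y = b%:E -> `|F x - F y| <= (a + b) * mdist x y.
Proof. by move=> xa yb; have := FG x y; rewrite xa yb -EFinD -EFinM lee_fin. Qed.

(** [H] is constant on the parameter interval of the jump, with the values of [G] at both ends as
    summands. The Hajlasz bound across the jump is thus at most the integral of [H] over that
    interval. *)
Let jump_bound s : 0 < s <= L -> (H s < +oo)%E ->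
  `|F (c (T s)) - F (left_lim c (T s))| <= Psi (V (T s)) - Psi (U (T s)).
Proof.
move=> sL Hs; have [e1 [e2 e3]] := Hfin Hs.
apply: (le_trans (FGfin e1 e2)); rewrite -e3.
have hs0 : 0 <= fine (H s) by rewrite fine_ge0.
apply: (@le_trans _ _ (fine (H s) * (V (T s) - U (T s)))).
  by rewrite ler_wpM2l// metric_sym; exact: mdist_jump_le.
rewrite -lee_fin -IB//.
have Hfn : H s \is a fin_num by rewrite ge0_fin_numE.
rewrite EFinM (fineK Hfn).
have -> : I (U (T s)) (V (T s)) = (\int[lebesgue_measure]_(s' in `]U (T s), V (T s)]) cst (H s) s')%E.
  by apply: eq_integral => s' /set_mem /=; rewrite in_itv/= => h; rewrite /H (T_jump sL h).
rewrite integral_cst// [X in (_ <= _ * X)%E]lebesgue_measure_itv/= lte_fin.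
case: ltP => [_|VU]; first by rewrite -EFinB.
have -> : V (T s) - U (T s) = 0 by apply/eqP; rewrite subr_eq0 eq_le VU UV.
by [].
Qed.

(** The distance from [c (T s)] to [c (T s')] may exceed [s' - s] when the curve jumps at [T s'].
    One therefore passes through the left limit, which is within [s' - s] of [c (T s)], and charges
    the jump to its own part of the integral, so that the charges telescope. *)
Let step_bound s s' : 0 < s -> s < s' -> s' <= L -> (H s < +oo)%E -> (H s' < +oo)%E ->
  `|F (c (T s')) - F (c (T s))| <=
  (fine (H s) + fine (H s')) * (s' - s) + (Psi (V (T s')) - Psi (V (T s))).
Proof.
move=> s0 ss' s'L Hs Hs'.
have sL : 0 < s <= L by rewrite s0 (le_trans (ltW ss')).
have s'L' : 0 < s' <= L by rewrite s'L (lt_trans s0).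
have hs0 : 0 <= fine (H s) by rewrite fine_ge0.
have hs'0 : 0 <= fine (H s') by rewrite fine_ge0.
have TT : T s <= T s' by apply: quantile_nd; exact: ltW.
have VTT : V (T s) <= V (T s') by exact: curve_variation_nd.
have s's : 0 <= s' - s by rewrite subr_ge0 ltW.
move: TT; rewrite le_eqVlt => /predU1P[<-|TT].
  by rewrite !subrr normr0 addr0 mulr_ge0// addr_ge0.
have [e1 [e2 e3]] := Hfin Hs; have [e1' [e2' e3']] := Hfin Hs'.
have VU : V (T s) <= U (T s') by exact: le_variation_left.
have j := jump_bound s'L' Hs'.
have d := mdist_left_lim_le c TT.
have g1 := FGfin e2' e1.
have g10 : 0 <= fine (G (c (T s))) by rewrite fine_ge0// bG.2.
have g20 : 0 <= fine (G (left_lim c (T s))) by rewrite fine_ge0// bG.2.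
have g10' : 0 <= fine (G (c (T s'))) by rewrite fine_ge0// bG.2.
have g20' : 0 <= fine (G (left_lim c (T s'))) by rewrite fine_ge0// bG.2.
have PP : Psi (V (T s)) <= Psi (U (T s')).
  by apply: Psi_nd => //; exact: le_trans (UV _) (VL _).
have d' : mdist (left_lim c (T s')) (c (T s)) <= s' - s.
  rewrite metric_sym (le_trans d)//; apply: lerB; first exact: UT_le_s.
  exact: s_le_VT.
have g2 : `|F (left_lim c (T s')) - F (c (T s))| <= (fine (H s) + fine (H s')) * (s' - s).
  apply: (le_trans g1); apply: ler_pM => //; first by rewrite addr_ge0.
    exact: mdist_ge0.
  by rewrite e3 e3' addrC; apply: lerD; rewrite ?lerDl ?lerDr.
apply: (le_trans (ler_distD (F (left_lim c (T s'))) _ _)).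
rewrite addrC; apply: lerD => //; apply: (le_trans j).
by rewrite lerD2l lerN2.
Qed.

(** [G] may be infinite at the start of the curve, so the first step relies on the Lipschitz
    constant; its contribution [K * s] vanishes in the limit. The same is done at the end in
    [end_bound]. *)
Let base_bound s : 0 < s <= L -> (H s < +oo)%E ->
  `|F (c (T s)) - F (c 0)| <= K * s + Psi (V (T s)).
Proof.
move=> sL Hs.
have T0 : 0 < T s.
  rewrite ltNge T_galois// /V (curve_variation_le0 c (lexx 0)) -ltNge.
  by case/andP: sL.
have j := jump_bound sL Hs.
have d := mdist_left_lim_le c T0.
rewrite (curve_variation_le0 c (lexx 0)) subr0 in d.
have k := FK (left_lim c (T s)) (c 0).
have kd : K * mdist (left_lim c (T s)) (c 0) <= K * s.
  by rewrite ler_wpM2l// metric_sym (le_trans d)//; exact: UT_le_s.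
have PU : 0 <= Psi (U (T s)).
  by rewrite -Psi0; apply: Psi_nd => //; exact: le_trans (UV _) (VL _).
apply: (le_trans (ler_distD (F (left_lim c (T s))) _ _)).
rewrite addrC; apply: lerD; first exact: le_trans k kd.
by apply: (le_trans j); rewrite gerBl.
Qed.

Let end_bound s : 0 < s <= L -> `|F (c 1) - F (c (T s))| <= K * (L - s).
Proof.
move=> sL; apply: (le_trans (FK _ _)); rewrite ler_wpM2l// metric_sym.
apply: (le_trans (mdist_le_curve_variation c (quantile_le1 c s))).
by rewrite lerD2l lerN2; exact: s_le_VT.
Qed.

Let choose (a b : R) (d : R) : 0 <= a -> a < b -> b <= L -> 0 < d ->
  exists s, [/\ a < s <= b, (H s < +oo)%E &
    fine (H s) * (b - a) <= Psi b - Psi a + d * (b - a)].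
Proof.
move=> a0 ab bL d0; have ba : 0 < b - a by rewrite subr_gt0.
(* The mean of [H] over the piece plus [d]. If [H] were at least [r] throughout, its integral would
   exceed [Psi b - Psi a]. *)
pose r : R := (Psi b - Psi a) / (b - a) + d.
apply: contrapT => N.
have Hr s : a < s <= b -> (r%:E <= H s)%E.
  move=> sab; rewrite leNgt; apply/negP => Hsr; apply: N; exists s; split => //.
    exact: lt_trans Hsr (ltry _).
  have Hfn : H s \is a fin_num by rewrite ge0_fin_numE// (lt_trans Hsr)// ltry.
  move: Hsr; rewrite -(fineK Hfn) lte_fin => /ltW; rewrite /r.
  by rewrite -(ler_pM2r ba) mulrDl mulfVK// gt_eqF.
have : (r%:E * (b - a)%:E <= I a b)%E.
  apply: (@le_trans _ _ (\int[lebesgue_measure]_(s in `]a, b]) cst r%:E s)%E).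
    by rewrite integral_cst// [X in (_ <= _ * X)%E]lebesgue_measure_itv/= lte_fin ab -EFinB.
  apply: ge0_le_integral => //.
  - move=> s _; rewrite lee_fin addr_ge0 ?(ltW d0)// divr_ge0 ?(ltW ba)// subr_ge0.
    by apply: Psi_nd => //; exact: ltW.
  - exact: measurable_funTS.
rewrite IB ?(ltW ab)// -EFinM lee_fin /r mulrDl mulfVK ?gt_eqF//.
by rewrite gerDl leNgt mulr_gt0.
Qed.

Let bound : `|F (c 1) - F (c 0)| <= 5 * Psi L.
Proof.
have : 0 <= L by exact: V0.
rewrite le_eqVlt => /predU1P[L0|L0].
  have -> : c 1 = c 0 by apply: notTC0_eq; rewrite TC0E -/(V 1) -/L -L0 ltxx.
  by rewrite -L0 Psi0 mulr0 subrr normr0.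
have hs0 s : 0 <= fine (H s) by rewrite fine_ge0.
have PV_le s : Psi (V (T s)) <= Psi L by apply: Psi_nd.
exact (@chain_bound R L K (F (c 0)) (F (c 1)) (fun s => F (c (T s)))
  (fun s => Psi (V (T s))) (fun s => fine (H s)) Psi (fun s => (H s < +oo)%E)
  K0 hs0 Psi0 Psi_nd PV_le step_bound base_bound end_bound choose L0).
Qed.

Lemma hajlasz_curve_bound_fin :
  (`|F (c 1%R) - F (c 0%R)|%:E <= (5 * 2)%R%:E * sym_curve_integral c G)%E.
Proof.
have L0 : 0 <= L by exact: V0.
(* The factor 2 undoes the 1/2 in the symmetrized integral. *)
rewrite EFinM -muleA -IE.
have IL : I 0 L \is a fin_num by exact: Ifin.
by rewrite -(fineK IL) -EFinM lee_fin; exact: bound.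
Qed.

End hajlasz_curve.

(** [K] enters only error terms that tend to 0, so the bound is uniform over functions with ever
    larger Lipschitz constants, such as the McShane extensions below. *)
Lemma hajlasz_curve_bound (R : realType) (X : pmetricType R)
    (F : X -> R) (G : X -> \bar R) (K : R) (c : test_curve X) :
  0 <= K -> (forall x y, `|F x - F y| <= K * mdist x y) -> borel_nonneg G ->
  (forall x y, (`|F x - F y|%:E <= (G x + G y) * (mdist x y)%:E)%E) ->
  (`|F (c 1%R) - F (c 0%R)|%:E <= (5 * 2)%R%:E * sym_curve_integral c G)%E.
Proof.
move=> K0 FK bG FG.
have [->|] := eqVneq (sym_curve_integral c G) +oo%E.
  by rewrite gt0_muley ?leey// lte_fin mulr_gt0.
by rewrite -ltey => fin; exact: (@hajlasz_curve_bound_fin _ _ F G K).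
Qed.

(** * Good representatives *)

Section borel_representatives.
Context {R : realType} {X : pmetricType R}.
Variable m : borel_measure R (@open X).
Hypothesis mreg : borel_regular m.

Lemma negligible_borel_hull (A : set X) : m.-negligible A ->
  exists N, [/\ <<s @open X >> N, m N = 0%E & A `<=` N].
Proof.
move=> [B [mB B0 AB]].
have mB' : bm_sets m B by move: mB; rewrite /measurable/= bm_setsE.
have [N [bN BN mN]] := mreg mB'.
by exists N; split => //; [rewrite mN|exact: subset_trans BN].
Qed.

Hypothesis msf : sigma_finite setT m.

(** A hull of equal measure differs from the set by a null set only when this measure is finite.
    Hence the hulls are taken on the pieces of finite measure. *)
Lemma measurable_borel_hull (A : set X) : bm_sets m A ->
  exists B, [/\ <<s @open X >> B, A `<=` B & m.-negligible (B `\` A)].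
Proof.
move=> mA; have [F FT mF] := msf.
have mA' : <<s bm_sets m >> A by rewrite bm_setsE.
have mAF i : bm_sets m (A `&` F i).
  by rewrite -bm_setsE; apply: (@measurableI _ (g_sigma_algebraType (bm_sets m))) => //; exact: (mF i).1.
have [B hB] := choice (fun i => mreg (mAF i)).
exists (\bigcup_i B i); split.
- apply: (@bigcupT_measurable _ (g_sigma_algebraType (@open X))) => i.
  by have [] := hB i.
- move=> x Ax; have : setT x by [].
  by rewrite FT => -[i _ Fx]; exists i => //; have [_ h _] := hB i; exact: h.
have sub : \bigcup_i B i `\` A `<=` \bigcup_i (B i `\` (A `&` F i)).
  by move=> x [[i _ Bx] nAx]; exists i => //; split => // -[].
apply: (@negligibleS _ (g_sigma_algebraType (bm_sets m)) _ m _ _ sub).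
apply: negligible_bigcup => i; have [bB AB mB] := hB i.
exists (B i `\` (A `&` F i)); split => //.
  by apply: (@measurableD _ (g_sigma_algebraType (bm_sets m))); rewrite /measurable/= bm_setsE//; exact: borel_bm.
have fin : (m (A `&` F i) < +oo)%E.
  apply: le_lt_trans (mF i).2; apply: le_measure; rewrite ?inE//.
    by rewrite /measurable/= bm_setsE.
  exact: (mF i).1.
rewrite measureD//.
- rewrite (setIidr AB) [X in (X - _)%E](_ : _ = m (A `&` F i)); last exact: mB.
  by rewrite subee// ge0_fin_numE.
- by rewrite /measurable/= bm_setsE; exact: borel_bm.
- by rewrite /measurable/= bm_setsE.
- by rewrite [X in (X < _)%E](_ : _ = m (A `&` F i))//; exact: mB.
Qed.

(** An enumeration of the rationals; the default value only repeats 0. *)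
Let q (n : nat) : R := if unpickle n is Some r then ratr (r : rat) else 0.

Let q_between (x : \bar R) (r : R) : (x < r%:E)%E -> exists n, (x < (q n)%:E)%E /\ q n < r.
Proof.
move=> xr; have [y [xy yr]] : exists y : R, (x < y%:E)%E /\ y < r.
  case: x xr => [x| |] //; last by exists (r - 1); split; [exact: ltNyr|lra].
  by rewrite lte_fin => xr; exists ((x + r) / 2); rewrite lte_fin; split; lra.
have [s] := rat_in_itvoo yr; rewrite in_itv/= => /andP[ys sr].
exists (pickle s); rewrite /q pickleK; split => //.
by rewrite (lt_trans xy)// lte_fin.
Qed.

(** [N] absorbs the countably many differences between the rational sublevel sets of [f] and their
    Borel hulls. Off [N] these sets agree, which determines all sublevel sets. *)
Lemma borel_restriction (f : X -> \bar R) (Z : set X) :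
  measurable_fun [set: g_sigma_algebraType (bm_sets m)] f -> m.-negligible Z ->
  exists N, [/\ <<s @open X >> N, m N = 0%E, Z `<=` N &
    borel_fun (@open X) (f \_ (~` N))].
Proof.
move=> mf nZ.
pose A n := f @^-1` `]-oo, (q n)%:E[%classic.
have mA n : bm_sets m (A n).
  have := mf measurableT _ (emeasurable_itv (`]-oo, (q n)%:E[)%O).
  by rewrite setTI /measurable/= bm_setsE.
have [B hB] := choice (fun n => measurable_borel_hull (mA n)).
have [N [bN N0 ZN]] : exists N, [/\ <<s @open X >> N, m N = 0%E &
    Z `|` \bigcup_n (B n `\` A n) `<=` N].
  apply: negligible_borel_hull; apply: negligibleU => //.
  by apply: negligible_bigcup => n; have [] := hB n.
exists N; split => //; first by move=> x Zx; apply: ZN; left.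
apply: (measurability (@ErealGenInftyO.G R)) => [|/= _ [_] [r] -> <-].
  exact: ErealGenInftyO.measurableE.
rewrite setTI.
(* The restricted function is 0 on [N], so [N] lies in the sublevel set iff a positive rational lies
   below [r]. *)
have -> : (f \_ (~` N)) @^-1` `]-oo, r%:E[%classic =
    \bigcup_(n in [set n | q n < r]) ((B n `\` N) `|` (if 0 < q n then N else set0)).
  apply/seteqP; split => x /=; rewrite in_itv/=.
    move=> /q_between[n [xn nr]]; exists n => //.
    move: xn; rewrite patchE; case: ifPn => [/set_mem Nx xn|/negP Nx].
      left; split => //; have [_ AB _] := hB n; apply: AB.
      by rewrite /A /= in_itv.
    rewrite lte_fin => ->; right.
    by apply: contrapT => h; apply: Nx; exact/mem_set.
  move=> [n /= nr]; rewrite patchE => -[[Bx Nx]|].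
    rewrite mem_set//; apply: (@lt_trans _ _ (q n)%:E); last by rewrite lte_fin.
    have : A n x by apply: contrapT => nA; apply: Nx; apply: ZN; right; exists n.
    by rewrite /A /= in_itv.
  case: ifPn => // n0 Nx; rewrite memNset; last by move=> /(_ Nx).
  by rewrite lte_fin (lt_trans n0).
apply: (@bigcup_measurable _ (g_sigma_algebraType (@open X))) => n _.
apply: measurableU; last by case: ifP => // _; exact: measurable0.
by apply: measurableD => //; have [] := hB n.
Qed.

(* g0 is set to +oo on a Borel null set that contains the exceptional points. *)
Lemma hajlasz_borel_representative (f g : X -> \bar R) :
  measurable_fun [set: g_sigma_algebraType (bm_sets m)] f ->
  {ae m, forall x, f x \is a fin_num} ->
  hajlasz_gradient m f g ->
  exists (f0 : X -> R) (g0 : X -> \bar R),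
    [/\ borel_fun (@open X) f0, borel_nonneg g0,
      {ae m, forall x, (f0 x)%:E = f x}, {ae m, forall x, g0 x = g x} &
      forall x y, (`|f0 x - f0 y|%:E <= (g0 x + g0 y) * (mdist x y)%:E)%E].
Proof.
move=> mf ff [mg g0 [E [mE E0] HE]].
have nE : m.-negligible E by exists E; split => //; rewrite /measurable/= bm_setsE.
have [N1 [bN1 N10 EN1 bg]] := borel_restriction mg nE.
have nN1 : m.-negligible (N1 `|` ~` [set x | f x \is a fin_num]).
  apply: negligibleU => //; exists N1; split => //.
  by rewrite /measurable/= bm_setsE; exact: borel_bm.
have [N [bN N0 NN bf]] := borel_restriction mf nN1.
have nfin x : ~ N x -> f x \is a fin_num.
  by move=> Nx; apply: contrapT => h; apply: Nx; apply: NN; right.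
have nE' x : ~ N x -> ~ E x by move=> Nx Ex; apply: Nx; apply: NN; left; exact: EN1.
pose f0 x := fine ((f \_ (~` N)) x).
pose g' x := ((g \_ (~` N1)) x + infty_on N x)%E.
have mb : bm_sets m N by exact: borel_bm.
have f0N x : ~ N x -> (f0 x)%:E = f x.
  by move=> Nx; rewrite /f0 patchE mem_set// fineK// nfin.
have g'N x : ~ N x -> g' x = g x.
  move=> Nx; rewrite /g' patchE mem_set ?infty_on_out ?adde0//.
  by move=> N1x; apply: Nx; apply: NN; left.
have gr0 x : (0 <= (g \_ (~` N1)) x)%E by rewrite patchE; case: ifP.
have g'y x : N x -> g' x = +oo%E.
  by move=> Nx; rewrite /g' infty_on_in// ge0_addey.
have g'0 x : (0 <= g' x)%E by rewrite adde_ge0// infty_on_ge0.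
exists f0, g'; split.
- exact: (measurableT_comp (f:=fine) (fine_measurable measurableT) bf).
- split => //; apply: (@emeasurable_funD _ (g_sigma_algebraType (@open X))) => //.
  exact: (borel_nonneg_infty_on bN).1.
- exact: ae_of_null mb N0 f0N.
- exact: ae_of_null mb N0 g'N.
move=> x y; have [->|xy] := eqVneq x y.
  by rewrite subrr normr0 mdistxx mule0.
have d0 : 0 < mdist x y by rewrite mdist_gt0.
have [Nx|Nx] := pselect (N x).
  by rewrite (g'y _ Nx) ge0_addye// gt0_mulye ?lte_fin// leey.
have [Ny|Ny] := pselect (N y).
  by rewrite (g'y _ Ny) ge0_addey// gt0_mulye ?lte_fin// leey.
rewrite !g'N//; have := HE x y (nE' _ Nx) (nE' _ Ny).
by rewrite -!f0N.
Qed.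

End borel_representatives.

Section good_representative.
Context {R : realType} {X : pmetricType R}.
Variables (f0 : X -> R) (g0 : X -> \bar R).
Hypothesis bg0 : borel_nonneg g0.
Hypothesis f0g0 : forall x y,
  (`|f0 x - f0 y|%:E <= (g0 x + g0 y) * (mdist x y)%:E)%E.
Implicit Types (i j : nat) (x y : X) (c : test_curve X).

Let E j : set X := [set x | (g0 x <= j%:R%:E)%E].
Let fl j : X -> R := mcshane (E j) (2 * j%:R) f0.
Let g2 x : \bar R := (2%:E * g0 x)%E.
(** A Hajlasz gradient of [fl i - fl j] for [i <= j] is [cut i]. The two functions agree on [E i],
    and the gradients [2 g0] of both add up to [4 g0]. If only [y] lies off [E i], then
    [g0 x <= i <= g0 y], so doubling the value at [y] makes up for dropping the one at [x]. *)
Let cut j : X -> \bar R := (fun x => 8%:E * g0 x)%E \_ (~` E j).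

Let j0 j : 0 <= 2 * j%:R :> R. Proof. by rewrite mulr_ge0. Qed.

Let E_le i j x : (i <= j)%N -> E i x -> E j x.
Proof. by move=> ij; rewrite /E /= => /le_trans; apply; rewrite lee_fin ler_nat. Qed.

Let Elip j x y : E j x -> E j y -> `|f0 x - f0 y| <= 2 * j%:R * mdist x y.
Proof.
move=> Ex Ey; rewrite -lee_fin; apply: (le_trans (f0g0 x y)).
rewrite EFinM; apply: lee_wpmul2r; first by rewrite lee_fin mdist_ge0.
by rewrite mulrDl mul1r EFinD leeD.
Qed.

Let flE j x : E j x -> fl j x = f0 x.
Proof. by move=> Ex; exact: (mcshaneE (j0 j) (@Elip j)). Qed.

Let fl_lip j x y : `|fl j x - fl j y| <= 2 * j%:R * mdist x y.
Proof. exact: (mcshane_lipschitz (j0 j) (@Elip j)). Qed.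

Let nE_le j x : ~ E j x -> (j%:R%:E <= g0 x)%E.
Proof. by move=> /negP; rewrite -ltNge => /ltW. Qed.

Let fl_half j x y : ~ E j y -> (`|fl j x - fl j y|%:E <= (g2 x + g2 y) * (mdist x y)%:E)%E.
Proof.
move=> nEy; apply: (@le_trans _ _ (2 * j%:R * mdist x y)%:E); first by rewrite lee_fin.
rewrite EFinM; apply: lee_wpmul2r; first by rewrite lee_fin mdist_ge0.
apply: (@le_trans _ _ (g2 y)); last first.
  by rewrite leeDr// mule_ge0// bg0.2.
by rewrite EFinM; apply: lee_wpmul2l => //; exact: nE_le.
Qed.

(** Inside [E j] this is the inequality for [f0]. At a point off [E j] the Lipschitz constant [2 j]
    is at most [g2]. The resulting gradient is the same for all [j]. *)
Let fl_grad j x y : (`|fl j x - fl j y|%:E <= (g2 x + g2 y) * (mdist x y)%:E)%E.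
Proof.
have [Ey|/fl_half] := pselect (E j y); last exact.
have [Ex|nEx] := pselect (E j x); last first.
  by rewrite distrC metric_sym addeC; exact: fl_half.
rewrite !flE//; apply: (le_trans (f0g0 x y)); apply: lee_wpmul2r.
  by rewrite lee_fin mdist_ge0.
have le2 z : (g0 z <= g2 z)%E.
  by rewrite /g2 -[leLHS]mul1e; apply: lee_wpmul2r; rewrite ?bg0.2// lee_fin; lra.
exact: leeD.
Qed.

Let cut_in j x : E j x -> cut j x = 0%E.
Proof. by move=> Ex; rewrite /cut patchE memNset//; exact. Qed.

Let cut_out j x : ~ E j x -> cut j x = (8%:E * g0 x)%E.
Proof. by move=> Ex; rewrite /cut patchE mem_set. Qed.

Let cut_ge0 j x : (0 <= cut j x)%E.
Proof.
have [/cut_in->//|/cut_out->] := pselect (E j x).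
by rewrite mule_ge0// bg0.2.
Qed.

Let bE j : <<s @open X >> (E j).
Proof.
have := bg0.1 measurableT _ (emeasurable_itv (`]-oo, (j%:R : R)%:E])%O).
by rewrite setTI (_ : _ @^-1` _ = E j).
Qed.

Let bcut j : borel_nonneg (cut j).
Proof.
split; last exact: cut_ge0.
rewrite /borel_fun /cut; apply/(measurable_restrictT _ _).1 => //.
  by apply: measurableC; exact: bE.
apply: measurable_funTS; apply: measurable_funeM; exact: bg0.1.
Qed.

Let cut_le j x : (cut j x <= 8%:E * g0 x)%E.
Proof.
have [/cut_in->|/cut_out->//] := pselect (E j x).
by rewrite mule_ge0// bg0.2.
Qed.

Let diff_half i j x y : (i <= j)%N -> ~ E i y ->
  (`|(fl i x - fl j x) - (fl i y - fl j y)|%:E <= (cut i x + cut i y) * (mdist x y)%:E)%E.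
Proof.
move=> ij nEy; have d0 := mdist_ge0 x y.
have h1 := fl_grad i x y; have h2 := fl_grad j x y.
apply: (@le_trans _ _ ((4%:E * g0 x + 4%:E * g0 y) * (mdist x y)%:E)%E).
  have -> : ((4%:E * g0 x + 4%:E * g0 y) * (mdist x y)%:E =
     (g2 x + g2 y) * (mdist x y)%:E + (g2 x + g2 y) * (mdist x y)%:E)%E.
    have gx := bg0.2 x; have gy := bg0.2 y.
    rewrite -ge0_muleDl ?adde_ge0 ?mule_ge0//; congr (_ * _)%E.
    rewrite addeACA /g2 -!ge0_muleDl// -!EFinD.
    by rewrite (_ : (2 + 2 = 4 :> R)%R)//; lra.
  apply: le_trans (leeD h1 h2); rewrite -EFinD lee_fin.
  rewrite (_ : _ - _ = (fl i x - fl i y) - (fl j x - fl j y)); last by lra.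
  exact: ler_normB.
apply: lee_wpmul2r; first by rewrite lee_fin.
have gx := bg0.2 x; have gy := bg0.2 y.
have H48 z : (4%:E * g0 z <= 8%:E * g0 z)%E.
  by apply: lee_wpmul2r; rewrite ?bg0.2// lee_fin; lra.
rewrite (cut_out nEy); have [Ex|nEx] := pselect (E i x); last first.
  by rewrite (cut_out nEx) leeD.
rewrite (cut_in Ex) add0e (_ : 8%:E = 4%:E + 4%:E)%E; last by rewrite -EFinD; congr EFin; lra.
rewrite ge0_muleDl//; apply: leeD => //; apply: lee_wpmul2l => //.
exact: le_trans Ex (nE_le nEy).
Qed.

Let diff_grad i j x y : (i <= j)%N ->
  (`|(fl i x - fl j x) - (fl i y - fl j y)|%:E <= (cut i x + cut i y) * (mdist x y)%:E)%E.
Proof.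
move=> ij; have [Ey|nEy] := pselect (E i y); last exact: diff_half.
have [Ex|nEx] := pselect (E i x); last first.
  by rewrite distrC metric_sym addeC; exact: diff_half.
rewrite !flE ?subrr ?normr0 ?mule_ge0 ?adde_ge0 ?lee_fin ?mdist_ge0//; exact: E_le ij _.
Qed.

Lemma sym_start_le c s h : 0 <= s <= 1 -> borel_nonneg h ->
  (sym_curve_integral (start_curve c s) h <= sym_curve_integral c h)%E.
Proof.
move=> s01 bh; rewrite /sym_curve_integral.
have [-> ->] := start_curve_integral c s01 bh.
have [-> ->] := curve_integral_quantile c bh.
apply: lee_wpmul2l; first by rewrite lee_fin.
apply: leeD; apply: ge0_subset_integral => //.
- exact: (measurable_funTS (measurable_quantile_curve c bh)).
- by move=> x _; exact: bh.2.
- move=> x /=; rewrite !in_itv/= => /andP[sx ->]; rewrite andbT.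
  by rewrite (le_lt_trans _ sx)// curve_variation_ge0.
- exact: (measurable_funTS (measurable_quantile_left_lim c bh)).
- by move=> x _; exact: bh.2.
- move=> x /=; rewrite !in_itv/= => /andP[sx ->]; rewrite andbT.
  by rewrite (le_lt_trans _ sx)// curve_variation_ge0.
Qed.

(** [fl i] and [fl j] agree at the point [c s] of [E i], so the oscillation of their difference
    along the tail from there is its value at the end. *)
Let osc_ij i j c s : 0 <= s <= 1 -> E i (c s) -> (i <= j)%N ->
  (`|fl i (c 1%R) - fl j (c 1%R)|%:E <= (5 * 2)%R%:E * sym_curve_integral c (cut i))%E.
Proof.
move=> s01 Es ij.
have K0 : 0 <= 2 * i%:R + 2 * j%:R :> R by rewrite addr_ge0.
have lip x y : `|(fl i x - fl j x) - (fl i y - fl j y)| <= (2 * i%:R + 2 * j%:R) * mdist x y.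
  rewrite (_ : _ - _ = (fl i x - fl i y) - (fl j x - fl j y)); last by lra.
  by rewrite (le_trans (ler_normB _ _))// mulrDl lerD.
have := @hajlasz_curve_bound _ _ (fun x => fl i x - fl j x) (cut i) _ (start_curve c s)
  K0 lip (bcut i) (fun x y => @diff_grad i j x y ij).
have /andP[s0 s1] := s01.
rewrite /= (max_l s1) (max_r s0) (flE Es) (flE (E_le ij Es)) subrr subr0.
move=> /le_trans; apply; apply: lee_wpmul2l; first by rewrite lee_fin mulr_ge0.
exact: sym_start_le.
Qed.

(** Where [g0] is finite, [cut n] is eventually 0, and [8 g0] dominates. *)
Let cut_cvg c : (curve_integral c g0 < +oo)%E ->
  curve_integral c (cut n) @[n --> \oo] --> 0%E.
Proof.
move=> fin.
have mc h : borel_nonneg h -> measurable_fun (`[0, 1]%classic : set R) (h \o c).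
  by move=> bh; exact: (measurable_funTS (measurable_borel_curve c bh)).
pose mu := lebesgue_stieltjes_measure (curve_variation c).
have mI : @measurable _ (measurableTypeR R) `[0, 1]%classic by exact: measurable_itv.
have int : mu.-integrable (`[0, 1]%classic : set R) (g0 \o c).
  apply/integrableP; split; first exact: mc.
  by under eq_integral => t _ do rewrite gee0_abs ?bg0.2//.
have := @dominated_convergence _ _ _ mu _ mI
  (fun n t => cut n (c t)) (cst 0%E) (fun t => 8%:E * g0 (c t))%E.
case.
- by move=> n; exact: (mc _ (bcut n)).
- exact: measurable_cst.
- have := integrable_ae mI int.
  apply: filterS => t h It; have /= gfin := h It.
  apply: cvg_near_cst.
  exists (Num.bound (fine (g0 (c t)))) => // n /= bn.
  rewrite cut_in// /E /= -(fineK gfin) lee_fin.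
  rewrite (le_trans (ltW (archi_boundP _)))//; first by rewrite fine_ge0// bg0.2.
  by rewrite ler_nat.
- exact: (integrableZl mI 8 int).
- apply: nearW => t n _; rewrite gee0_abs//; exact: cut_le.
by move=> _ _; rewrite integral0.
Qed.

Let ex_fin c : TC0 c -> (sym_curve_integral c g0 < +oo)%E ->
  exists2 s, 0 <= s <= 1 & exists i, E i (c s).
Proof.
rewrite TC0E => L0 fin; have [+ _] := sym_curve_integral_lty bg0.2 fin.
have [-> _] := curve_integral_quantile c bg0.
move=> ifin; apply: contrapT => N.
move: ifin; rewrite ltNge => /negP; apply.
have -> : (\int[lebesgue_measure]_(s in `]0%R, curve_variation c 1]) g0 (c (quantile c s)) =
   \int[lebesgue_measure]_(s in `]0%R, curve_variation c 1]) cst +oo s)%E.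
  apply: eq_integral => s _; apply: contrapT => /eqP; rewrite -ltey => gy.
  have gf : g0 (c (quantile c s)) \is a fin_num by rewrite ge0_fin_numE// bg0.2.
  apply: N; exists (quantile c s); first by rewrite quantile_ge0 quantile_le1.
  exists (Num.bound (fine (g0 (c (quantile c s))))).
  by rewrite /E /= -(fineK gf) lee_fin ltW// archi_boundP// fine_ge0// bg0.2.
rewrite integral_cst// [X in (_ <= _ * X)%E]lebesgue_measure_itv/= lte_fin L0 sube0.
by rewrite gt0_mulye ?lte_fin.
Qed.

Let fl_cauchy c : TC0 c -> (sym_curve_integral c g0 < +oo)%E ->
  cvgn (fun j => fl j (c 1)).
Proof.
move=> c0 fin; have [s s01 [i Ei]] := ex_fin c0 fin.
have [f1 f2] := sym_curve_integral_lty bg0.2 fin.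
apply: cauchy_cvg; apply: cauchy_exP => e e0.
(* Ten times the mean of the two integrals is then at most [e / 2], strictly inside the ball of
   radius [e]. *)
have e10 : 0 < e / 2 / 10 by rewrite !divr_gt0.
have [n1 _ H1] : \forall n \near \oo, (curve_integral c (cut n) <= (e / 2 / 10)%:E)%E.
  have /fine_cvgP[ff /cvgrPdist_le/(_ _ e10)] := cut_cvg f1.
  apply: filterS2 ff => n nf; rewrite sub0r normrN /= ger0_norm; last first.
    by rewrite fine_ge0// curve_integral_ge0.
  by rewrite -lee_fin fineK.
have [n2 _ H2] : \forall n \near \oo, (curve_integral (reversal c) (cut n) <= (e / 2 / 10)%:E)%E.
  have /fine_cvgP[ff /cvgrPdist_le/(_ _ e10)] := cut_cvg f2.
  apply: filterS2 ff => n nf; rewrite sub0r normrN /= ger0_norm; last first.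
    by rewrite fine_ge0// curve_integral_ge0.
  by rewrite -lee_fin fineK.
pose n := maxn i (maxn n1 n2).
have En : E n (c s) by apply: E_le Ei; rewrite leq_maxl.
exists (fl n (c 1)); exists n => // j /= nj.
rewrite /ball /= -lte_fin.
apply: (le_lt_trans (osc_ij s01 En nj)).
apply: (@le_lt_trans _ _ ((5 * 2)%R%:E * (2^-1%:E * ((e / 2 / 10)%:E + (e / 2 / 10)%:E)))%E).
  apply: lee_wpmul2l; first by rewrite lee_fin mulr_ge0.
  apply: lee_wpmul2l => //; apply: leeD.
    by apply: H1; rewrite /= /n !leq_max leqnn !orbT.
  by apply: H2; rewrite /= /n !leq_max leqnn !orbT.
rewrite -EFinD -!EFinM lte_fin; lra.
Qed.

(* The limit may fail to exist where g0 = +oo. *)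
Definition mcshane_limit x : R := fine (limn_esup (fun j => (fl j x)%:E)).

Let mcshane_limitE x l : fl j x @[j --> \oo] --> l -> mcshane_limit x = l.
Proof.
move=> fx; rewrite /mcshane_limit.
have fx' : (fl j x)%:E @[j --> \oo] --> l%:E.
  by apply: cvg_EFin => //; exact: nearW.
rewrite is_cvg_limn_esupE; last by apply/cvg_ex; exists l%:E.
by rewrite (cvg_lim _ fx').
Qed.

(** An upper limit of Borel functions is Borel whether or not the sequence converges. *)
Lemma mcshane_limit_borel : borel_fun (@open X) mcshane_limit.
Proof.
rewrite /borel_fun /mcshane_limit.
apply: (measurableT_comp (f:=fine) (fine_measurable measurableT)).
apply: measurable_fun_limn_esup => j; apply/measurable_EFinP.
exact: (lipschitz_borel (j0 j) (@fl_lip j)).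
Qed.

Lemma mcshane_limit_eq x : (g0 x < +oo)%E -> mcshane_limit x = f0 x.
Proof.
move=> gx; have gf : g0 x \is a fin_num by rewrite ge0_fin_numE// bg0.2.
apply: mcshane_limitE; apply: cvg_near_cst.
exists (Num.bound (fine (g0 x))) => // n /= bn.
rewrite flE// /E /= -(fineK gf) lee_fin.
rewrite (le_trans (ltW (archi_boundP _)))//; first by rewrite fine_ge0// bg0.2.
by rewrite ler_nat.
Qed.

(** The bound for [fl j] along [c] does not depend on [j] and passes to the limit at both ends; at
    the start, convergence comes from the reversed curve. The last factor 2 is that of [g2]. *)
Lemma mcshane_limit_gradient c :
  (`|mcshane_limit (c 1%R) - mcshane_limit (c 0%R)|%:E <=
   sym_curve_integral c (fun x => (5 * 2 * 2)%R%:E * g0 x))%E.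
Proof.
have s0 := sym_curve_integral_ge0 c bg0.2.
have k0 : 0 <= 5 * 2 * 2 :> R by rewrite !mulr_ge0.
rewrite sym_curve_integralZ//.
have [c0|/notTC0_eq->] := pselect (TC0 c); last first.
  by rewrite subrr normr0 mule_ge0.
have [->|] := eqVneq (sym_curve_integral c g0) +oo%E.
  by rewrite gt0_muley ?leey// lte_fin !mulr_gt0.
rewrite -ltey => fin.
have rfin := eq_ind_r (fun r : \bar R => r < +oo)%E fin (sym_curve_integral_reversal c g0).
have := fl_cauchy (reversal_TC0 c0) rfin.
rewrite (reversal1 c) => /cvg_ex[l0 h0].
have /cvg_ex[l1 h1] := fl_cauchy c0 fin.
rewrite (mcshane_limitE h0) (mcshane_limitE h1).
have sf : sym_curve_integral c g0 \is a fin_num by rewrite ge0_fin_numE.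
rewrite -(fineK sf) -EFinM lee_fin.
have b j : `|fl j (c 1) - fl j (c 0)| <= 5 * 2 * 2 * fine (sym_curve_integral c g0).
  have := @hajlasz_curve_bound _ _ (fl j) g2 _ c (j0 j) (@fl_lip j)
    (borel_nonnegZ (ler0n _ 2) bg0) (@fl_grad j).
  by rewrite sym_curve_integralZ// -(fineK sf) -!EFinM lee_fin mulrA.
have h : `|fl j (c 1) - fl j (c 0)| @[j --> \oo] --> `|l1 - l0|.
  by apply: cvg_norm; exact: cvgB.
rewrite -(cvg_lim _ h)//; apply: limr_le; first by apply/cvg_ex; exists `|l1 - l0|.
exact: nearW.
Qed.

End good_representative.

(** * m-upper gradients of doubling measures *)

Section separable.
Context {R : realType} {X : pmetricType R}.
Variable m : borel_measure R (@open X).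

Lemma ball_bm (x : X) (r : R) : <<s bm_sets m >> (ball x r).
Proof.
rewrite bm_setsE; apply: borel_bm; apply: sub_sigma_algebra; apply/metric_openP => y.
rewrite ballEmdist /= => xy; exists (r - mdist x y); first by rewrite subr_gt0.
by move=> z yz; have := metric_triangle x y z; lra.
Qed.

Lemma doubling_ball : doubling m ->
  forall (x : X) (r : R), 0 < r -> (0 < m (ball x r) < +oo)%E.
Proof.
move=> [C HC] x r r0.
have r20 : 0 < r / 2 by rewrite divr_gt0.
have [h1 h2 h3] := HC x _ r20.
have e : 2 * (r / 2) = r by rewrite mulrC divfK.
by rewrite e in h1 h2; rewrite h1 (le_lt_trans h2).
Qed.

Hypothesis mball : forall (x : X) (r : R), 0 < r -> (0 < m (ball x r) < +oo)%E.

Lemma ball_sigma_finite : sigma_finite setT m.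
Proof.
exists (fun n => ball (point : X) n.+1%:R); last first.
  by move=> n; split; [exact: ball_bm|have /andP[] := mball point (ltr0Sn R n)].
apply/seteqP; split => // x _; exists (Num.bound (mdist (point : X) x)) => //.
rewrite ballEmdist /= (lt_le_trans (archi_boundP (mdist_ge0 _ _)))//.
by rewrite ler_nat.
Qed.

(** The centres are sorted by their distance to a base point and by a lower bound on the mass of
    their balls. Each class is finite, since its disjoint balls lie in one ball of finite
    measure. *)
Lemma disjoint_balls_countable (G : set X) (e : R) : 0 < e ->
  trivIset G (fun x => ball x e) -> countable G.
Proof.
move=> e0 tG.
pose A (k : nat * nat) : set X := [set y | [/\ G y, mdist point y < k.1%:R &
  ((k.2.+1%:R^-1)%:E <= m (ball y e))%E]].
suff fA k : finite_set (A k).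
  apply: (@sub_countable _ _ _ (\bigcup_(k in setT) A k)); last first.
    by apply: bigcup_countable => // k _; exact: finite_set_countable.
  apply: subset_card_le => y Gy.
  have /andP[m0 my] := mball y e0.
  have mf : m (ball y e) \is a fin_num by rewrite ge0_fin_numE// ltW.
  have f0 : 0 < fine (m (ball y e)) by rewrite fine_gt0// m0.
  have [j _ Hj] := near_infty_natSinv_lt (PosNum f0).
  exists (Num.bound (mdist point y), j) => //; split => //=.
    by rewrite archi_boundP// mdist_ge0.
  by rewrite -(fineK mf) lee_fin ltW//; exact: (Hj j (leqnn j)).
apply: contrapT => /infiniteP/pcard_leP[u].
have uA i : A k (u i) by exact: funS.
pose F i := ball (u i) e.
have tF : trivIset setT F.
  move=> i j _ _ ij; apply: (@inj _ _ setT u); rewrite ?in_setT//.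
  by apply: tG => //; [have [] := uA i|have [] := uA j].
have mF i : <<s bm_sets m >> (F i) by exact: ball_bm.
have r0 : 0 < k.1%:R + e by rewrite ltr_wpDl.
have /andP[_ Bfin] := mball point r0.
have UF : (m (\bigcup_i F i) <= m (ball (point : X) (k.1%:R + e)%R))%E.
  apply: le_measure.
  - by rewrite inE; exact: bigcupT_measurable.
  - by rewrite inE; exact: ball_bm.
  move=> y [i _]; rewrite /F ballEmdist /= ballEmdist /= => uy.
  have [_ pu _] := uA i; have := metric_triangle point (u i) y; lra.
have B0 : m (ball (point : X) (k.1%:R + e)%R) \is a fin_num.
  by rewrite ge0_fin_numE.
pose b := fine (m (ball (point : X) (k.1%:R + e)%R)).
(* So many balls of mass at least [1 / (k.2 + 1)] would weigh more than [b]. *)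
pose N := Num.bound (b * k.2.+1%:R).
have : (\sum_(0 <= i < N) (k.2.+1%:R^-1)%:E <= b%:E)%E.
  rewrite /b fineK//; apply: le_trans UF.
  rewrite (measure_bigcup m setT F (fun i _ => mF i))//.
  have -> : (\sum_(0 <= i <oo | i \in setT) m (F i) = \sum_(0 <= i <oo) m (F i))%E.
    by apply: eq_eseriesl => i; rewrite in_setT.
  apply: le_trans (nneseries_lim_ge N _) => //.
  by apply: lee_sum => i _; have [] := uA i.
rewrite sumEFin lee_fin sumr_const_nat subn0 -[X in X <= _]mulr_natl ler_pdivrMr//.
rewrite leNgt archi_boundP// mulr_ge0//.
by rewrite /b fine_ge0.
Qed.

(** By maximality of a disjoint family of balls of radius [e], every point is within [2 e] of a
    centre: a point farther away would contribute one more disjoint ball. The families for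
    [e = 1 / (k + 1)] are countable. *)
Lemma dense_sequence : exists D : nat -> X, forall x (r : R), 0 < r ->
  exists n, mdist x (D n) < r.
Proof.
have ek k : 0 < k.+1%:R^-1 :> R by rewrite invr_gt0.
have ex' (e : R) : 0 < e -> exists G : set X, countable G /\ forall x, exists2 y, G y & mdist x y < 2 * e.
  move=> e0; have [G [_ tG maxG]] := ex_maximal_disjoint_subcollection
    (fun x : X => ball x e) setT.
  exists G; split; first exact: disjoint_balls_countable tG.
  move=> x; apply: contrapT => N.
  have Gx : ~ G x.
    move=> Gx; apply: N; exists x => //; rewrite mdistxx mulr_gt0//.
  have far y : G y -> ball x e `&` ball y e = set0.
    move=> Gy; apply/seteqP; split => // z; rewrite !ballEmdist => -[/= xz yz].
    apply: N; exists y => //; have := metric_triangle x z y.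
    rewrite (metric_sym z y); lra.
  apply: (maxG (G `|` [set x])) => //.
    split; first by move=> y Gy; left.
    by move=> /(_ x) h; apply: Gx; apply: h; right.
  move=> y z [Gy|->] [Gz|->] => //.
  - exact: tG.
  - by rewrite setIC (far _ Gy) => -[? []].
  - by rewrite (far _ Gz) => -[? []].
have ex k : exists G : set X, countable G /\
    forall x, exists2 y, G y & mdist x y < 2 * k.+1%:R^-1 by exact: ex' (ek k).
have [G HG] := choice ex.
have cS : countable (\bigcup_(k in setT) G k).
  by apply: bigcup_countable => // k _; have [] := HG k.
have /pfcard_geP[S0|[D]] := cS.
  have [y Gy _] := (HG 0%N).2 point.
  by have : (\bigcup_(k in setT) G k) y by [exists 0%N]; rewrite S0.
exists D => x r r0.
have r20 : 0 < r / 2 by rewrite divr_gt0.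
have [k _ Hk] := near_infty_natSinv_lt (PosNum r20).
have [y Gy xy] := (HG k).2 x.
have [n _ Dn] : range D y by apply: surj; exists k.
exists n; rewrite Dn (lt_trans xy)//.
by rewrite mulrC -ltr_pdivlMr//; exact: (Hk k (leqnn k)).
Qed.

End separable.

Section jump_measure.
Context {R : realType} {X : pmetricType R}.
Variable m : borel_measure R (@open X).
Variable D : nat -> X.
Hypothesis denseD : forall x (r : R), 0 < r -> exists n, mdist x (D n) < r.

Let X' := g_sigma_algebraType (bm_sets m).
Let J (z : X' * X') : test_curve X := jump_curve (z.1 : X) (z.2 : X).

(** Measurability for the product sigma-algebra relies on separability: [d(x, y) < r] iff the path
    through some [D n] is shorter than [r]. *)
Lemma measurable_mdist_pair :
  measurable_fun [set: X' * X'] (fun z : X' * X' => mdist (z.1 : X) (z.2 : X)).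
Proof.
apply: (measurability (@RGenInftyO.G R)) => [|/= _ [_] [r] -> <-].
  exact: RGenInftyO.measurableE.
rewrite setTI.
have md (a : X) : measurable_fun [set: X'] (fun x : X' => mdist (x : X) a).
  apply: borel_measurable; apply: (lipschitz_borel ler01) => x y.
  by rewrite mul1r; exact: metric_dist_triangle.
have -> : (fun z : X' * X' => mdist (z.1 : X) (z.2 : X)) @^-1` `]-oo, r[%classic =
    \bigcup_n ((fun z : X' * X' => mdist (z.1 : X) (D n) + mdist (z.2 : X) (D n)) @^-1` `]-oo, r[%classic).
  apply/seteqP; split => -[x y] /=; last first.
    move=> [n _] /=; rewrite !in_itv/=; apply: le_lt_trans.
    by rewrite (metric_sym y); exact: metric_triangle.
  rewrite in_itv/= => xyr.
  have r0 : 0 < (r - mdist (x : X) (y : X)) / 2 by rewrite divr_gt0// subr_gt0.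
  have [n Hn] := denseD y r0; exists n => //=; rewrite in_itv/=.
  have := metric_triangle (x : X) y (D n); lra.
apply: bigcupT_measurable => n; rewrite -[X in measurable X]setTI.
have mD : measurable_fun setT
    (fun z : X' * X' => mdist (z.1 : X) (D n) + mdist (z.2 : X) (D n)).
  apply: measurable_funD.
    exact: (measurableT_comp (md (D n)) measurable_fst).
  exact: (measurableT_comp (md (D n)) measurable_snd).
exact: mD.
Qed.

Lemma jump_dTC (x y x' y' : X) (r : R) : mdist x x' <= r -> mdist y y' <= r ->
  (dTC (jump_curve x y) (jump_curve x' y') <= r%:E)%E.
Proof.
move=> xr yr; have r0 : 0 <= r by exact: le_trans (mdist_ge0 _ _) xr.
apply: (@le_trans _ _ (\int[lebesgue_measure]_(t in `[0%R, 1%R]) cst r%:E t)%E).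
  apply: ge0_le_integral => //.
  - by move=> t _; rewrite lee_fin le_min ler01 mdist_ge0.
  - apply/measurable_EFinP; apply: measurable_funTS; apply: measurable_minr => //.
    exact: measurable_mdist_test_curve.
  move=> t _; rewrite lee_fin /= ge_min; apply/orP; right.
  by case: ifP.
rewrite integral_cst// [X in (_ * X <= _)%E]lebesgue_measure_itv/= lte_fin ltr01 sube0.
by rewrite mule1.
Qed.

(** Jump curves depend continuously on their two values, and in a separable space an open set of
    pairs is a countable union of products of balls. *)
Lemma jump_open (U : set (test_curve X)) : TC_open U -> measurable (J @^-1` U).
Proof.
move=> oU.
pose Rect (k : nat * nat * nat) : set (X' * X') :=
  (ball (D k.1.1) (k.2.+1%:R^-1) : set X') `*` (ball (D k.1.2) (k.2.+1%:R^-1) : set X').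
have -> : J @^-1` U = \bigcup_(k in [set k | Rect k `<=` J @^-1` U]) Rect k.
  apply/seteqP; split => [[x y] Uxy|z [k /= kU /kU]//].
  have [e e0 He] := oU _ Uxy.
  (* Two points of a ball of radius below [e / 3] are less than [2 e / 3] apart, which leaves room
     for a strict inequality. *)
  have e20 : 0 < e / 3 by rewrite divr_gt0.
  have [k _ Hk] := near_infty_natSinv_lt (PosNum e20).
  have {Hk} /= ke := Hk k (leqnn k).
  have k0 : 0 < k.+1%:R^-1 :> R by rewrite invr_gt0.
  have [i xi] := denseD x k0; have [j yj] := denseD y k0.
  exists (i, j, k) => /=; last first.
    by rewrite /Rect /=; split; rewrite ballEmdist /= metric_sym.
  move=> [x' y'] [/=]; rewrite !ballEmdist /= => xi' yj'.
  apply: He; apply: (@le_lt_trans _ _ (2 * (e / 3))%:E); last by rewrite lte_fin; lra.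
  apply: jump_dTC.
    apply: (le_trans (metric_triangle x (D i) x')); rewrite mulr_natl mulr2n.
    by apply: lerD; apply: ltW; [exact: lt_trans xi ke|exact: lt_trans xi' ke].
  apply: (le_trans (metric_triangle y (D j) y')); rewrite mulr_natl mulr2n.
  by apply: lerD; apply: ltW; [exact: lt_trans yj ke|exact: lt_trans yj' ke].
rewrite bigcup_mkcond; apply: countable_bigcupT_measurable; first exact: countableP.
move=> k; case: ifP => // _; apply: measurableX; exact: ball_bm.
Qed.

(* Separability makes this sigma-algebra contain the open sets of TC. *)
Definition jump_sets : set (set (test_curve X)) := [set S | measurable (J @^-1` S)].

Lemma jump_sets_sigma : sigma_algebra setT jump_sets.
Proof.
split.
- by rewrite /jump_sets /= preimage_set0; exact: measurable0.
- by move=> S mS; rewrite /jump_sets /= setTD preimage_setC; exact: measurableC.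
- by move=> F mF; rewrite /jump_sets /= preimage_bigcup; exact: bigcupT_measurable.
Qed.

Lemma jump_measurable :
  measurable_fun [set: X' * X'] (J : _ -> g_sigma_algebraType jump_sets).
Proof.
move=> _ Y; rewrite /measurable /= (sigma_algebra_id jump_sets_sigma) setTI.
exact.
Qed.

Variables (nu : {measure set (X' * X') -> \bar R}) (A : set (X' * X')).
Hypothesis mA : measurable A.
Variable k : {nonneg R}.

(** In the application [k] is the inverse of the mass of [A], which makes this a probability
    measure. *)
Definition jump_measure : borel_measure R (@TC_open R X) :=
  BorelMeasure jump_sets_sigma jump_open
    (mscale k (measure_function_pushforward__canonical__measure_function_Measure (mrestr nu mA) jump_measurable)).

Lemma jump_measure_integral (F : test_curve X -> \bar R) :
  (forall c, (0 <= F c)%E) -> measurable_fun setT (F \o J) ->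
  (\int[jump_measure]_c F c = k%:num%:E * \int[nu]_(z in A) F (J z))%E.
Proof.
move=> F0 mF.
have mF' : measurable_fun [set: g_sigma_algebraType jump_sets] F.
  move=> _ Y mY; rewrite /measurable /= (sigma_algebra_id jump_sets_sigma) setTI.
  rewrite /jump_sets /= -[X in measurable X]setTI; exact: mF.
rewrite ge0_integral_mscale//.
congr (_ * _)%E.
rewrite (@ge0_integral_pushforward _ _ _ _ _ _ jump_measurable)//.
by rewrite preimage_setT; apply: mrestr_integral => // z; exact: F0.
Qed.

End jump_measure.

(** * From m-upper gradients to Hajlasz gradients *)

Section ags_hajlasz.
Context {R : realType} {X : pmetricType R}.
Variables (m : borel_measure R (@open X)).
Hypothesis mball : forall (x : X) (r : R), 0 < r -> (0 < m (ball x r) < +oo)%E.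
Variables (f : X -> R) (g : X -> \bar R).
Hypothesis bf : borel_fun (@open X) f.
Hypothesis fg : m_upper_gradient m f g.
Local Open Scope ereal_scope.
Let X' := g_sigma_algebraType (bm_sets m).

Let bg : borel_nonneg g. Proof. exact: fg.1. Qed.

Let h1 (z : X' * X') : \bar R := `|f z.1 - f z.2|%:E.
Let h2 (z : X' * X') : \bar R := (g z.1 + g z.2) * (mdist (z.1 : X) (z.2 : X))%:E.
Let bad : set (X' * X') := [set z | h2 z < h1 z].

Let h20 z : 0 <= h2 z.
Proof. by rewrite mule_ge0 ?lee_fin ?mdist_ge0// adde_ge0// bg.2. Qed.

Let mh1 : measurable_fun setT h1.
Proof.
apply/measurable_EFinP; apply: measurableT_comp => //; apply: measurable_funB.
- exact: (measurableT_comp (borel_measurable (m:=m) bf) measurable_fst).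
- exact: (measurableT_comp (borel_measurable (m:=m) bf) measurable_snd).
Qed.

Let mh2 : measurable_fun setT h2.
Proof.
have [D denseD] := dense_sequence mball.
apply: emeasurable_funM.
  apply: emeasurable_funD.
  - exact: (measurableT_comp (borel_measurable (m:=m) bg.1) measurable_fst).
  - exact: (measurableT_comp (borel_measurable (m:=m) bg.1) measurable_snd).
by apply/measurable_EFinP; exact: (measurable_mdist_pair denseD).
Qed.

Section on_ball.
Variables (a : X) (r : R).
Hypothesis r0 : (0 < r)%R.
Let B : set X' := ball a r.
Let mB : measurable B. Proof. exact: ball_bm. Qed.
Let Bfin : m B < +oo. Proof. by have /andP[] := mball a r0. Qed.
Let mn : {finite_measure set X' -> \bar R} := mfrestr mB Bfin.
Let nu : {measure set (X' * X') -> \bar R} := mn \x mn.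

Let nuT : nu setT < +oo.
Proof.
rewrite -setXTT; have -> : nu (setT `*` setT) = mn setT * mn setT by exact: product_measure1E.
have fin : mn setT \is a fin_num by exact: fin_num_measure.
by rewrite -(fineK fin) -EFinM ltry.
Qed.

(** The gap [1 / (i + 1)] keeps the pairs off the diagonal, so that the jumps are not constant, and
    makes the final inequality strict. The bound on [h1] makes the integral of [h2] finite. *)
Let Ak (i : nat) : set (X' * X') := [set z | [/\ B z.1, B z.2,
  h2 z + (i.+1%:R^-1)%:E <= h1 z & h1 z <= i%:R%:E]].

Let mAk i : measurable (Ak i).
Proof.
have -> : Ak i = ((B `*` B) `&` [set z | h2 z + (i.+1%:R^-1)%:E <= h1 z]) `&` [set z | h1 z <= i%:R%:E].
  by apply/seteqP; split => z /=; [move=> []|move=> [[[]]]].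
apply: measurableI.
  apply: measurableI; first exact: measurableX.
  rewrite -[X in measurable X]setTI; apply: measurable_lee => //.
  by apply: emeasurable_funD.
by rewrite -[X in measurable X]setTI; apply: emeasurable_fun_infty_c.
Qed.

(** If the set had positive mass, the normalized jump measure on it would be admissible. The
    gradient inequality would then bound the integral of [h1] by half that of [h2], whereas [h1]
    exceeds [h2] by a fixed amount on the set. *)
Let Ak_null i : nu (Ak i) = 0.
Proof.
have [D denseD] := dense_sequence mball.
apply/eqP; apply: contrapT => /negP nuA0.
have nuA : 0 < nu (Ak i) by rewrite lt0e nuA0 measure_ge0.
have nuAfin : nu (Ak i) \is a fin_num.
  rewrite ge0_fin_numE ?measure_ge0//; apply: le_lt_trans nuT.
  by apply: le_measure; rewrite ?inE//; exact: mAk.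
pose w : R := ((fine (nu (Ak i)))^-1)%R.
have w0 : (0 < w)%R by rewrite invr_gt0 fine_gt0// nuA -ge0_fin_numE.
pose k : {nonneg R} := NngNum (ltW w0).
pose mu := jump_measure denseD nu (mAk i) k.
have muE S : mu S = w%:E * nu ((fun z : X' * X' => jump_curve (z.1 : X) (z.2 : X)) @^-1` S `&` Ak i) by [].
have muint (F : test_curve X -> \bar R) : (forall c, 0 <= F c) ->
    measurable_fun setT (fun z : X' * X' => F (jump_curve (z.1 : X) (z.2 : X))) ->
    \int[mu]_c F c = w%:E * \int[nu]_(z in Ak i) F (jump_curve (z.1 : X) (z.2 : X)).
  exact: (@jump_measure_integral _ _ _ _ denseD nu _ (mAk i) k F).
have M0mu : M0 mu.
  rewrite /M0 /= muE (_ : _ `&` _ = set0) ?measure0 ?mule0//.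
  apply/seteqP; split => // -[x y] /= [nTC [_ _ h _]].
  apply: nTC; apply/jump_curve_TC0 => xy; move: h.
  rewrite /h1 /h2 /= xy subrr normr0 mdistxx mule0 add0e lee_fin.
  by rewrite leNgt invr_gt0 ltr0n.
have wA : w%:E * nu (Ak i) = 1.
  rewrite -(fineK nuAfin) -EFinM /w mulVf// gt_eqF// fine_gt0// nuA.
  by rewrite -ge0_fin_numE.
have mnT : mn setT \is a fin_num by exact: fin_num_measure.
have md := measurable_mdist_pair (m := m) denseD.
have adm : admissible m mu.
  split.
  - by rewrite muE preimage_setT setTI.
  (* At each time the jump sits at its first or second point, so its law is at most [w] times a
     marginal of [nu], and both marginals are [mn setT] times [mn]. *)
  - exists (w * fine (mn setT))%R; first by apply: mulr_ge0; [exact: ltW|exact: fine_ge0].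
    move=> t S t01 bS; rewrite muE EFinM fineK// -muleA.
    rewrite lee_pmul2l//.
    have mS : measurable (S : set X') by rewrite /measurable /= bm_setsE; exact: borel_bm.
    have mnS : mn S <= m S by rewrite /mn /= /mfrestr /= /mrestr; apply: le_measure; rewrite ?inE//; exact: measurableI.
    have eqJ z : jump_curve (z.1 : X) (z.2 : X) t = (if (t < 2^-1)%R then z.1 else z.2) by [].
    pose S' : set (X' * X') := if (t < 2^-1)%R then S `*` setT else setT `*` S.
    have mS' : measurable S' by rewrite /S'; case: ifP => _; exact: measurableX.
    have nuS' : nu S' = mn S * mn setT.
      rewrite /S'; case: ifP => _; first exact: product_measure1E.
      by rewrite muleC; exact: product_measure1E.
    apply: (@le_trans _ _ (nu S')).
      have -> : (fun z : X' * X' => jump_curve (z.1 : X) (z.2 : X)) @^-1` [set c | S (c t)] = S'.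
        rewrite /S'; case: ifP => ht; apply/seteqP; split => z /=; rewrite ht => zS; by [split|case: zS].
      by apply: le_measure; rewrite ?inE; [exact: measurableI|exact: mS'|exact: subIsetl].
    by rewrite nuS' muleC; apply: lee_pmul.
  - rewrite muint; last 2 first.
    + by move=> c; exact: mtotal_variation_ge0.
    + rewrite (_ : (fun _ => _) = (fun z : X' * X' => (mdist (z.1 : X) (z.2 : X))%:E)).
        exact/measurable_EFinP.
      by apply/funext => z; rewrite jump_curve_length.
    apply: (@le_lt_trans _ _ (w%:E * \int[nu]_(z in Ak i) (r + r)%:E)).
      rewrite lee_pmul2l//; apply: ge0_le_integral => //.
      * by move=> z _; exact: mtotal_variation_ge0.
      * rewrite (_ : (fun _ => _) = (fun z : X' * X' => (mdist (z.1 : X) (z.2 : X))%:E)).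
          by apply/measurable_EFinP; exact: measurable_funTS.
        by apply/funext => z; rewrite jump_curve_length.
      move=> z [+ + _ _]; rewrite /B !ballEmdist /= jump_curve_length lee_fin => h3 h4.
      have := metric_triangle (z.1 : X) a z.2; rewrite (metric_sym (z.1 : X) a); lra.
    by rewrite integral_cst// -(fineK nuAfin) -!EFinM ltry.
have := fg.2 _ M0mu adm; rewrite /curve_oscillation /sym_measure_integral.
rewrite !muint; last 4 first.
- by move=> c; apply: sym_curve_integral_ge0; exact: bg.2.
- rewrite (_ : (fun _ => _) = (fun z => 2^-1%:E * h2 z)); first exact: measurable_funeM.
  by apply/funext => z; rewrite sym_curve_integral_jump.
- by [].
- rewrite (_ : (fun _ => _) = h1) => //.
  by apply/funext => z; rewrite jump_curve0 jump_curve1 /h1 distrC.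
rewrite lee_pmul2l// leNgt => /negP; apply.
have mAh (h : X' * X' -> \bar R) : measurable_fun setT h -> measurable_fun (Ak i) h.
  by move=> mh; exact: measurable_funTS.
apply: (@le_lt_trans _ _ (\int[nu]_(z in Ak i) h2 z)).
  apply: ge0_le_integral => //.
  - by move=> z _; apply: sym_curve_integral_ge0; exact: bg.2.
  - rewrite (_ : (fun _ => _) = (fun z => 2^-1%:E * h2 z)); first by apply: mAh; exact: measurable_funeM.
    by apply/funext => z; rewrite sym_curve_integral_jump.
  - exact: mAh.
  move=> z _; rewrite sym_curve_integral_jump// gee_pMl ?lee_fin//.
    exact: h20.
  by rewrite invf_le1// ler1n.
(* Strictness requires the integral of [h2] to be finite; it is, as [h2 <= h1 <= i] on a set of
   finite mass. *)
apply: (@lt_le_trans _ _ (\int[nu]_(z in Ak i) (h2 z + (i.+1%:R^-1)%:E)%E)).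
  rewrite ge0_integralD//; last exact: mAh.
  rewrite integral_cst// lteDl ?mule_gt0//.
  rewrite ge0_fin_numE ?integral_ge0//.
  apply: (@le_lt_trans _ _ (\int[nu]_(z in Ak i) i%:R%:E)).
    apply: ge0_le_integral => //; first exact: mAh.
    move=> z [_ _ h3 h4]; apply: le_trans h4; apply: le_trans h3.
    by rewrite leeDl.
  by rewrite integral_cst// -(fineK nuAfin) -!EFinM ltry.
apply: ge0_le_integral => //.
- by move=> z _; rewrite adde_ge0.
- by apply: mAh; exact: emeasurable_funD.
- by rewrite (_ : (fun _ => _) = h1); [exact: mAh|apply/funext => z; rewrite jump_curve0 jump_curve1 /h1 distrC].
- by move=> z [_ _ h3 _]; rewrite jump_curve0 jump_curve1 distrC.
Qed.

Let bad_null : nu (bad `&` (B `*` B)) = 0.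
Proof.
have -> : bad `&` (B `*` B) = \bigcup_i Ak i.
  apply/seteqP; split => [z [/= bz [Bz1 Bz2]]|z [i _ [Bz1 Bz2 h3 h4]]]; last first.
    split => //; apply: lt_le_trans (h3).
    rewrite lteDl ?lte_fin ?invr_gt0//.
    rewrite ge0_fin_numE//; apply: le_lt_trans (ltry i%:R); apply: le_trans h4.
    by apply: le_trans h3; rewrite leeDl// lee_fin invr_ge0.
  have h2fin : h2 z \is a fin_num by rewrite ge0_fin_numE// (lt_trans bz)// ltry.
  have : (0 < `|f z.1 - f z.2| - fine (h2 z))%R by rewrite subr_gt0 -lte_fin fineK.
  set e := (X in (0 < X)%R) => e0.
  have [n _ Hn] := near_infty_natSinv_lt (PosNum e0).
  pose i := maxn n (Num.truncn `|f z.1 - f z.2|%R).+1.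
  exists i => //; split => //.
    have := Hn i (leq_maxl _ _); rewrite /= /e ltrBrDl => /ltW.
    by rewrite -lee_fin EFinD fineK.
  rewrite lee_fin; apply: ltW; apply: lt_le_trans (truncnS_gt _) _.
  by rewrite ler_nat leq_maxr.
apply: measure_negligible; first exact: bigcupT_measurable.
apply: negligible_bigcup => i; apply/negligibleP; [exact: mAk|exact: Ak_null].
Qed.

Lemma bad_section : exists N : set X', [/\ measurable N, m N = 0 &
  forall x, B x -> ~ N x -> m.-negligible ([set y | bad (x, y)] `&` B)].
Proof.
have mC : measurable (bad `&` (B `*` B)).
  apply: measurableI; last exact: measurableX.
  by rewrite -[X in measurable X]setTI; exact: measurable_lte.
have := bad_null; rewrite /nu /= /product_measure1 => h.
have mx := measurable_fun_xsection mn mC.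
have /(ae_eq_integral_abs mn measurableT mx) [N [mN N0 HN]] :
    \int[mn]_x `|mn (xsection (bad `&` (B `*` B)) x)| = 0.
  by rewrite -[RHS]h; apply: eq_integral => x _; rewrite gee0_abs.
(* [N] is null only for the restriction of [m] to [B]. *)
exists (N `&` B); split.
- exact: measurableI.
- exact: N0.
move=> x Bx NBx; have {}NBx : ~ N x by move=> Nx; apply: NBx.
have := subsetC HN NBx; rewrite setCK /= => /(_ I) H0.
exists (xsection (bad `&` (B `*` B)) x `&` B); split => //.
- by apply: measurableI => //; exact: measurable_xsection.
- by move=> y [yb By]; split => //; apply: mem_set.
Qed.

End on_ball.

Let ae_section : exists N : set X', [/\ measurable N, m N = 0 &
  forall x, ~ N x -> forall (a : X) (r : R), m.-negligible ([set y | bad (x, y)] `&` ball a r)].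
Proof.
have s0 (n : nat) : (0 < n.+1%:R :> R)%R by [].
have /choice[N HN] (n : nat) := bad_section point (s0 n).
exists (\bigcup_n N n); split.
- by apply: bigcupT_measurable => n; have [] := HN n.
- apply: measure_negligible; first by apply: bigcupT_measurable => n; have [] := HN n.
  by apply: negligible_bigcup => n; have [mN N0 _] := HN n; apply/negligibleP.
move=> x Nx a r.
pose n := Num.truncn (Num.max (mdist (point : X) x) (mdist (point : X) a + r)%R).
have xn : (mdist (point : X) x < n.+1%:R)%R.
  by apply: le_lt_trans (truncnS_gt _); rewrite le_max lexx.
have an : (mdist (point : X) a + r < n.+1%:R)%R.
  by apply: le_lt_trans (truncnS_gt _); rewrite le_max lexx orbT.
have [_ _ Hn] := HN n.
apply: negligibleS (Hn x _ _).
- move=> y [by_ ya]; split => //; move: ya; rewrite !ballEmdist /= => ya.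
  by have := metric_triangle (point : X) a y; lra.
- by rewrite ballEmdist.
- by move=> Nnx; apply: Nx; exists n.
Qed.

Let mlt (q : R) : measurable ([set x | g x < q%:E] : set X').
Proof.
rewrite -[X in measurable X]setTI; apply: emeasurable_fun_infty_o => //.
exact: (borel_measurable (m := m) bg.1).
Qed.

(** A point that violates the condition lies in a null set [W t], cut out by a rational level and by
    a small ball around a term of the dense sequence. There are countably many such sets. *)
Let ae_dense : exists N : set X', [/\ measurable N, m N = 0 &
  forall x, ~ N x -> forall (q : rat) (r : R), g x < (ratr q)%:E -> (0 < r)%R ->
    0 < m ([set x | g x < (ratr q)%:E] `&` ball x r)].
Proof.
have [D denseD] := dense_sequence mball.
pose W (t : rat * nat * nat) : set X' :=
  [set x | g x < (ratr t.1.1)%:E] `&` ball (D t.1.2) ((t.2.+1%:R^-1)%R).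
have k0 k : (0 < k.+1%:R^-1 :> R)%R by rewrite invr_gt0.
have mW t : measurable (W t) by apply: measurableI; [exact: mlt|exact: ball_bm].
(* The null sets among the [W t], in an enumeration of the triples; the other indices give the empty
   set. *)
pose F i : set X' := if unpickle i is Some t then if m (W t) == 0 then W t else set0 else set0.
have mF i : measurable (F i).
  by rewrite /F; case: unpickle => // t; case: ifP.
have F0 i : m (F i) = 0.
  by rewrite /F; case: unpickle => // t; case: ifP => // /eqP.
exists (\bigcup_i F i); split.
- exact: bigcupT_measurable.
- apply: measure_negligible; first exact: bigcupT_measurable.
  by apply: negligible_bigcup => i; apply/negligibleP; [exact: mF|exact: F0].
move=> x Fx q r gq r0.
have r20 : (0 < r / 2)%R by rewrite divr_gt0.
have [k _ /(_ k (leqnn k)) /= kr] := near_infty_natSinv_lt (PosNum r20).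
have [n xn] := denseD x _ (k0 k).
have Wx : W (q, n, k) x by split => //=; rewrite ballEmdist /= metric_sym.
have : m (W (q, n, k)) != 0.
  apply/negP => W0; apply: Fx; exists (pickle (q, n, k)); first exact: I.
  rewrite /F pickleK W0; exact: Wx.
rewrite -measure_gt0 => /lt_le_trans; apply; apply: le_measure; rewrite ?inE.
- exact: mW.
- by apply: measurableI; [exact: mlt|exact: ball_bm].
move=> y [/= gy]; rewrite !ballEmdist /= => ny; split => //=.
apply: (le_lt_trans (metric_triangle x (D n) y)); rewrite (splitr r).
by apply: ltrD; apply: lt_trans kr.
Qed.

(** A null set of pairs need not be contained in the pairs that meet a fixed null set of points. So
    [y] is replaced by a nearby [z] with [g z] hardly above [g y], such that neither [(x, z)] nor
    [(y, z)] is bad: such [z] fill a set of positive measure near [y], and the bad ones form a null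
    set. *)
Lemma m_upper_gradient_hajlasz : hajlasz_gradient m (EFin \o f) g.
Proof.
split; [exact: borel_measurable bg.1|exact: bg.2|].
have [N1 [mN1 N10 HN1]] := ae_section.
have [N2 [mN2 N20 HN2]] := ae_dense.
have mN : measurable (N1 `|` N2) by exact: measurableU.
exists (N1 `|` N2); first split.
- by move: mN; rewrite /measurable /= bm_setsE.
- by apply: measure_negligible => //; apply: negligibleU; apply/negligibleP.
move=> x y xN yN; rewrite -EFinB abse_EFin.
have [<-|xy] := eqVneq x y.
  by rewrite subrr normr0 mule_ge0 ?lee_fin ?mdist_ge0// adde_ge0// bg.2.
have d0 : (0 < mdist x y)%R by rewrite mdist_gt0.
have gx0 := bg.2 x; have gy0 := bg.2 y.
have [gx|] := boolP (g x \is a fin_num); last first.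
  rewrite ge0_fin_numE// -leNgt leye_eq => /eqP ->.
  by rewrite ge0_addye ?gt0_mulye ?leey.
have [gy|] := boolP (g y \is a fin_num); last first.
  rewrite ge0_fin_numE// -leNgt leye_eq => /eqP ->.
  by rewrite ge0_addey ?gt0_mulye ?leey.
have key (q : rat) (r : R) : (fine (g y) < ratr q)%R -> (0 < r)%R ->
    (`|f x - f y| <= (fine (g x) + ratr q) * (mdist x y + r) + (fine (g y) + ratr q) * r)%R.
  move=> yq r0; have gyq : g y < (ratr q)%:E by rewrite -(fineK gy) lte_fin.
  have yN2 : ~ N2 y by move=> ?; apply: yN; right.
  have pos := HN2 y yN2 q r gyq r0.
  have xs := HN1 x (fun h => xN (or_introl h)) y r.
  have ys := HN1 y (fun h => yN (or_introl h)) y r.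
  have [z [[/= gz yz] nxz nyz]] : exists z, [/\ ([set x | g x < (ratr q)%:E] `&` ball y r) z,
      ~ bad (x, z) & ~ bad (y, z)].
    apply: contrapT => nz; suff: m ([set x | g x < (ratr q)%:E] `&` ball y r) = 0.
      by move=> h; rewrite h ltxx in pos.
    apply: measure_negligible; first by apply: measurableI; [exact: mlt|exact: ball_bm].
    apply: negligibleS (negligibleU xs ys) => z [gz yz].
    have [bx|nbx] := pselect (bad (x, z)); first by left.
    have [by_|nby] := pselect (bad (y, z)); first by right.
    by case: nz; exists z.
  have gz0 := bg.2 z.
  have gzf : g z \is a fin_num by rewrite ge0_fin_numE// (lt_trans gz)// ltry.
  have yzr : (mdist y z < r)%R by move: yz; rewrite ballEmdist.
  move/negP: nxz; rewrite -leNgt /h1 /h2 /= -(fineK gx) -(fineK gzf) -EFinD -EFinM lee_fin => hx.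
  move/negP: nyz; rewrite -leNgt /h1 /h2 /= -(fineK gy) -(fineK gzf) -EFinD -EFinM lee_fin => hy.
  have gzq : (fine (g z) <= ratr q)%R by rewrite -lee_fin fineK// ltW.
  have u0 := fine_ge0 gx0; have v0 := fine_ge0 gy0; have w0 := fine_ge0 gz0.
  have dz := metric_triangle x y z.
  apply: (le_trans (ler_distD (f z) _ _)); apply: lerD.
    apply: (le_trans hx); apply: ler_pM; rewrite ?addr_ge0 ?mdist_ge0//; lra.
  rewrite distrC; apply: (le_trans hy); apply: ler_pM; rewrite ?addr_ge0 ?mdist_ge0//; lra.
rewrite -(fineK gx) -(fineK gy) -EFinD -EFinM lee_fin.
move: key (fine_ge0 gx0) (fine_ge0 gy0).
move: (fine (g x)) (fine (g y)) (mdist x y) d0 => u v d d0 key u0 v0.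
apply/ler_addgt0Pr => e e0.
(* For [q < v + t] and [r = t <= 1], the bound in [key] exceeds [(u + v) d] by at most
   [t (d + u + 3 v + 2 t)]. *)
pose K := (d + u + 3 * v + 2)%R.
have K0 : (0 < K)%R by rewrite /K; lra.
pose t := Num.min 1%R (e / K)%R.
have t0 : (0 < t)%R by rewrite lt_min ltr01 divr_gt0.
have t1 : (t <= 1)%R by rewrite ge_min lexx.
have tK : (t * K <= e)%R by rewrite -ler_pdivlMr// ge_min lexx orbT.
have [q] : exists q : rat, (v < ratr q < v + t)%R.
  have vt : (v < v + t)%R by rewrite ltrDl.
  by have [q] := rat_in_itvoo vt; rewrite in_itv /= => h; exists q.
move=> /andP[vq qt].
have := key q t vq t0; rewrite /K in tK *.
nra.
Qed.

End ags_hajlasz.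

(** * Quotient spaces and natural maps *)

Section natural_maps.
Context {R : realType}.
Variables A B : fun_space R.
Hypotheses (lA : linear_quotient A) (lB : linear_quotient B).

Lemma fs_class_eq (S : fun_space R) (f g : fs_sort S) : linear_quotient S ->
  fs_mem S f -> fs_mem S g -> fs_class S f = fs_class S g <-> fs_eqv S f g.
Proof.
move=> [_ [rf sy tr _ _]] Sf Sg; split=> [fg|fg].
  have : fs_class S g g by split => //; exact: rf.
  by rewrite -fg => -[].
apply/seteqP; split => h [Sh e]; split => //.
- by apply: (tr g f h) => //; exact: sy.
- exact: (tr f g h).
Qed.

Lemma class_addE (S : fun_space R) (f g : fs_sort S) : linear_quotient S ->
  fs_mem S f -> fs_mem S g ->
  class_add (fs_class S f) (fs_class S g) = fs_class S (fs_add f g).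
Proof.
move=> [[_ aD _] [rf sy tr eD _]] Sf Sg; apply/seteqP; split.
  move=> h [f1 [Sf1 ff1] [g1 [Sg1 gg1] [Sh e]]]; split => //.
  by apply: (tr _ (fs_add f1 g1)) => //; [exact: aD|exact: aD|exact: eD].
move=> h [Sh e]; exists f; first by split => //; exact: rf.
by exists g; split => //; exact: rf.
Qed.

Lemma class_scaleE (S : fun_space R) c (f : fs_sort S) : linear_quotient S ->
  fs_mem S f -> class_scale c (fs_class S f) = fs_class S (fs_scale c f).
Proof.
move=> [[_ _ aZ] [rf sy tr _ eZ]] Sf; apply/seteqP; split.
  move=> h [f1 [Sf1 ff1] [Sh e]]; split => //.
  by apply: (tr _ (fs_scale c f1)) => //; [exact: aZ|exact: aZ|exact: eZ].
by move=> h [Sh e]; exists f => //; split => //; exact: rf.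
Qed.

Variable r : fs_sort A -> fs_sort B -> Prop.
Hypothesis wd : well_defined r.

Lemma natural_map_class f f' : fs_mem A f -> fs_mem B f' -> r f f' ->
  natural_map r (fs_class A f) = fs_class B f'.
Proof.
move=> Af Bf' rff'; have [_ [rf _ _ _ _]] := lA; have [_ [_ _ tr _ _]] := lB.
apply/seteqP; split => [h [f1 [Af1 e1] [f1' [Bf1' r1] [Bh e]]]|h fh].
  split => //; apply: (tr _ f1') => //; exact: (wd.2 f f1).
by exists f; [split => //; exact: rf|exists f'].
Qed.

Lemma natural_map_inj :
  (forall f g f' g', fs_mem A f -> fs_mem A g -> fs_mem B f' -> fs_mem B g' ->
    r f f' -> r g g' -> fs_eqv B f' g' -> fs_eqv A f g) ->
  set_inj (fs_quot A) (natural_map r).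
Proof.
move=> H _ _ /set_mem[f Af <-] /set_mem[g Ag <-].
have [f' Bf' rf] := wd.1 f Af; have [g' Bg' rg] := wd.1 g Ag.
rewrite (natural_map_class Af Bf' rf) (natural_map_class Ag Bg' rg).
move=> /(fs_class_eq lB Bf' Bg') e; apply/(fs_class_eq lA Af Ag).
exact: (H f g f' g').
Qed.

(** The norm of a class is an infimum over its members, so it is enough to bound, for each
    representative, the best of its possible images. The relation may thus have many images, as in
    almost everywhere equality. *)
Lemma natural_map_bounded_linear (C : R) : (0 < C) ->
  (forall f g f' g', fs_mem A f -> fs_mem A g -> fs_mem B f' -> fs_mem B g' ->
    r f f' -> r g g' -> r (fs_add f g) (fs_add f' g')) ->
  (forall c f f', fs_mem A f -> fs_mem B f' -> r f f' ->
    r (fs_scale c f) (fs_scale c f')) ->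
  (forall f, fs_mem A f ->
    ereal_inf [set fs_norm B f' | f' in [set f' | fs_mem B f' /\ r f f']] <=
      C%:E * fs_norm A f)%E ->
  bounded_linear (natural_map r).
Proof.
move=> C0 rD rZ rN; have [[_ AD AZ] _] := lA; have [[_ BD BZ] _] := lB.
split.
- by [].
- move=> _ [f Af <-]; have [f' Bf' rf] := wd.1 f Af.
  by rewrite (natural_map_class Af Bf' rf); exists f'.
- move=> _ _ [f Af <-] [g Ag <-].
  have [f' Bf' rf] := wd.1 f Af; have [g' Bg' rg] := wd.1 g Ag.
  rewrite (class_addE lA Af Ag) (natural_map_class Af Bf' rf).
  rewrite (natural_map_class Ag Bg' rg) (class_addE lB Bf' Bg').
  by apply: natural_map_class; [exact: AD|exact: BD|exact: rD].
- move=> c _ [f Af <-]; have [f' Bf' rf] := wd.1 f Af.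
  rewrite (class_scaleE c lA Af) (natural_map_class Af Bf' rf) (class_scaleE c lB Bf').
  by apply: natural_map_class; [exact: AZ|exact: BZ|exact: rZ].
exists C; first exact: ltW.
move=> _ [f Af <-]; rewrite -lee_pdivrMl//; apply: le_ereal_inf_tmp => _ [f1 [Af1 e1] <-].
rewrite lee_pdivrMl//; apply: le_trans (rN _ Af1); apply: le_ereal_inf_tmp => _ [f1' [Bf1' r1] <-].
rewrite ((fs_class_eq lA Af Af1).2 e1) (natural_map_class Af1 Bf1' r1).
have [_ [rf _ _ _ _]] := lB.
by apply: ereal_inf_lbound; exists f1' => //; split => //; exact: rf.
Qed.

End natural_maps.

Lemma natural_map_isomorphism (R : realType) (A B : fun_space R)
    (r : fs_sort A -> fs_sort B -> Prop) (r' : fs_sort B -> fs_sort A -> Prop) :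
  well_defined r -> well_defined r' ->
  bounded_linear (natural_map r) -> bounded_linear (natural_map r') ->
  (forall f f' f'', fs_mem A f -> fs_mem B f' -> fs_mem A f'' ->
    r f f' -> r' f' f'' -> fs_eqv A f f'') ->
  (forall f f' f'', fs_mem B f -> fs_mem A f' -> fs_mem B f'' ->
    r' f f' -> r f' f'' -> fs_eqv B f f'') ->
  bounded_isomorphism (natural_map r).
Proof.
move=> wr wr' br br' H H'; have [[lA lB] _ _ _ _] := br.
split => //; exists (natural_map r'); split => // _ /set_mem[f Sf <-].
- have [f' Bf' rf] := wr.1 f Sf; have [f'' Af'' rf'] := wr'.1 f' Bf'.
  rewrite (natural_map_class lA lB wr Sf Bf' rf) (natural_map_class lB lA wr' Bf' Af'' rf').
  by apply/esym/(fs_class_eq lA) => //; exact: (H f f' f'').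
- have [f' Af' rf] := wr'.1 f Sf; have [f'' Bf'' rf'] := wr.1 f' Af'.
  rewrite (natural_map_class lB lA wr' Sf Af' rf) (natural_map_class lA lB wr Af' Bf'' rf').
  by apply/esym/(fs_class_eq lB) => //; exact: (H' f f' f'').
Qed.

Section ereal_inf.
Context {R : realType}.
Implicit Types A B : set (\bar R).
Local Open Scope ereal_scope.

Lemma le_ereal_infD A B (x : \bar R) :
  (forall a, A a -> 0 <= a) -> (forall b, B b -> 0 <= b) ->
  (forall a b, A a -> B b -> x <= a + b) -> x <= ereal_inf A + ereal_inf B.
Proof.
move=> A0 B0 H.
have iA0 : 0 <= ereal_inf A by exact: le_ereal_inf_tmp.
have iB0 : 0 <= ereal_inf B by exact: le_ereal_inf_tmp.
have [iA|] := boolP (ereal_inf A \is a fin_num); last first.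
  rewrite ge0_fin_numE// -leNgt leye_eq => /eqP ->.
  by rewrite ge0_addye ?leey.
have [iB|] := boolP (ereal_inf B \is a fin_num); last first.
  rewrite ge0_fin_numE// -leNgt leye_eq => /eqP ->.
  by rewrite ge0_addey ?leey.
apply/lee_addgt0Pr => e e0; have e20 : (0 < e / 2)%R by rewrite divr_gt0.
have [a Aa /ltW ae] := lb_ereal_inf_adherent e20 iA.
have [b Bb /ltW be] := lb_ereal_inf_adherent e20 iB.
apply: (le_trans (H a b Aa Bb)); apply: (le_trans (leeD ae be)).
by rewrite addeACA -EFinD -splitr.
Qed.

End ereal_inf.

Section almost_everywhere.
Context {R : realType} {X : pmetricType R}.
Variable m : borel_measure R (@open X).
Implicit Types P Q : X -> Prop.

Lemma ae_mono P Q : (forall x, P x -> Q x) ->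
  {ae m, forall x, P x} -> {ae m, forall x, Q x}.
Proof.
move=> PQ [N [mN N0 NP]]; exists N; split => // x nQ.
by apply: NP => Px; apply: nQ; exact: PQ.
Qed.

Lemma ae_and P Q : {ae m, forall x, P x} -> {ae m, forall x, Q x} ->
  {ae m, forall x, P x /\ Q x}.
Proof.
move=> mP mQ; apply: (negligibleS _ (negligibleU mP mQ)) => x /= nPQ.
by have [Px|] := pselect (P x); [right => Qx; apply: nPQ|left].
Qed.

End almost_everywhere.

Section sobolev_norm.
Context {R : realType} {X : pmetricType R}.
Variables (m : borel_measure R (@open X)) (p : R).
Hypothesis p1 : (1 <= p)%R.
Implicit Types (f g : X -> \bar R) (G : set (X -> \bar R)).
Local Open Scope ereal_scope.

Lemma sobolev_norm_ge0 f G : 0 <= sobolev_norm m p f G.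
Proof.
apply: adde_ge0; first exact: Lnorm_ge0.
by apply: le_ereal_inf_tmp => _ [g _ <-]; exact: Lnorm_ge0.
Qed.

Lemma sobolev_norm_subset f G G' : G `<=` G' ->
  sobolev_norm m p f G' <= sobolev_norm m p f G.
Proof.
by move=> GG'; rewrite leeD2l//; apply: ereal_inf_le_tmp; exact: image_subset.
Qed.

Lemma sobolev_norm_le f G g : G g -> sobolev_norm m p f G <= 'N[m]_p%:E[f] + 'N[m]_p%:E[g].
Proof. by move=> Gg; rewrite leeD2l//; apply: ereal_inf_lbound; exists g. Qed.

(** A gradient outside L^p has infinite norm, so only gradients in L^p have to be tested. *)
Lemma le_sobolev_norm (C : R) (x : \bar R) f G : (0 < C)%R ->
  (forall g, G g -> in_Lp m p g -> x <= C%:E * ('N[m]_p%:E[f] + 'N[m]_p%:E[g])) ->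
  x <= C%:E * sobolev_norm m p f G.
Proof.
(* The norm of [f] is written as an infimum over a singleton, to fit [le_ereal_infD]. *)
move=> C0 H; rewrite -lee_pdivrMl// /sobolev_norm -[X in _ <= X + _]ereal_inf1.
apply: le_ereal_infD.
- by move=> _ ->; exact: Lnorm_ge0.
- by move=> _ [g _ <-]; exact: Lnorm_ge0.
move=> _ _ -> [g Gg <-]; rewrite lee_pdivrMl//.
have [Lg|Lg] := pselect (in_Lp m p g); first exact: H.
have -> : 'N[m]_p%:E[g] = +oo.
  by apply/eqP; rewrite -leye_eq leNgt; apply/negP => /(in_Lp_lty _ p1).
by rewrite ge0_addey ?Lnorm_ge0// gt0_muley ?leey.
Qed.

End sobolev_norm.

Section gradient_space.
Context {R : realType} {X : pmetricType R}.
Variables (m : borel_measure R (@open X)) (p : R).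
Hypothesis p1 : (1 <= p)%R.
Local Open Scope ereal_scope.

(** Shared by the three kinds of gradients along curves, so that linearity and the lift of Hajlasz
    functions are proved once. [grad_true] is the entry point of the lift: an inequality along every
    curve gives a gradient in each of the three senses. *)
Record gradient_axioms (P : (X -> R) -> Prop)
    (G : (X -> R) -> set (X -> \bar R)) : Prop := GradientAxioms {
  grad_borel : forall f : X -> R, borel_fun (@open X) f -> P f;
  grad_measurable : forall f, P f ->
    measurable_fun [set: g_sigma_algebraType (bm_sets m)] f;
  grad_addP : forall f g, P f -> P g -> P (f \+ g)%R;
  grad_scaleP : forall c f, P f -> P (c \*o f)%R;
  grad_nonneg : forall f g, G f g -> borel_nonneg g;
  grad_true : forall (f : X -> R) (g : X -> \bar R), borel_nonneg g ->
    (forall c : test_curve X, `|f (c 1%R) - f (c 0%R)|%:E <= sym_curve_integral c g) -> G f g;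
  gradD : forall f f' g g', P f -> P f' -> G f g -> G f' g' ->
    G (f \+ f')%R (g \+ g')%E;
  gradZ : forall c f g, P f -> G f g -> G (c \*o f)%R (fun x => `|c|%:E * g x) }.

Variables (P : (X -> R) -> Prop) (G : (X -> R) -> set (X -> \bar R)).
Hypothesis axG : gradient_axioms P G.
Let S := gradient_space m p P G.
Let N f := sobolev_norm m p (EFin \o f) (G f).

Let mP f : P f -> measurable_fun [set: g_sigma_algebraType (bm_sets m)] (EFin \o f).
Proof. by move=> /(grad_measurable axG) mf; exact/measurable_EFinP. Qed.

Let mG f g : G f g -> measurable_fun [set: g_sigma_algebraType (bm_sets m)] g.
Proof. by move=> /(grad_nonneg axG)[bg _]; exact: borel_measurable. Qed.

Let G0 : G (cst 0%R) (cst 0).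
Proof.
apply: (grad_true axG); first exact: borel_nonneg0.
by move=> c; rewrite subrr normr0; apply: sym_curve_integral_ge0.
Qed.

Let N0 : N (cst 0%R) = 0.
Proof.
apply/eqP; rewrite eq_le sobolev_norm_ge0 andbT.
have pn0 : p%:E != 0 by rewrite eqe gt_eqF// (lt_le_trans ltr01).
apply: (le_trans (sobolev_norm_le m p (EFin \o cst 0%R) G0)).
by rewrite (_ : EFin \o cst 0%R = cst 0)// Lnorm0// adde0.
Qed.

Let ND f f' : P f -> P f' -> N (f \+ f')%R <= N f + N f'.
Proof.
move=> Pf Pf'; rewrite /N /sobolev_norm addeACA; apply: leeD.
  exact: (Lnorm_minkowski m p1 (mP Pf) (mP Pf')).
apply: le_ereal_infD.
- by move=> _ [g _ <-]; exact: Lnorm_ge0.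
- by move=> _ [g _ <-]; exact: Lnorm_ge0.
move=> _ _ [g Gg <-] [g' Gg' <-].
apply: le_trans (Lnorm_minkowski m p1 (mG Gg) (mG Gg')).
by apply: ereal_inf_lbound; exists (g \+ g') => //; exact: gradD axG _ _ _ _ Pf Pf' Gg Gg'.
Qed.

Let NZ c f : fs_mem S f -> N (c \*o f)%R <= `|c|%:E * N f.
Proof.
move=> [Pf _ [g0 Gg0 _]].
have [->|c0] := eqVneq c 0%R.
  rewrite (_ : (0 \*o f)%R = cst 0%R); last by apply/funext => x; rewrite /= mul0r.
  by rewrite N0 normr0 mul0e.
have nc0 : (0 < `|c|)%R by rewrite normr_gt0.
apply: le_sobolev_norm => // g Gg _.
apply: (le_trans (sobolev_norm_le m p (EFin \o (c \*o f)%R) (gradZ axG c Pf Gg))).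
rewrite ge0_muleDr ?Lnorm_ge0//; apply: leeD.
  rewrite (_ : EFin \o _ = (fun x => c%:E * (EFin \o f) x)); last by apply/funext => x; rewrite /= EFinM.
  by rewrite LnormZE//; exact: mP.
by rewrite LnormZE ?normr_id//; exact: mG Gg.
Qed.

Lemma gradient_memD f f' : fs_mem S f -> fs_mem S f' -> fs_mem S (f \+ f')%R.
Proof.
move=> [Pf Lf [g Gg Lg]] [Pf' Lf' [g' Gg' Lg']]; split.
- exact: grad_addP axG _ _ Pf Pf'.
- apply/in_Lp_lty => //; apply: (le_lt_trans (Lnorm_minkowski m p1 (mP Pf) (mP Pf'))).
  by apply: lte_add_pinfty; apply/in_Lp_lty.
exists (g \+ g'); first exact: gradD axG _ _ _ _ Pf Pf' Gg Gg'.
by apply: in_LpD => //; apply: grad_nonneg axG _ _ _; eassumption.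
Qed.

Lemma gradient_memZ c f : fs_mem S f -> fs_mem S (c \*o f)%R.
Proof.
move=> [Pf Lf [g Gg Lg]]; split.
- exact: grad_scaleP axG _ _ Pf.
- rewrite (_ : EFin \o _ = (fun x => c%:E * (EFin \o f) x)); last by apply/funext => x; rewrite /= EFinM.
  apply/in_Lp_lty => //; rewrite LnormZE//; last exact: mP.
  by rewrite lte_mul_pinfty//; apply/in_Lp_lty.
exists (fun x => `|c|%:E * g x); first exact: gradZ axG _ _ _ Pf Gg.
by apply: in_LpZ => //; exact: grad_nonneg axG _ _ Gg.
Qed.

Let subE f f' : (f \- f')%R = (f \+ (-1 \*o f'))%R :> (X -> R).
Proof. by apply/funext => x; rewrite /= mulN1r. Qed.

Let memB f f' : fs_mem S f -> fs_mem S f' -> fs_mem S (f \- f')%R.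
Proof. by move=> Sf Sf'; rewrite subE; apply: gradient_memD => //; exact: gradient_memZ. Qed.

Let SP f : fs_mem S f -> P f. Proof. by case. Qed.

Let N_eq0 f : N f <= 0 -> N f = 0.
Proof. by move=> h; apply/eqP; rewrite eq_le h sobolev_norm_ge0. Qed.

Lemma gradient_space_linear : linear_quotient S.
Proof.
split; split.
- split; [by apply: (grad_borel axG); exact: measurable_cst| |].
    exact: in_Lp0.
  by exists (cst 0) => //; exact: in_Lp0.
- exact: gradient_memD.
- exact: gradient_memZ.
- move=> f Sf; rewrite /= -/(N _) (_ : (f \- f)%R = cst 0%R)//.
  by apply/funext => x; rewrite /= subrr.
- move=> f g Sf Sg; rewrite /= -!/(N _) => e; apply: N_eq0.
  rewrite (_ : (g \- f)%R = (-1 \*o (f \- g))%R); last first.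
    by apply/funext => x; rewrite /= mulN1r opprB.
  by apply: (le_trans (NZ _ (memB Sf Sg))); rewrite e mule0.
- move=> f g h Sf Sg Sh; rewrite /= -!/(N _) => e1 e2; apply: N_eq0.
  rewrite (_ : (f \- h)%R = ((f \- g) \+ (g \- h))%R); last first.
    by apply/funext => x; rewrite /= addrA subrK.
  by apply: (le_trans (ND (SP (memB Sf Sg)) (SP (memB Sg Sh)))); rewrite e1 e2 adde0.
- move=> f f' g g' Sf Sf' Sg Sg'; rewrite /= -!/(N _) => e1 e2; apply: N_eq0.
  rewrite (_ : ((f \+ g) \- (f' \+ g'))%R = ((f \- f') \+ (g \- g'))%R); last first.
    by apply/funext => x; rewrite /= opprD addrACA.
  by apply: (le_trans (ND (SP (memB Sf Sf')) (SP (memB Sg Sg')))); rewrite e1 e2 adde0.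
- move=> c f f' Sf Sf'; rewrite /= -!/(N _) => e; apply: N_eq0.
  rewrite (_ : ((c \*o f) \- (c \*o f'))%R = (c \*o (f \- f'))%R); last first.
    by apply/funext => x; rewrite /= mulrBr.
  by apply: (le_trans (NZ _ (memB Sf Sf'))); rewrite e mule0.
Qed.

Lemma gradient_eqv_ae f g : fs_mem S f -> fs_mem S g -> fs_eqv S f g ->
  {ae m, forall x, f x = g x}.
Proof.
move=> Sf Sg /eqP; rewrite /= /sobolev_norm padde_eq0; last 2 first.
- exact: Lnorm_ge0.
- by apply: le_ereal_inf_tmp => _ [h _ <-]; exact: Lnorm_ge0.
move=> /andP[/eqP e _].
have [Pfg _ _] := memB Sf Sg.
have p0 : 0 < p%:E by rewrite lte_fin (lt_le_trans ltr01).
apply: ae_mono (Lnorm_eq0_eq0 (mP Pfg) p0 e) => x /(_ I) /= [] /eqP.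
by rewrite subr_eq0 => /eqP.
Qed.

(** The L^p part of the seminorm of the difference vanishes. That 0 is also a gradient of it is
    where the spaces differ, and is left as a hypothesis. *)
Lemma gradient_ae_eqv f g : fs_mem S f -> fs_mem S g ->
  {ae m, forall x, f x = g x} ->
  (forall h, fs_mem S h -> {ae m, forall x, h x = 0%R} -> G h (cst 0)) ->
  fs_eqv S f g.
Proof.
move=> Sf Sg fg H; have Sh := memB Sf Sg.
have h0 : {ae m, forall x, (f \- g)%R x = 0%R}.
  by apply: ae_mono fg => x /= ->; rewrite subrr.
rewrite /= -/(N _); apply: N_eq0.
apply: (le_trans (sobolev_norm_le _ _ _ (H _ Sh h0))).
have pn0 : p%:E != 0 by rewrite eqe gt_eqF// (lt_le_trans ltr01).
rewrite Lnorm0// adde0 Lnorm0_ae//; last exact: mP (SP Sh).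
by apply: ae_mono h0 => x /= ->.
Qed.

End gradient_space.

Section hajlasz_space.
Context {R : realType} {X : pmetricType R}.
Variables (m : borel_measure R (@open X)) (p : R).
Hypothesis p1 : (1 <= p)%R.
Implicit Types f g : X -> \bar R.
Local Open Scope ereal_scope.
Let S := hajlasz_space m p.

Lemma hajlasz_gradientP f g : hajlasz_gradient m f g <->
  [/\ measurable_fun [set: g_sigma_algebraType (bm_sets m)] g,
    forall x, 0 <= g x &
    exists Q : X -> Prop, {ae m, forall x, Q x} /\
      forall x y, Q x -> Q y -> `|f x - f y| <= (g x + g y) * (mdist x y)%:E].
Proof.
split=> -[mg g0 H]; split => //.
  have [E [mE E0] HE] := H; exists (fun x => ~ E x); split => //.
  exact: ae_of_null mE E0 _.
have [Q [Qae HQ]] := H; have [E [mE E0 HE]] := null_of_ae Qae.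
by exists E => // x y /HE Qx /HE Qy; exact: HQ.
Qed.

Lemma hajlasz_gradientD f f' g g' :
  {ae m, forall x, f x \is a fin_num} -> {ae m, forall x, f' x \is a fin_num} ->
  hajlasz_gradient m f g -> hajlasz_gradient m f' g' ->
  hajlasz_gradient m (f \+ f') (g \+ g').
Proof.
move=> ff ff' /hajlasz_gradientP[mg g0 [Q [Qae HQ]]] /hajlasz_gradientP[mg' g'0 [Q' [Qae' HQ']]].
apply/hajlasz_gradientP; split; first exact: emeasurable_funD.
  by move=> x; rewrite adde_ge0.
exists (fun x => (f x \is a fin_num /\ f' x \is a fin_num) /\ (Q x /\ Q' x)); split.
  by apply: ae_and; exact: ae_and.
move=> x y [[fx fx'] [Qx Qx']] [[fy fy'] [Qy Qy']] /=.
rewrite (_ : g x + g' x + (g y + g' y) = (g x + g y) + (g' x + g' y)); last by rewrite addeACA.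
rewrite ge0_muleDl ?adde_ge0//.
rewrite (_ : _ - _ = (f x - f y) + (f' x - f' y)); last by rewrite fin_num_oppeD// addeACA.
by apply: (le_trans (lee_abs_add _ _)); apply: leeD; [exact: HQ|exact: HQ'].
Qed.

Lemma hajlasz_gradientZ (c : R) f g : {ae m, forall x, f x \is a fin_num} ->
  hajlasz_gradient m f g ->
  hajlasz_gradient m (fun x => c%:E * f x) (fun x => `|c|%:E * g x).
Proof.
move=> ff /hajlasz_gradientP[mg g0 [Q [Qae HQ]]].
apply/hajlasz_gradientP; split; first exact: measurable_funeM.
  by move=> x; rewrite mule_ge0.
exists (fun x => f x \is a fin_num /\ Q x); split; first exact: ae_and.
move=> x y [fx Qx] [fy Qy].
rewrite -ge0_muleDr// -muleA (_ : _ - _ = c%:E * (f x - f y)).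
  by rewrite abseM lee_wpmul2l//; exact: HQ.
by rewrite -(fineK fx) -(fineK fy) -!EFinM -!EFinB mulrBr.
Qed.

Lemma hajlasz_space_linear : linear_quotient S.
Proof.
split; split.
- split; [exact: measurable_cst|by apply: aeW|exact: in_Lp0|].
  exists (cst 0); last exact: in_Lp0.
  apply/hajlasz_gradientP; split; [exact: measurable_cst|by []|].
  exists (fun=> True); split; first exact: aeW.
  move=> x y _ _; apply: (@le_trans _ _ 0); last by rewrite mule_ge0 ?lee_fin ?mdist_ge0.
  by rewrite [X in `|X|](_ : _ = 0) ?abse0// -[RHS](@subee _ (0 : \bar R)).
- move=> f f' [mf ff Lf [g fg Lg]] [mf' ff' Lf' [g' fg' Lg']].
  have mg : measurable_fun [set: g_sigma_algebraType (bm_sets m)] g by case: fg.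
  have mg' : measurable_fun [set: g_sigma_algebraType (bm_sets m)] g' by case: fg'.
  have LD h h' : measurable_fun [set: g_sigma_algebraType (bm_sets m)] h ->
      measurable_fun [set: g_sigma_algebraType (bm_sets m)] h' ->
      in_Lp m p h -> in_Lp m p h' -> in_Lp m p (h \+ h').
    move=> mh mh' /(in_Lp_lty _ p1) Lh /(in_Lp_lty _ p1) Lh'; apply/(in_Lp_lty _ p1).
    by apply: (le_lt_trans (Lnorm_minkowski m p1 mh mh')); exact: lte_add_pinfty.
  split; [exact: emeasurable_funD| |exact: LD|].
    by apply: ae_mono (ae_and ff ff') => x [fx fx'] /=; rewrite fin_numD fx.
  by exists (g \+ g'); [exact: hajlasz_gradientD|exact: LD].
- move=> c f [mf ff Lf [g fg Lg]].
  have mg : measurable_fun [set: g_sigma_algebraType (bm_sets m)] g by case: fg.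
  have LZ k h : measurable_fun [set: g_sigma_algebraType (bm_sets m)] h ->
      in_Lp m p h -> in_Lp m p (fun x => k%:E * h x).
    move=> mh /(in_Lp_lty _ p1) Lh; apply/(in_Lp_lty _ p1).
    by rewrite LnormZE// lte_mul_pinfty.
  split; [exact: measurable_funeM| |exact: LZ|].
    by apply: ae_mono ff => x fx; rewrite fin_numM.
  by exists (fun x => `|c|%:E * g x); [exact: hajlasz_gradientZ|exact: LZ].
- by move=> f _; apply: aeW.
- by move=> f g _ _; apply: ae_mono => x ->.
- by move=> f g h _ _ _ fg gh; apply: ae_mono (ae_and fg gh) => x [-> ->].
- by move=> f f' g g' _ _ _ _ ff gg; apply: ae_mono (ae_and ff gg) => x /= [-> ->].
- by move=> c f f' _ _; apply: ae_mono => x /= ->.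
Qed.

End hajlasz_space.

Section gradient_to_hajlasz.
Context {R : realType} {X : pmetricType R}.
Variables (m : borel_measure R (@open X)) (p : R).
Hypothesis p1 : (1 <= p)%R.
Variables (P : (X -> R) -> Prop) (G : (X -> R) -> set (X -> \bar R)).
Hypothesis axG : gradient_axioms m P G.
Hypothesis GH : forall f g, P f -> G f g -> hajlasz_gradient m (EFin \o f) g.
Let S := gradient_space m p P G.
Local Open Scope ereal_scope.

Definition EFin_rel (f : fs_sort S) (f' : fs_sort (hajlasz_space m p)) : Prop :=
  f' = EFin \o f.

Lemma gradient_hajlasz_mem f : fs_mem S f -> fs_mem (hajlasz_space m p) (EFin \o f).
Proof.
move=> [Pf Lf [g Gg Lg]]; split => //.
- by apply/measurable_EFinP; exact: grad_measurable axG _ Pf.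
- exact: aeW.
by exists g => //; exact: GH Pf Gg.
Qed.

Lemma EFin_rel_well_defined : well_defined EFin_rel.
Proof.
split=> [f Sf|f g _ _ Sf Sg _ _ -> -> fg].
  by exists (EFin \o f) => //; exact: gradient_hajlasz_mem.
by apply: ae_mono (gradient_eqv_ae p1 axG Sf Sg fg) => x /= ->.
Qed.

Lemma EFin_rel_bounded_linear : bounded_linear (natural_map EFin_rel).
Proof.
apply: (natural_map_bounded_linear (gradient_space_linear p1 axG) (hajlasz_space_linear m p1)
  EFin_rel_well_defined ltr01).
- by move=> f g _ _ _ _ _ _ -> ->.
- by move=> c f _ _ _ ->.
move=> f Sf; rewrite mul1e.
apply: (@le_trans _ _ (sobolev_norm m p (EFin \o f) (hajlasz_gradient m (EFin \o f)))).
  apply: ereal_inf_lbound; exists (EFin \o f) => //; split => //.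
  exact: gradient_hajlasz_mem.
apply: sobolev_norm_subset => g Gg; apply: GH Gg.
by case: Sf.
Qed.

End gradient_to_hajlasz.

Section instances.
Context {R : realType} {X : pmetricType R}.
Variables (m : borel_measure R (@open X)) (p : R).
Hypothesis p1 : (1 <= p)%R.
Implicit Types (f : X -> R) (g : X -> \bar R) (mu : borel_measure R (@TC_open R X)).
Local Open Scope ereal_scope.

Let sym_measure_ge0 mu g : borel_nonneg g -> 0 <= sym_measure_integral mu g.
Proof. by move=> bg; apply: integral_ge0 => c _; apply: sym_curve_integral_ge0; exact: bg.2. Qed.

(** The oscillations of Borel functions are measurable, so their integrals add up exactly; on the
    side of the gradients superadditivity is enough. *)
Lemma curve_oscillationD mu f f' g g' : borel_fun (@open X) f -> borel_fun (@open X) f' ->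
  borel_nonneg g -> borel_nonneg g' ->
  curve_oscillation f mu <= sym_measure_integral mu g ->
  curve_oscillation f' mu <= sym_measure_integral mu g' ->
  curve_oscillation (f \+ f')%R mu <= sym_measure_integral mu (g \+ g').
Proof.
move=> bf bf' bg bg' H H'.
apply: le_trans (sym_measure_integralD mu bg bg'); apply: le_trans (leeD H H').
rewrite /curve_oscillation -ge0_integralD//; last 2 first.
- exact: measurable_oscillation.
- exact: measurable_oscillation.
apply: ge0_lower_integral_le => c //.
by rewrite -EFinD lee_fin /= opprD addrACA ler_normD.
Qed.

Lemma curve_oscillationZ mu (c : R) f g : borel_fun (@open X) f -> borel_nonneg g ->
  curve_oscillation f mu <= sym_measure_integral mu g ->
  curve_oscillation (c \*o f)%R mu <= sym_measure_integral mu (fun x => `|c|%:E * g x).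
Proof.
move=> bf bg H.
have E : curve_oscillation (c \*o f)%R mu = `|c|%:E * curve_oscillation f mu.
  rewrite /curve_oscillation -ge0_integralZl//; last exact: measurable_oscillation.
  by apply: eq_integral => a _; rewrite -EFinM -normrM /= mulrBr.
rewrite E; have [->|c0] := eqVneq c 0%R.
  by rewrite normr0 mul0e sym_measure_ge0//; exact: borel_nonnegZ.
have nc0 : (0 < `|c|)%R by rewrite normr_gt0.
by apply: le_trans (sym_measure_integralZ mu nc0 bg); rewrite lee_pmul2l.
Qed.

Lemma curve_oscillation_le mu f g : borel_nonneg g ->
  (forall c : test_curve X, `|f (c 1%R) - f (c 0%R)|%:E <= sym_curve_integral c g) ->
  curve_oscillation f mu <= sym_measure_integral mu g.
Proof. by move=> bg H; apply: ge0_lower_integral_le. Qed.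

Lemma TC_axioms : gradient_axioms m
  (fun f => measurable_fun [set: g_sigma_algebraType (bm_sets m)] f)
  (weak_upper_gradient m p).
Proof.
split.
- by move=> f; exact: borel_measurable.
- by [].
- by move=> f g; exact: measurable_funD.
- by move=> c f mf; exact: measurable_funM.
- by move=> f g [].
- move=> f g bg H; apply/weak_upper_gradientP => //; split => //; exists (cst 0).
  by split; [exact: borel_nonneg0|exact: in_Lp0|move=> c _; exact: H].
- move=> f f' g g' _ _ /(weak_upper_gradientP _ p1)[bg [r [br Lr H]]] /(weak_upper_gradientP _ p1)[bg' [r' [br' Lr' H']]].
  apply/(weak_upper_gradientP _ p1); split; first exact: borel_nonnegD.
  exists (r \+ r'); split; [exact: borel_nonnegD|exact: in_LpD|move=> c].
  rewrite !sym_curve_integralD// => rr.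
  have r0 := sym_curve_integral_ge0 c br.2; have r'0 := sym_curve_integral_ge0 c br'.2.
  apply: le_trans (leeD (H c _) (H' c _)).
  + by rewrite -EFinD lee_fin /= opprD addrACA ler_normD.
  + by apply: le_lt_trans rr; rewrite leeDl.
  + by apply: le_lt_trans rr; rewrite leeDr.
- move=> c f g _ /(weak_upper_gradientP _ p1)[bg [r [br Lr H]]].
  apply/(weak_upper_gradientP _ p1); split; first exact: borel_nonnegZ.
  exists r; split => // a /H Ha; rewrite sym_curve_integralZ//.
  by rewrite /= -mulrBr normrM EFinM lee_wpmul2l.
Qed.

Lemma hTC_axioms : gradient_axioms m (fun f => borel_fun (@open X) f)
  (generalized_weak_upper_gradient m p).
Proof.
split.
- by [].
- by move=> f; exact: borel_measurable.
- by move=> f g; exact: measurable_funD.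
- by move=> c f mf; exact: measurable_funM.
- by move=> f g [].
- move=> f g bg H; apply/generalized_weak_upper_gradientP => //; split => //; exists (cst 0).
  split; [exact: borel_nonneg0|exact: in_Lp0|move=> mu _ _].
  exact: curve_oscillation_le.
- move=> f f' g g' bf bf' /(generalized_weak_upper_gradientP _ p1)[bg [r [br Lr H]]] /(generalized_weak_upper_gradientP _ p1)[bg' [r' [br' Lr' H']]].
  apply/(generalized_weak_upper_gradientP _ p1); split; first exact: borel_nonnegD.
  exists (r \+ r'); split; [exact: borel_nonnegD|exact: in_LpD|move=> mu mu0 rr].
  have brr := borel_nonnegD br br'.
  apply: curve_oscillationD => //.
  + apply: H => //; apply: le_lt_trans rr; apply: sym_measure_integral_le => // x.
    by rewrite /= leeDl// br'.2.
  + apply: H' => //; apply: le_lt_trans rr; apply: sym_measure_integral_le => // x.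
    by rewrite /= leeDr// br.2.
- move=> c f g bf /(generalized_weak_upper_gradientP _ p1)[bg [r [br Lr H]]].
  apply/(generalized_weak_upper_gradientP _ p1); split; first exact: borel_nonnegZ.
  exists r; split => // mu mu0 /(H _ mu0) Hm; exact: curve_oscillationZ.
Qed.

Lemma ags_axioms : gradient_axioms m (fun f => borel_fun (@open X) f) (m_upper_gradient m).
Proof.
split.
- by [].
- by move=> f; exact: borel_measurable.
- by move=> f g; exact: measurable_funD.
- by move=> c f mf; exact: measurable_funM.
- by move=> f g [].
- by move=> f g bg H; split => // mu _ _; exact: curve_oscillation_le.
- move=> f f' g g' bf bf' [bg H] [bg' H']; split; first exact: borel_nonnegD.
  by move=> mu mu0 adm; apply: curve_oscillationD => //; [exact: H|exact: H'].
- move=> c f g bf [bg H]; split; first exact: borel_nonnegZ.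
  by move=> mu mu0 adm; apply: curve_oscillationZ => //; exact: H.
Qed.

Lemma borel_null_set f : borel_fun (@open X) f -> {ae m, forall x, f x = 0%R} ->
  exists N : set X, [/\ <<s @open X >> N, m N = 0 & forall x, ~ N x -> f x = 0%R].
Proof.
move=> bf f0; exists (f @^-1` [set~ 0%R]); split.
- have := bf measurableT [set~ 0%R] (measurableC (measurable_set1 0%R)).
  by rewrite setTI.
- have bN : <<s @open X >> (f @^-1` [set~ 0%R]).
    have := bf measurableT [set~ 0%R] (measurableC (measurable_set1 0%R)).
    by rewrite setTI.
  apply: measure_negligible; first by rewrite /measurable /= bm_setsE; exact: borel_bm.
  exact: f0.
- by move=> x /= /contrapT.
Qed.

Let hTC := newtonian_hTC m p.
Let TC := newtonian_TC m p.
Let AGS := ags_space m p.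

Lemma hTC_ae_eqv (f g : X -> R) : fs_mem hTC f -> fs_mem hTC g ->
  {ae m, forall x, f x = g x} -> fs_eqv hTC f g.
Proof.
move=> Sf Sg fg; apply: (gradient_ae_eqv p1 hTC_axioms Sf Sg fg) => h [bh _ [k Gk Lk]] h0.
have [N [bN N0 hN]] := borel_null_set bh h0.
exact: (generalized_weak_upper_gradient_null p1 Gk Lk bh bN N0 hN).
Qed.

Lemma ags_ae_eqv (f g : X -> R) : fs_mem AGS f -> fs_mem AGS g ->
  {ae m, forall x, f x = g x} -> fs_eqv AGS f g.
Proof.
move=> Sf Sg fg; apply: (gradient_ae_eqv p1 ags_axioms Sf Sg fg) => h [bh _ [k Gk Lk]] h0.
have [N [bN N0 hN]] := borel_null_set bh h0.
exact: (m_upper_gradient_null bh bN N0 hN).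
Qed.

(** A function that is only measurable may be nonzero on a set that is not Borel; Borel regularity
    encloses this set in a Borel null set. For the Borel functions of the two preceding lemmas that
    set is itself Borel. *)
Lemma TC_ae_eqv (f g : X -> R) : borel_regular m -> fs_mem TC f -> fs_mem TC g ->
  {ae m, forall x, f x = g x} -> fs_eqv TC f g.
Proof.
move=> mreg Sf Sg fg; apply: (gradient_ae_eqv p1 TC_axioms Sf Sg fg) => h [bh _ [k Gk Lk]] h0.
have [N [bN N0 hN]] := negligible_borel_hull mreg h0.
apply: (weak_upper_gradient_null p1 Gk Lk bN N0) => x Nx.
by apply: contrapT => hx; apply: Nx; exact: hN.
Qed.

Lemma hTC_TC_mem f : fs_mem hTC f -> fs_mem TC f.
Proof.
move=> [bf Lf [g Gg Lg]]; split => //; first exact: borel_measurable.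
by exists g => //; exact: generalized_weak_upper_gradientW.
Qed.

Let hTC_TC_norm f : fs_norm TC f <= fs_norm hTC f.
Proof. by apply: sobolev_norm_subset => g; exact: generalized_weak_upper_gradientW. Qed.

Lemma hTC_TC_eqv (f g : X -> R) : fs_eqv hTC f g -> fs_eqv TC f g.
Proof.
move=> e; apply/eqP; rewrite eq_le sobolev_norm_ge0 andbT -[X in _ <= X]e.
exact: hTC_TC_norm.
Qed.

Lemma hTC_TC_well_defined : well_defined (hTC_TC_rel m p).
Proof.
split=> [f Sf|f g _ _ _ _ _ _ -> ->]; last exact: hTC_TC_eqv.
by exists f => //; exact: hTC_TC_mem.
Qed.

Lemma hTC_TC_bounded_linear : bounded_linear (hTC_to_TC m p).
Proof.
apply: (natural_map_bounded_linear (gradient_space_linear p1 hTC_axioms)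
  (gradient_space_linear p1 TC_axioms) hTC_TC_well_defined ltr01).
- by move=> f g _ _ _ _ _ _ -> ->.
- by move=> c f _ _ _ ->.
move=> f Sf; rewrite mul1e; apply: le_trans (hTC_TC_norm f).
by apply: ereal_inf_lbound; exists f => //; split => //; exact: hTC_TC_mem.
Qed.

Lemma hTC_TC_inj : set_inj (fs_quot hTC) (hTC_to_TC m p).
Proof.
apply: (natural_map_inj (gradient_space_linear p1 hTC_axioms)
  (gradient_space_linear p1 TC_axioms) hTC_TC_well_defined).
move=> f g _ _ Sf Sg _ _ -> -> fg; apply: hTC_ae_eqv => //.
by apply: (gradient_eqv_ae p1 TC_axioms) => //; exact: hTC_TC_mem.
Qed.

Let GH_TC f g (_ : measurable_fun [set: g_sigma_algebraType (bm_sets m)] f) :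
  weak_upper_gradient m p f g -> hajlasz_gradient m (EFin \o f) g.
Proof. exact: weak_upper_gradient_hajlasz. Qed.

Let GH_hTC f g (_ : borel_fun (@open X) f) :
  generalized_weak_upper_gradient m p f g -> hajlasz_gradient m (EFin \o f) g.
Proof. by move=> /(generalized_weak_upper_gradientW p1); exact: weak_upper_gradient_hajlasz. Qed.

Lemma TC_hajlasz_well_defined : well_defined (TC_hajlasz_rel m p).
Proof. exact: (EFin_rel_well_defined p1 TC_axioms GH_TC). Qed.

Lemma TC_hajlasz_bounded_linear : bounded_linear (TC_to_hajlasz m p).
Proof. exact: (EFin_rel_bounded_linear p1 TC_axioms GH_TC). Qed.

Lemma hTC_hajlasz_well_defined : well_defined (hTC_hajlasz_rel m p).
Proof. exact: (EFin_rel_well_defined p1 hTC_axioms GH_hTC). Qed.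

Lemma hTC_hajlasz_bounded_linear : bounded_linear (hTC_to_hajlasz m p).
Proof. exact: (EFin_rel_bounded_linear p1 hTC_axioms GH_hTC). Qed.

Let ae_EFin (f g : X -> R) : {ae m, forall x, (EFin \o f) x = (EFin \o g) x} ->
  {ae m, forall x, f x = g x}.
Proof. by apply: ae_mono => x []. Qed.

Lemma hTC_hajlasz_inj : set_inj (fs_quot hTC) (hTC_to_hajlasz m p).
Proof.
apply: (natural_map_inj (gradient_space_linear p1 hTC_axioms)
  (hajlasz_space_linear m p1) hTC_hajlasz_well_defined).
by move=> f g _ _ Sf Sg _ _ -> -> /ae_EFin fg; exact: hTC_ae_eqv.
Qed.

Lemma TC_hajlasz_inj : borel_regular m -> set_inj (fs_quot TC) (TC_to_hajlasz m p).
Proof.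
move=> mreg; apply: (natural_map_inj (gradient_space_linear p1 TC_axioms)
  (hajlasz_space_linear m p1) TC_hajlasz_well_defined).
by move=> f g _ _ Sf Sg _ _ -> -> /ae_EFin fg; exact: TC_ae_eqv.
Qed.

Lemma TC_hajlasz_kernel :
  [set a | fs_quot TC a /\ TC_to_hajlasz m p a = class_zero (hajlasz_space m p)] =
  [set fs_class TC f | f in
     [set f : X -> R | fs_mem TC f /\ {ae m, forall x, f x = 0%R}]].
Proof.
have lM := hajlasz_space_linear m p1; have lT := gradient_space_linear p1 TC_axioms.
have M0 := lM.1; have {}M0 : fs_mem (hajlasz_space m p) (fs_zero (hajlasz_space m p)).
  by case: M0.
have TE f : fs_mem TC f -> TC_to_hajlasz m p (fs_class TC f) = fs_class (hajlasz_space m p) (EFin \o f).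
  move=> Sf; apply: (natural_map_class lT lM TC_hajlasz_well_defined Sf) => //.
  exact: (gradient_hajlasz_mem TC_axioms GH_TC).
have E f : fs_mem TC f -> fs_mem (hajlasz_space m p) (EFin \o f).
  exact: (gradient_hajlasz_mem TC_axioms GH_TC).
apply/seteqP; split => [_ [[f Sf <-]]|_ [f [Sf f0] <-]].
  rewrite TE// => /(fs_class_eq lM (E _ Sf) M0) e; exists f => //; split => //.
  exact: ae_EFin.
split; first by exists f.
rewrite TE//; apply/(fs_class_eq lM (E _ Sf) M0).
by apply: ae_mono f0 => x /= ->.
Qed.

End instances.

(** * Lifting Hajlasz functions, and the isomorphisms *)

Section hajlasz_lift.
Context {R : realType} {X : pmetricType R}.
Variables (m : borel_measure R (@open X)) (p : R).
Hypothesis p1 : (1 <= p)%R.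
Hypotheses (msf : sigma_finite setT m) (mreg : borel_regular m).
Local Open Scope ereal_scope.
Let M := hajlasz_space m p.
Let C : R := (5 * 2 * 2)%R.

Let C0 : (0 < C)%R. Proof. by rewrite !mulr_gt0. Qed.

Section lift.
Variables (P : (X -> R) -> Prop) (G : (X -> R) -> set (X -> \bar R)).
Hypothesis axG : gradient_axioms m P G.
Let S := gradient_space m p P G.

(** The lift is the limit of McShane extensions built from an everywhere valid Borel version of
    [(f, g)]. It has upper gradient [C g0] along every curve, which [grad_true] turns into a
    gradient of the kind at hand. *)
Lemma hajlasz_lift (f g : X -> \bar R) : fs_mem M f ->
  hajlasz_gradient m f g -> in_Lp m p g ->
  exists f' : X -> R, [/\ fs_mem S f', {ae m, forall x, (f' x)%:E = f x} &
    fs_norm S f' <= C%:E * ('N[m]_p%:E[f] + 'N[m]_p%:E[g])].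
Proof.
move=> [mf ff Lf _] fg Lg; have mg : measurable_fun [set: g_sigma_algebraType (bm_sets m)] g by case: fg.
have [f0 [g0 [bf0 bg0 f0f g0g f0g0]]] := hajlasz_borel_representative mreg msf mf ff fg.
have g_fin : {ae m, forall x, g x \is a fin_num}.
  by apply: (Lnorm_lty_ae p1) => //; apply/(in_Lp_lty _ p1).
pose f' := mcshane_limit f0 g0.
pose h x : \bar R := C%:E * g0 x.
have bh : borel_nonneg h by apply: borel_nonnegZ => //; exact: ltW.
have mg0 := borel_measurable (m := m) bg0.1.
have bf' : borel_fun (@open X) f' by exact: (mcshane_limit_borel f0g0).
have f'f : {ae m, forall x, (f' x)%:E = f x}.
  apply: ae_mono (ae_and f0f (ae_and g0g g_fin)) => x [<- [gx gf]].
  by rewrite /f' (mcshane_limit_eq bg0 f0g0)// gx ltey_eq gf.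
have mf' : measurable_fun [set: g_sigma_algebraType (bm_sets m)] (EFin \o f').
  by apply/measurable_EFinP; exact: borel_measurable.
have Nf' : 'N[m]_p%:E[EFin \o f'] = 'N[m]_p%:E[f] by exact: (Lnorm_ae_eq p mf' mf f'f).
have Ng0 : 'N[m]_p%:E[g0] = 'N[m]_p%:E[g] by exact: (Lnorm_ae_eq p mg0 mg g0g).
have Lg0 : in_Lp m p g0 by apply/(in_Lp_lty _ p1); rewrite Ng0; apply/(in_Lp_lty _ p1).
have Gh : G f' h by apply: (grad_true axG) => // c; exact: mcshane_limit_gradient.
exists f'; split => //.
  split; first exact: grad_borel axG _ bf'.
    by apply/(in_Lp_lty _ p1); rewrite Nf'; apply/(in_Lp_lty _ p1).
  by exists h => //; exact: in_LpZ.
apply: (le_trans (sobolev_norm_le m p (EFin \o f') Gh)).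
rewrite Nf' /h (LnormZE m p1)// Ng0 gtr0_norm// ge0_muleDr ?Lnorm_ge0//.
(* The norm of [f] itself is unchanged and is absorbed by [C >= 1]. *)
apply: leeD => //; rewrite lee_pemull ?Lnorm_ge0// lee_fin /C; lra.
Qed.

Hypothesis aeG : forall f g, fs_mem S f -> fs_mem S g ->
  {ae m, forall x, f x = g x} -> fs_eqv S f g.

Definition ae_rel (f : fs_sort M) (f' : fs_sort S) : Prop :=
  {ae m, forall x, (f' x)%:E = f x}.

Lemma ae_rel_well_defined : well_defined ae_rel.
Proof.
split=> [f Mf|f g f' g' _ _ Sf' Sg' ff' gg' fg].
  have [_ _ _ [g fg Lg]] := Mf.
  by have [f' [Sf' f'f _]] := hajlasz_lift Mf fg Lg; exists f'.
apply: aeG => //; apply: ae_mono (ae_and (ae_and ff' gg') fg) => x [[f'x g'x] fgx].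
by apply: EFin_inj; rewrite f'x g'x.
Qed.

Lemma ae_rel_bounded_linear : bounded_linear (natural_map ae_rel).
Proof.
apply: (natural_map_bounded_linear (hajlasz_space_linear m p1) (gradient_space_linear p1 axG)
  ae_rel_well_defined C0).
- move=> f g f' g' _ _ _ _ ff' gg'.
  by apply: ae_mono (ae_and ff' gg') => x /= [<- <-]; rewrite -EFinD.
- by move=> c f f' _ _; apply: ae_mono => x /= <-; rewrite -EFinM.
move=> f Mf; apply: le_sobolev_norm => // g fg Lg.
have [f' [Sf' f'f Nf']] := hajlasz_lift Mf fg Lg.
by apply: le_trans Nf'; apply: ereal_inf_lbound; exists f'.
Qed.

End lift.

Lemma TC_hajlasz_isomorphism : bounded_isomorphism (TC_to_hajlasz m p).
Proof.
have aeG f g : fs_mem (newtonian_TC m p) f -> fs_mem (newtonian_TC m p) g ->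
  {ae m, forall x, f x = g x} -> fs_eqv (newtonian_TC m p) f g by exact: TC_ae_eqv.
have wd := ae_rel_well_defined (TC_axioms m p1) aeG.
have bl := ae_rel_bounded_linear (TC_axioms m p1) aeG.
apply: (natural_map_isomorphism (TC_hajlasz_well_defined m p1) wd (TC_hajlasz_bounded_linear m p1) bl).
- move=> f _ f'' Sf _ Sf'' -> ff; apply: aeG => //.
  by apply: ae_mono ff => x [].
- by move=> f f' _ _ _ _ ff ->; apply: ae_mono ff => x /= ->.
Qed.

Definition TC_hTC_rel (f : fs_sort (newtonian_TC m p)) (f' : fs_sort (newtonian_hTC m p)) : Prop :=
  {ae m, forall x, f' x = f x}.

(** The inverse passes through the Hajlasz space: a weak gradient is a Hajlasz gradient, and the
    lift provides a Borel representative with a gradient along measures. *)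
Lemma hTC_TC_isomorphism : bounded_isomorphism (hTC_to_TC m p).
Proof.
have lT := gradient_space_linear p1 (TC_axioms m p1).
have lh := gradient_space_linear p1 (hTC_axioms m p1).
have TM f : fs_mem (newtonian_TC m p) f -> fs_mem M (EFin \o f).
  by apply: (gradient_hajlasz_mem (TC_axioms m p1)) => ? ? _; exact: weak_upper_gradient_hajlasz.
have wd : well_defined TC_hTC_rel.
  split=> [f Sf|f g f' g' Sf Sg Sf' Sg' ff' gg' fg].
    have [_ _ _ [g fg Lg]] := TM _ Sf.
    have [f' [Sf' f'f _]] := hajlasz_lift (hTC_axioms m p1) (TM _ Sf) fg Lg.
    by exists f' => //; apply: ae_mono f'f => x [].
  apply: hTC_ae_eqv => //.
  have {}fg := gradient_eqv_ae p1 (TC_axioms m p1) Sf Sg fg.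
  by apply: ae_mono (ae_and (ae_and ff' gg') fg) => x [[-> ->]].
have bl : bounded_linear (natural_map TC_hTC_rel).
  apply: (natural_map_bounded_linear lT lh wd C0).
  - by move=> f g f' g' _ _ _ _ ff' gg'; apply: ae_mono (ae_and ff' gg') => x /= [-> ->].
  - by move=> c f f' _ _; apply: ae_mono => x /= ->.
  move=> f Sf; apply: le_sobolev_norm => // g fg Lg.
  have Hg : hajlasz_gradient m (EFin \o f) g by exact: (weak_upper_gradient_hajlasz p1 fg).
  have [f' [Sf' f'f Nf']] := hajlasz_lift (hTC_axioms m p1) (TM _ Sf) Hg Lg.
  apply: le_trans Nf'; apply: ereal_inf_lbound; exists f' => //; split => //.
  by apply: ae_mono f'f => x [].
apply: (natural_map_isomorphism (hTC_TC_well_defined m p1) wd (hTC_TC_bounded_linear m p1) bl).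
- move=> f f' f'' Sf _ Sf'' -> ff; apply: hTC_ae_eqv => //.
  by apply: ae_mono ff => x ->.
- move=> f f' f'' Sf _ Sf'' ff e; apply: TC_ae_eqv => //.
  by rewrite e; apply: ae_mono ff => x ->.
Qed.

Lemma hajlasz_ags_well_defined : well_defined (hajlasz_ags_rel m p).
Proof. by apply: (ae_rel_well_defined (ags_axioms m)); exact: ags_ae_eqv. Qed.

Lemma hajlasz_ags_bounded_linear : bounded_linear (hajlasz_to_ags m p).
Proof. by apply: (ae_rel_bounded_linear (ags_axioms m)); exact: ags_ae_eqv. Qed.

Lemma hajlasz_ags_inj : set_inj (fs_quot M) (hajlasz_to_ags m p).
Proof.
apply: (natural_map_inj (hajlasz_space_linear m p1)
  (gradient_space_linear p1 (ags_axioms m)) hajlasz_ags_well_defined).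
move=> f g f' g' Mf Mg Sf' Sg' ff' gg' fg.
have {}fg := gradient_eqv_ae p1 (ags_axioms m) Sf' Sg' fg.
by apply: ae_mono (ae_and (ae_and ff' gg') fg) => x [[<- <-] ->].
Qed.

(** Each m-upper gradient is itself a Hajlasz gradient, so the inverse sends a function to its
    almost everywhere class without increasing the norm. *)
Lemma hajlasz_ags_isomorphism : doubling m -> bounded_isomorphism (hajlasz_to_ags m p).
Proof.
move=> md.
have GH f g : borel_fun (@open X) f -> m_upper_gradient m f g ->
    hajlasz_gradient m (EFin \o f) g.
  move=> bf fg; exact: (m_upper_gradient_hajlasz (doubling_ball md) bf fg).
have wd := EFin_rel_well_defined p1 (ags_axioms m) GH.
have bl := EFin_rel_bounded_linear p1 (ags_axioms m) GH.
apply: (natural_map_isomorphism hajlasz_ags_well_defined wd hajlasz_ags_bounded_linear bl).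
- by move=> f f' _ _ _ _ ff ->; apply: ae_mono ff => x /= ->.
- move=> f _ f'' Sf _ Sf'' -> ff; apply: ags_ae_eqv => //.
  by apply: ae_mono ff => x [].
Qed.

End hajlasz_lift.

Theorem theorem7p2 (R : realType) (X : pmetricType R)
    (m : borel_measure R (@open X)) (p : R) (hp : 1 <= p) :
  [/\ (* (1) *)
      [/\ [/\ well_defined (hTC_TC_rel m p),
              bounded_linear (hTC_to_TC m p) &
              set_inj (fs_quot (newtonian_hTC m p)) (hTC_to_TC m p)],
          [/\ well_defined (TC_hajlasz_rel m p),
              bounded_linear (TC_to_hajlasz m p) &
              [set a | fs_quot (newtonian_TC m p) a /\
                 TC_to_hajlasz m p a = class_zero (hajlasz_space m p)] =
              [set fs_class (newtonian_TC m p) f | f in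
                 [set f : X -> R | fs_mem (newtonian_TC m p) f /\
                    {ae m, forall x, f x = 0}]]] &
          [/\ well_defined (hTC_hajlasz_rel m p),
              bounded_linear (hTC_to_hajlasz m p) &
              set_inj (fs_quot (newtonian_hTC m p))
                (hTC_to_hajlasz m p)]],
      (* (2) *)
      borel_regular m ->
        [/\ bounded_linear (hTC_to_TC m p),
            set_inj (fs_quot (newtonian_hTC m p)) (hTC_to_TC m p),
            bounded_linear (TC_to_hajlasz m p) &
            set_inj (fs_quot (newtonian_TC m p)) (TC_to_hajlasz m p)],
      (* (3) *)
      sigma_finite setT m -> borel_regular m ->
        [/\ bounded_isomorphism (hTC_to_TC m p),
            bounded_isomorphism (TC_to_hajlasz m p) &
            [/\ well_defined (hajlasz_ags_rel m p),
                bounded_linear (hajlasz_to_ags m p) &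
                set_inj (fs_quot (hajlasz_space m p))
                  (hajlasz_to_ags m p)]] &
      (* (4) *)
      doubling m -> borel_regular m ->
        [/\ bounded_isomorphism (hTC_to_TC m p),
            bounded_isomorphism (TC_to_hajlasz m p),
            well_defined (hajlasz_ags_rel m p) &
            bounded_isomorphism (hajlasz_to_ags m p)]].
Proof.
have b1 := hTC_TC_bounded_linear m hp; have i1 := @hTC_TC_inj _ _ m _ hp.
have b2 := TC_hajlasz_bounded_linear m hp.
split; [split; split => //| | |].
- exact: hTC_TC_well_defined.
- exact: TC_hajlasz_well_defined.
- exact: TC_hajlasz_kernel.
- exact: hTC_hajlasz_well_defined.
- exact: hTC_hajlasz_bounded_linear.
- exact: hTC_hajlasz_inj.
- by move=> mreg; split => //; exact: TC_hajlasz_inj.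
- move=> msf mreg; split; [exact: hTC_TC_isomorphism|exact: TC_hajlasz_isomorphism|split].
  + exact: hajlasz_ags_well_defined.
  + exact: hajlasz_ags_bounded_linear.
  + exact: hajlasz_ags_inj.
(* Balls of finite measure around a fixed point exhaust the space, so the previous case applies. *)
move=> md mreg; have msf := ball_sigma_finite (doubling_ball md).
split; [exact: hTC_TC_isomorphism|exact: TC_hajlasz_isomorphism| |].
  exact: hajlasz_ags_well_defined.
exact: hajlasz_ags_isomorphism.
Qed.
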